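(* Let $\tau,\kappa>0$ be fixed and let the standing assumptions (A1)–(A5) listed in the context hold. For $N\ge N_1$ let $\mu_N$ be the probability measure on $\mathbb{R}^N$ with density proportional to $\exp\{-\Psi_N^{\mathrm{full}}(\vec f)\}$ with respect to Lebesgue measure. Then there exists a probability measure $\mu$ on $L^2$ such that the pushforwards $(\mathcal I_N)_\#\mu_N$ converge weakly to $\mu$ as probability measures on $L^2$ as $N\to\infty$.
   Context: $S^1$ is the interval $[0,1]$ with endpoints glued; functions on $S^1$ are identified with $1$-periodic functions on $\mathbb{R}$. All functions are real valued, $C=C(S^1)$, $L^2=L^2(S^1)$. $N$ is a positive integer, $t_i=i/N$, vectors in $\mathbb{R}^N$ are written $\vec f=(f_0,\dots,f_{N-1})$ with the periodic convention $f_N=f_0$. Data of the problem: a linear operator $\mathcal K$, a function $g$ on $S^1$, a function $w:\mathbb{R}\to\mathbb{R}$, a function $\Phi:\mathbb{R}\times\mathbb{R}\times S^1\to\mathbb{R}$; $\partial_1$ denotes differentiation in the first argument of $\Phi$. Put $$g_i=N\int_{\mathbb{R}}w(N(t-t_i))g(t)\,dt,\qquad 0\le i\le N-1,$$ $$\mathcal I_N:\mathbb{R}^N\to L^2,\quad (\mathcal I_N\vec f)(t)=f_m\ \text{ for } t\in[m/N,(m+1)/N),$$ $$(\mathcal K_N\vec f)_i=N\int_{\mathbb{R}}w(N(t-t_i))(\mathcal K\mathcal I_N\vec f)(t)\,dt,\qquad (D_N\vec f)_i=N(f_{i+1}-f_i),$$ $$\Psi_N(\vec f)=\frac{\tau}{N}\sum_{i=0}^{N-1}\Phi\big((\mathcal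 K_N\vec f)_i,g_i,t_i\big),\qquad \Psi_N^{\mathrm{full}}(\vec f)=\Psi_N(\vec f)+\frac{\kappa}{2N}\sum_{i=0}^{N-1}\big[f_i^2+(D_N\vec f)_i^2\big].$$ Standing assumptions: (A1) $w\in L^\infty(\mathbb{R})$ has compact support and $\int_{\mathbb{R}}w=1$. (A2) $\mathcal K$ and its $L^2$-adjoint $\mathcal K^*$ are bounded from $L^2$ to $C$; $g\in C$. (A3) There are $h_0>0$ and $c\ge0$ such that $\Phi(p,g(t)+h,t)\ge -c$ and $\partial_1^2\Phi(p,g(t)+h,t)\ge0$ for all $p\in\mathbb{R}$, $t\in S^1$, $|h|\le h_0$. (A4) $\Phi$ is locally Lipschitz in $(p,v,t)$, and $\partial_1\Phi$, $\partial_1^2\Phi$ exist and are continuous in $(p,v,t)$. (A5) For some $p_0>0$, $\partial_1^3\Phi(r_i+p,g_i,t_i)$ exists for $|p|\le p_0$ and $\sup_{N\ge N_1}\sup_{0\le i\le N-1}\sup_{|p|\le p_0}|\partial_1^3\Phi(r_i+p,g_i,t_i)|<\infty$, where $r_i=(\mathcal K_N\vec u_{*,N})_i$ and $\vec u_{*,N}$ is the unique minimizer of $\Psi_N^{\mathrm{full}}$ on $\mathbb{R}^N$. Here $N_1$ is an integer such that $|g_i-g(t_i)|\le h_0$ for all $0\le i\le N-1$ and all $N\ge N_1$ (it exists by (A1) and continuity of $g$); for $N\ge N_1$ the functional $\Psi_N^{\mathrm{full}}$ is coercive and strongly convex, so $\vec u_{*,N}$ exists and is unique, and $\exp\{-\Psi_N^{\mathrm{full}}\}$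 is integrable. *)

(* Defs.v *)
From HB Require Import structures.
From mathcomp Require Import all_boot all_order all_algebra.
From mathcomp Require Import all_classical all_reals all_analysis.
From mathcomp Require Import measurable_realfun ess_sup_inf.

Set Implicit Arguments.
Unset Strict Implicit.
Unset Printing Implicit Defensive.

Import Order.TTheory GRing.Theory Num.Theory.
Import numFieldNormedType.Exports.

Local Open Scope classical_set_scope.
Local Open Scope ring_scope.

(* L^2(S^1) is the library space of classes modulo equality a.e. for Lebesgue
   measure on the fundamental domain [0, 1); a representative is a function on
   the whole line whose values outside [0, 1) are irrelevant. *)
Definition circle_measure (R : realType) : set (measurableTypeR R) -> \bar R :=
  mrestr lebesgue_measure (measurable_itv `[0 : R, 1[ ).
HB.instance Definition _ (R : realType) := Measure.on (@circle_measure R).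

Definition L2 (R : realType) : Type := LspaceType2 (@circle_measure R).

Section L2_structure.
Context {R : realType}.
Local Notation T := (measurableTypeR R).
Local Notation mu := (@circle_measure R).
Local Notation L := (@L2 R).
Local Notation Lf := (LfunType mu (lee1n 2)).
Local Open Scope quotient_scope.

HB.instance Definition _ := gen_eqMixin L.
HB.instance Definition _ := gen_choiceMixin L.

Lemma Lnorm2_ae (f g : T -> R) :
  measurable_fun [set: T] f -> measurable_fun [set: T] g ->
  f = g %[ae mu] -> ('N[mu]_2%:E[EFin \o f] = 'N[mu]_2%:E[EFin \o g])%E.
Proof.
move=> mf mg fg; rewrite unlock; congr (_ `^ _)%E.
have mpow (h : T -> R) : measurable_fun [set: T] h ->
    measurable_fun [set: T] (EFin \o (fun x => `|h x| `^ 2)).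
  move=> mh; apply/measurable_EFinP.
  apply: (@measurableT_comp _ _ _ _ _ _ (@powR R ^~ 2)) => //.
  exact: measurableT_comp.
apply: ae_eq_integral => //; [exact: mpow|exact: mpow|].
by apply: filterS fg => x /= + _ => ->.
Qed.

Lemma measurable_repr (u : {mfun_ mu, T >-> T}) : measurable_fun [set: T] (u : T -> R).
Proof. exact: (@measurable_funPT _ _ _ _ (repr u)). Qed.

Section class.
Variable f : T -> R.
Hypothesis fL : f \in Lfun mu 2%:E.

Let mf : measurable_fun [set: T] f.
Proof. by move: fL; rewrite inE => /andP[/[!inE]]. Qed.

Definition L2_mfun : {mfun T >-> T} :=
  HB.pack f (isMeasurableFun.Build _ _ T T f mf).

Definition L2_quot : {mfun_ mu, T >-> T} := \pi L2_mfun.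

Lemma L2_quot_ae : (L2_quot : T -> R) = f %[ae mu].
Proof.
have /eqmodP/asboolP : repr L2_quot = L2_mfun %[mod {mfun_ mu, T >-> T}].
  by rewrite reprK.
by [].
Qed.

Lemma L2_quot_finite : finite_norm mu 2%:E (L2_quot : T -> R).
Proof.
rewrite /finite_norm (Lnorm2_ae _ mf L2_quot_ae)//; last exact: measurable_repr.
by move: fL; rewrite inE => /andP[_ /[!inE]].
Qed.

Definition L2_class : L :=
  HB.pack L2_quot
    (isFinLebesgue.Build _ _ _ mu 2%:E (lee1n 2) L2_quot L2_quot_finite).

End class.

Lemma L2_inj (u v : L) : (u : {mfun_ mu, T >-> T}) = v -> u = v.
Proof.
case: u v => [u [[hu]]] [v [[hv]]] /= uv; move: hv; rewrite -uv => hv.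
by rewrite (Prop_irrelevance hu hv).
Qed.

Lemma L2_aeP (u v : L) : (u : T -> R) = v %[ae mu] -> u = v.
Proof.
move=> uv; apply: L2_inj.
rewrite -[LHS]reprK -[RHS]reprK; apply/eqmodP/asboolP.
exact: uv.
Qed.

Lemma L2_Lfun (u : L) : (u : T -> R) \in Lfun mu 2%:E.
Proof.
rewrite inE; apply/andP; split; rewrite inE; first exact: measurable_repr.
exact: Lebesgue_finite.
Qed.

Definition L2_repr (u : L) : Lf := Lfun_Sub (lee1n 2) (L2_Lfun u).

Definition L2_pi (f : Lf) : L := L2_class (LfunP f).

Lemma L2_pi_ae (f : Lf) : (L2_pi f : T -> R) = f %[ae mu].
Proof. exact: L2_quot_ae. Qed.

Lemma L2_pi_eq (f g : Lf) : (f : T -> R) = g %[ae mu] -> L2_pi f = L2_pi g.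
Proof.
move=> fg; apply: L2_aeP; have := L2_pi_ae f; have := L2_pi_ae g.
by apply: filterS3 fg => x fg gx fx _; rewrite gx// fx// fg.
Qed.

Lemma L2_reprK (u : L) : L2_pi (L2_repr u) = u.
Proof. by apply: L2_aeP; exact: L2_pi_ae. Qed.

Lemma L2_repr_pi (f : Lf) : (L2_repr (L2_pi f) : T -> R) = f %[ae mu].
Proof. exact: L2_pi_ae. Qed.

Definition L2_add (u v : L) := L2_pi (L2_repr u + L2_repr v).
Definition L2_opp (u : L) := L2_pi (- L2_repr u).
Definition L2_scale (a : R) (u : L) := L2_pi (a *: L2_repr u).
Definition L2_norm (u : L) : R := fine ('N[mu]_2%:E[EFin \o (u : T -> R)])%E.

Lemma L2_addE (f g : Lf) : L2_add (L2_pi f) (L2_pi g) = L2_pi (f + g).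
Proof.
apply: L2_pi_eq; have := L2_repr_pi f; have := L2_repr_pi g.
by apply: filterS2 => x gx fx _; exact: (congr2 +%R (fx I) (gx I)).
Qed.

Lemma L2_oppE (f : Lf) : L2_opp (L2_pi f) = L2_pi (- f).
Proof.
apply: L2_pi_eq; apply: filterS (L2_repr_pi f) => x fx _.
exact: (congr1 -%R (fx I)).
Qed.

Lemma L2_scaleE a (f : Lf) : L2_scale a (L2_pi f) = L2_pi (a *: f).
Proof.
apply: L2_pi_eq; apply: filterS (L2_repr_pi f) => x fx _.
exact: (congr1 ( *%R a) (fx I)).
Qed.

Lemma L2_normE (f : Lf) : L2_norm (L2_pi f) = fine ('N[mu]_2%:E[EFin \o f])%E.
Proof.
congr fine; apply: Lnorm2_ae; [exact: measurable_repr|by []|exact: L2_pi_ae].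
Qed.

Let add0 : left_id (L2_pi 0) L2_add.
Proof. by move=> u; rewrite -(L2_reprK u) L2_addE add0r. Qed.

Let addA : associative L2_add.
Proof.
move=> u v w; rewrite -(L2_reprK u) -(L2_reprK v) -(L2_reprK w).
by rewrite !L2_addE addrA.
Qed.

Let addC : commutative L2_add.
Proof. by move=> u v; rewrite /L2_add addrC. Qed.

Let addN : left_inverse (L2_pi 0) L2_opp L2_add.
Proof. by move=> u; rewrite -(L2_reprK u) L2_oppE L2_addE addNr. Qed.

HB.instance Definition _ := GRing.isZmodule.Build L addA addC add0 addN.

Let scaleA a b u : L2_scale a (L2_scale b u) = L2_scale (a * b) u.
Proof. by rewrite -(L2_reprK u) !L2_scaleE scalerA. Qed.

Let scale1 : left_id 1 L2_scale.
Proof. by move=> u; rewrite -(L2_reprK u) L2_scaleE scale1r. Qed.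

Let scaleDr : right_distributive L2_scale +%R.
Proof.
move=> a u v; rewrite -(L2_reprK u) -(L2_reprK v).
move: (L2_repr u) (L2_repr v) => f g.
rewrite [X in L2_scale a X](L2_addE f g) !L2_scaleE scalerDr.
exact/esym/L2_addE.
Qed.

Let scaleDl u : {morph L2_scale ^~ u : a b / a + b}.
Proof.
move=> a b; rewrite -(L2_reprK u) !L2_scaleE scalerDl.
exact/esym/L2_addE.
Qed.

HB.instance Definition _ := GRing.Zmodule_isLmodule.Build R L
  scaleA scale1 scaleDr scaleDl.

Let normD (u v : L) : L2_norm (u + v) <= L2_norm u + L2_norm v.
Proof.
rewrite -(L2_reprK u) -(L2_reprK v); move: (L2_repr u) (L2_repr v) => f g.
rewrite [X in L2_norm X <= _](L2_addE f g) !L2_normE.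
exact: ler_LnormD.
Qed.

Let normZ (a : R) (u : L) : L2_norm (a *: u) = `|a| * L2_norm u.
Proof.
rewrite -(L2_reprK u); move: (L2_repr u) => f.
rewrite [X in L2_norm X = _](L2_scaleE a f) !L2_normE.
by apply: EFin_inj; rewrite EFinM !finite_norm_fine LnormZ.
Qed.

Let norm0 (u : L) : L2_norm u = 0 -> u = 0.
Proof.
rewrite -(L2_reprK u) L2_normE => /fine_Lnormr_eq0 u0.
exact: L2_pi_eq.
Qed.

HB.instance Definition _ := Lmodule_isNormed.Build R L normD normZ norm0.

End L2_structure.

Section lebesgue_cons.
Context {R : realType} {n : nat}.
Variable m : {sigma_finite_measure set (n.-tuple R) -> \bar R}.
Local Open Scope ereal_scope.

Definition tuple_cons (p : measurableTypeR R * n.-tuple R) : n.+1.-tuple R :=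
  [tuple of (p.1 : R) :: p.2].

Lemma measurable_tuple_cons : measurable_fun [set: _] tuple_cons.
Proof. by apply: measurable_cons. Qed.

Definition lebesgue_cons : set (n.+1.-tuple R) -> \bar R :=
  pushforward (lebesgue_measure \x m) tuple_cons.

HB.instance Definition _ := Measure.copy lebesgue_cons
  (measure_function_pushforward__canonical__measure_function_Measure
     (lebesgue_measure \x m) measurable_tuple_cons).

Let sigmaT_finite_lebesgue_cons : sigma_finite [set: _] lebesgue_cons.
Proof.
have /sigma_finiteP[/= F [FT ndF mF]] := sigma_finiteT (@lebesgue_measure R).
have /sigma_finiteP[/= G [GT ndG mG]] := sigma_finiteT m.
exists (fun k => (fun t : n.+1.-tuple R => tnth t ord0) @^-1` F k `&`
    (fun t : n.+1.-tuple R => [tuple of behead t]) @^-1` G k).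
  apply/esym; rewrite -subTset => t _.
  have [i _ Fi] : (\bigcup_i F i) (tnth t ord0) by rewrite -FT.
  have [j _ Gj] : (\bigcup_i G i) [tuple of behead t] by rewrite -GT.
  exists (maxn i j) => //; split => /=.
    by move: Fi; apply/subsetPset/ndF/leq_maxl.
  by move: Gj; apply/subsetPset/ndG/leq_maxr.
move=> k; have [mFk Fk] := mF k; have [mGk Gk] := mG k; split.
  apply: measurableI; rewrite -[X in measurable X]setTI.
    exact: measurable_tnth.
  exact: measurable_behead.
rewrite /lebesgue_cons /pushforward.
rewrite (_ : _ @^-1` _ = F k `*` G k).
  by rewrite product_measure1E//; apply: lte_mul_pinfty => //; rewrite ge0_fin_numE.
apply/seteqP; split => -[x t] /= [].
  rewrite tnth0 => Fx Gt; split => //=.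
  by move: Gt; congr (G k _); exact/val_inj.
move=> /= Fx Gt; split; first by rewrite tnth0.
by move: Gt; congr (G k _); exact/val_inj.
Qed.

HB.instance Definition _ := @Measure_isSigmaFinite.Build _ _ _ lebesgue_cons
  sigmaT_finite_lebesgue_cons.

End lebesgue_cons.

Fixpoint lebesgue_tuple (R : realType) (n : nat) :
    {sigma_finite_measure set (n.-tuple R) -> \bar R} :=
  match n with
  | 0 => \d_[tuple]
  | k.+1 => lebesgue_cons (lebesgue_tuple R k)
  end.

Section step.
Context {R : realType} {N : nat}.

(* Zero outside [0, 1) rather than periodic: this does not change the class. *)
Definition step (f : N.-tuple R) (t : measurableTypeR R) : R :=
  \sum_(m < N) tnth f m * \1_(`[m%:R / N%:R, m.+1%:R / N%:R[) t.

Lemma step_Lfun f : step f \in Lfun (@circle_measure R) 2%:E.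
Proof.
have p1 : (1 <= 2%:E :> \bar R)%E by exact: (lee1n 2).
rewrite (_ : step f = \sum_(m < N)
    tnth f m *: (\1_(`[m%:R / N%:R, m.+1%:R / N%:R[) : measurableTypeR R -> R)).
  apply: rpred_sum => m _; apply: rpredZ.
  rewrite inE; apply/andP; split; rewrite inE.
    exact: measurable_indic.
  rewrite /finite_norm unlock; apply: poweR_lty.
  rewrite (eq_integral (fun t : measurableTypeR R => (\1_(`[m%:R / N%:R, m.+1%:R / N%:R[) t)%:E)).
    rewrite integral_indic// setIT.
    apply: (@le_lt_trans _ _ (@circle_measure R [set: _])).
      by apply: le_measure; rewrite ?inE.
    rewrite /circle_measure /= /mrestr setTI lebesgue_measure_itv/=.
    by case: ifPn => _; rewrite ?ltry// -EFinB ltry.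
  move=> t _ /=; rewrite indicE; case: (_ \in _).
    by rewrite normr1 powR1.
  by rewrite normr0 powR0.
by apply/funext => t; rewrite /step fct_sumE.
Qed.

Definition interp (f : N.-tuple R) : L2 R := L2_class (step_Lfun f).

End step.

Section circle.
Context {R : realType}.
Implicit Types (f : R -> R) (K : L2 R -> R -> R).

(* Functions on S^1 are 1-periodic functions on the line. *)
Definition periodic1 f := forall t, f (t + 1) = f t.

Definition circle_continuous f := continuous f /\ periodic1 f.

Definition bounded_L2_C K :=
  [/\ forall (a : R) u v t, K (a *: u + v) t = a * K u t + K v t,
      forall u, circle_continuous (K u)
    & exists M : R, forall u t, `|K u t| <= M * `|u|].

(* [K'] is determined by [K]: the Hilbert adjoint is unique, and a class has
   at most one continuous representative. *)
Definition L2_adjoint K K' := forall u v : L2 R,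
  \int[@circle_measure R]_t (K u t * v t) =
  \int[@circle_measure R]_t (u t * K' v t).

End circle.

Definition d1 (R : realType) (Phi : R -> R -> R -> R) : R -> R -> R -> R :=
  fun p v t => derive1 (fun q => Phi q v t) p.

Section discretization.
Context {R : realType}.
Variables (K : L2 R -> R -> R) (g w : R -> R) (Phi : R -> R -> R -> R).
Variables (tau kappa : R).

Section fixed_N.
Variable N : nat.
Implicit Types (f : N.-tuple R) (i : 'I_N).

Definition node i : R := i%:R / N%:R.

Definition local_average (h : R -> R) i : R :=
  N%:R * \int[lebesgue_measure]_t (w (N%:R * (t - node i)) * h t).

Definition g_ i : R := local_average g i.

Definition K_ f i : R := local_average (K (interp f)) i.

Definition D_ f i : R := N%:R * (tnth f (ordS i) - tnth f i).

Definition Psi f : R :=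
  tau / N%:R * \sum_(i < N) Phi (K_ f i) (g_ i) (node i).

Definition Psi_full f : R :=
  Psi f + kappa / (2 * N%:R) * \sum_(i < N) (tnth f i ^+ 2 + D_ f i ^+ 2).

Definition is_minimizer f := forall f', Psi_full f <= Psi_full f'.

(* A plain set function; it is a probability measure as soon as the density is
   measurable and Z is finite and positive, hence for all N >= N1 under the
   assumptions A1-A4. *)
Definition gibbs (A : set (N.-tuple R)) : \bar R :=
  let Z := \int[lebesgue_tuple R N]_f expR (- Psi_full f) in
  (\int[lebesgue_tuple R N]_(f in A) (Z^-1 * expR (- Psi_full f))%:E)%E.

End fixed_N.

Definition A1 :=
  [/\ w \in Lfun (@lebesgue_measure R) +oo%E,
      exists2 S : set R, compact S &
        {ae lebesgue_measure, forall t : R, ~ S t -> w t = 0}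
    & (\int[lebesgue_measure]_t (w t)%:E = 1)%E].

Definition A2 :=
  [/\ bounded_L2_C K,
      exists2 K', L2_adjoint K K' & bounded_L2_C K'
    & circle_continuous g].

Definition A3 (h0 c : R) := forall p t h, `|h| <= h0 ->
  - c <= Phi p (g t + h) t /\ 0 <= d1 (d1 Phi) p (g t + h) t.

Definition A4 :=
  [/\ forall x : R * R * R, exists2 U : set (R * R * R), nbhs x U &
        [lipschitz Phi y.1.1 y.1.2 y.2 | y in U],
      forall p v t, derivable (fun q => Phi q v t) p 1,
      forall p v t, derivable (fun q => d1 Phi q v t) p 1,
      continuous (fun x : R * R * R => d1 Phi x.1.1 x.1.2 x.2)
    & continuous (fun x : R * R * R => d1 (d1 Phi) x.1.1 x.1.2 x.2)].

(* Since the minimizer exists and is unique for N >= N1, quantifying over all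
   minimizers amounts to naming it. *)
Definition A5 (N1 : nat) := exists2 p0 : R, 0 < p0 & exists M : R,
  forall N : nat, (N1 <= N)%N ->
  forall u : N.-tuple R, is_minimizer u ->
  forall (i : 'I_N) (p : R), `|p| <= p0 ->
    derivable (fun q => d1 (d1 Phi) q (g_ i) (node i)) (K_ u i + p) 1 /\
    `|d1 (d1 (d1 Phi)) (K_ u i + p) (g_ i) (node i)| <= M.

End discretization.

Definition borel (X : ptopologicalType) := g_sigma_algebraType (@open X).

Definition weakly_cvg (R : realType) (X : ptopologicalType)
    (nu : nat -> set (borel X) -> \bar R) (mu : set (borel X) -> \bar R) :=
  forall phi : X -> R, continuous phi -> (exists M : R, forall x, `|phi x| <= M) ->
  (\int[nu n]_x (phi x)%:E @[n --> \oo] --> \int[mu]_x (phi x)%:E)%E.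

(* Main.v *)
(* Up to a constant, the Gibbs density is the product of
     exp(- Psi_N(f) - kappa / (2 N) sum_i f_i^2)
   and of exp(- (kappa N / 2) sum_i (f_{i+1} - f_i)^2), and the second factor
   times Lebesgue measure is the law of (a + b(i/N) - mean)_i, where the mean a
   is distributed by Lebesgue measure on the line and b is a Brownian bridge of
   variance 1 / kappa. Sampling the bridges for all N from one and the same
   continuous path turns the integral of phi against mu_N into the quotient of
   the integrals of phi(X_N) W_N and of W_N over a fixed measure space. Pointwise
   X_N converges in L^2, W_N converges to a positive limit, and
   0 <= W_N <= exp(tau c) exp(- kappa a^2 / 2), so dominated convergence applies;
   the limit measure is the law of X = lim X_N under the normalised density
   W = lim W_N.

   A Brownian path is built by midpoint displacement from a single pair of a
   normal and a uniform variable, the binary digits of the uniform variable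
   supplying the independent normals needed at all levels. *)
Require Import Defs.
From HB Require Import structures.
From mathcomp Require Import all_boot all_order all_algebra.
From mathcomp Require Import all_classical all_reals all_analysis.
From mathcomp Require Import measurable_realfun ess_sup_inf.
From mathcomp Require Import ring lra.

Set Implicit Arguments.
Unset Strict Implicit.
Unset Printing Implicit Defensive.

Import Order.TTheory GRing.Theory Num.Theory.
Import numFieldNormedType.Exports.

Local Open Scope classical_set_scope.
Local Open Scope ring_scope.

(** * Integration tools and Gaussian measures *)

(** Midpoint displacement gives exact laws at dyadic times only, while the mesh points i/N are in
    general not dyadic. The law on the mesh is therefore obtained as a limit: at level n the times
    are rounded down to multiples of 2^-n, the mesh increments become sums over consecutive blocks
    of standard normals, and it suffices that the block lengths divided by 2^n tend to 1/N. This
    passage to the limit restricts the test functions to bounded continuous ones. The bridge is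
    never treated as a conditional law. A Gaussian factor in an auxiliary end point, integrated out,
    turns closed loops into free paths, whose increments are independent coordinates. The mean is
    subtracted because the bound by exp(- kappa a^2 / 2) can fail for an uncentred loop; since a is
    Lebesgue distributed, the shift by the mean is free. Path continuity rests on fourth moments:
    second moments give no geometric decay of the largest increment, whereas with fourth moments a
    decay rate q works as soon as 2 q^4 > 1, and 9/10 is such a rate. *)

Section tonelli_curried.
Context d1 d2 (T1 : measurableType d1) (T2 : measurableType d2) (R : realType).
Variables (m1 : {sigma_finite_measure set T1 -> \bar R})
          (m2 : {sigma_finite_measure set T2 -> \bar R}).
Variable F : T1 -> T2 -> \bar R.
Hypotheses (mF : measurable_fun setT (fun z : T1 * T2 => F z.1 z.2))
           (F0 : forall x y, (0 <= F x y)%E).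

Lemma measurable_integral_r : measurable_fun setT (fun x => \int[m2]_y F x y)%E.
Proof.
have := measurable_fun_fubini_tonelli_F (m2 := m2) _ mF.
by apply => z; exact: F0.
Qed.

Lemma ge0_integral_swap :
  (\int[m1]_x \int[m2]_y F x y = \int[m2]_y \int[m1]_x F x y)%E.
Proof.
have := fubini_tonelli (m1 := m1) (m2 := m2) _ mF.
by apply => z; exact: F0.
Qed.

Lemma ge0_integral_prod :
  (\int[m1 \x m2]_z F z.1 z.2 = \int[m1]_x \int[m2]_y F x y)%E.
Proof. by rewrite (fubini_tonelli1 _ mF)// => z; exact: F0. Qed.

End tonelli_curried.

Section weighted_image.
Context d d' (T : measurableType d) (T' : measurableType d') (R : realType).
Variables (m : {measure set T -> \bar R}) (nu : {measure set T' -> \bar R}).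
Variables (X : T -> T') (h : T -> R).
Hypotheses (mX : measurable_fun [set: T] X) (mh : measurable_fun [set: T] h).
Hypothesis h0 : forall t, 0 <= h t.
Hypothesis nuE : forall A, measurable A ->
  nu A = (\int[m]_t ((h t)%:E * (\1_A (X t))%:E))%E.
Local Open Scope ereal_scope.
Import HBNNSimple.

Let nnsfunE (f : {nnsfun T' >-> R}) :
  \int[nu]_y (f y)%:E = \int[m]_t ((h t)%:E * (f (X t))%:E).
Proof.
under [LHS]eq_integral do rewrite fimfunE -fsumEFin//.
rewrite [LHS]ge0_integral_fsum//; last 2 first.
  - by move=> r; exact/measurable_EFinP/measurableT_comp.
  - by move=> n x _; rewrite EFinM nnfun_muleindic_ge0.
under [RHS]eq_integral.
  move=> t _; rewrite fimfunE -fsumEFin// ge0_mule_fsumr; last first.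
    by move=> r; rewrite EFinM nnfun_muleindic_ge0.
  over.
have mI A : measurable A -> measurable_fun setT (fun t => (\1_A (X t))%:E : \bar R).
  by move=> mA; apply/measurable_EFinP/measurableT_comp => //.
rewrite [RHS]ge0_integral_fsum//; last 2 first.
  - move=> r; apply/measurable_EFinP; apply: measurable_funM => //.
    apply: measurable_funM => //; exact/measurable_EFinP/mI.
  - move=> n x _; apply: mule_ge0; first by rewrite lee_fin.
    by rewrite EFinM; exact: (nnfun_muleindic_ge0 f n (X x)).
apply: eq_fsbigr => r _.
rewrite integralZl_indic_nnsfun//= integral_indic// setIT nuE//.
have [r0|r0] := leP 0%R r; last first.
  rewrite preimage_nnfun0// integral0_eq; last first.
    by move=> t _; rewrite indic0 mule0.
  by rewrite mule0 integral0_eq// => t _; rewrite indic0 mulr0 mule0.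
rewrite -ge0_integralZl//.
- by apply: eq_integral => t _; rewrite muleCA.
- by apply: emeasurable_funM; [exact/measurable_EFinP|exact: mI].
- by move=> t _; rewrite mule_ge0// lee_fin.
Qed.

(** Indicators by [nuE], simple functions by linearity, then monotone convergence. A constant [h]
    gives image measures and the identity for [X] gives densities; both cases occur below. *)
Lemma ge0_integral_weighted_image (f : T' -> \bar R) :
  measurable_fun setT f -> (forall y, 0 <= f y) ->
  \int[nu]_y f y = \int[m]_t ((h t)%:E * f (X t)).
Proof.
move=> mf f0.
pose f_ := nnsfun_approx measurableT mf.
transitivity (limn (fun n => \int[nu]_x (f_ n x)%:E)).
  rewrite -monotone_convergence//=.
  - apply: eq_integral => ? /[!inE] xD; apply/esym/cvg_lim => //=.
    exact: cvg_nnsfun_approx.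
  - by move=> n; exact/measurable_EFinP/measurable_funTS.
  - by move=> n ? _; rewrite lee_fin.
  - by move=> ? _ ? ? mn; rewrite lee_fin; exact/lefP/nd_nnsfun_approx.
rewrite [RHS](_ : _ = limn (fun n => \int[m]_t ((h t)%:E * (f_ n (X t))%:E))); last first.
  rewrite -monotone_convergence//=.
  - apply: eq_integral => t /[!inE] xD; apply/esym/cvg_lim => //.
    by apply: cvgeZl => //; exact: cvg_nnsfun_approx.
  - move=> n; apply: emeasurable_funM; first exact/measurable_EFinP.
    by apply/measurable_EFinP/measurableT_comp.
  - by move=> n t _; rewrite mule_ge0// lee_fin.
  - move=> t _ a b ab; rewrite lee_wpmul2l// lee_fin//.
    exact/lefP/nd_nnsfun_approx.
by congr (limn _); apply/funext => n; exact: nnsfunE.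
Qed.
End weighted_image.

(** * Affine changes of variable for Lebesgue measure *)

Section lebesgue_affine.
Context {R : realType}.
Notation leb := (@lebesgue_measure R).
Variables a b : R.
Hypothesis a0 : 0 < a.

Let X (x : measurableTypeR R) : measurableTypeR R := a * x + b.

Let mX : measurable_fun setT X.
Proof.
by apply: measurable_funD => //; apply: measurable_funM.
Qed.

Let img : {measure set (measurableTypeR R) -> \bar R} :=
  mscale (NngNum (ltW a0))
    (measure_function_pushforward__canonical__measure_function_Measure leb mX).

Let img_val A : img A = (a%:E * leb (X @^-1` A))%E. Proof. by []. Qed.

Let imgE A : measurable A -> leb A = img A.
Proof.
apply: lebesgue_measure_unique => {}A [[x y] /= _ <-].
rewrite img_val.
rewrite (_ : X @^-1` `]x, y] = `]((x - b) / a), ((y - b) / a)]%classic); last first.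
  apply/seteqP; split => t; rewrite /X/= !in_itv/=.
    by rewrite ltr_pdivrMr// ler_pdivlMr// ltrBlDr lerBrDr [t * a]mulrC.
  by rewrite ltr_pdivrMr// ler_pdivlMr// ltrBlDr lerBrDr [t * a]mulrC.
rewrite !lebesgue_measure_itv/= !lte_fin ltr_pM2r ?invr_gt0// ltrD2r.
case: ifPn => _; last by rewrite mule0.
by rewrite -!EFinB -EFinM; congr EFin; field; rewrite gt_eqF.
Qed.

Lemma ge0_integral_lebesgue_affine (f : R -> \bar R) :
  measurable_fun [set: measurableTypeR R] f -> (forall x, 0 <= f x)%E ->
  (\int[leb]_x f x = a%:E * \int[leb]_x f (a * x + b)%R)%E.
Proof.
move=> mf f0.
have mfX : measurable_fun [set: measurableTypeR R] (fun x => f (a * x + b)).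
  exact: (measurableT_comp mf mX).
rewrite -ge0_integralZl// ?lee_fin ?ltW//.
apply: (@ge0_integral_weighted_image _ _ _ _ _ _ _ X (cst a)) => //.
  by move=> ?; rewrite ltW.
move=> A mA; etransitivity; first exact: (imgE mA).
rewrite img_val.
rewrite -[RHS]/(\int[leb]_t (a%:E * (\1_A (X t))%:E))%E.
rewrite ge0_integralZl//; first last.
- by rewrite lee_fin ltW.
- by apply/measurable_EFinP/measurableT_comp => //.
congr (_ * _)%E.
rewrite -[in LHS](setIT (X @^-1` A)) -integral_indic//.
by rewrite -[X in measurable X]setTI; exact: mX.
Qed.

Lemma ge0_integral_lebesgue_affineV (f : R -> \bar R) :
  measurable_fun [set: measurableTypeR R] f -> (forall x, 0 <= f x)%E ->
  (\int[leb]_x f (a * x + b)%R = (a^-1)%:E * \int[leb]_x f x)%E.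
Proof.
move=> mf f0; rewrite (ge0_integral_lebesgue_affine mf f0) muleA -EFinM.
by rewrite mulVf ?mul1e// gt_eqF.
Qed.

End lebesgue_affine.

Lemma ge0_integral_lebesgue_shift {R : realType} (b : R) (f : R -> \bar R) :
  measurable_fun [set: measurableTypeR R] f -> (forall x, 0 <= f x)%E ->
  (\int[@lebesgue_measure R]_x f x = \int[@lebesgue_measure R]_x f (x + b)%R)%E.
Proof.
move=> mf f0; rewrite (ge0_integral_lebesgue_affine b ltr01 mf f0) mul1e.
by apply: eq_integral => x _; rewrite mul1r.
Qed.

Lemma integral_probability_cst d (T : measurableType d) (R : realType)
  (P : probability T R) (k : \bar R) : (\int[P]_x k = k)%E.
Proof.
by rewrite integral_cst// -[X in _ = X]mule1; congr (_ * _)%E; exact: probability_setT.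
Qed.

(** * The standard normal law and its rotation invariance *)

Section standard_normal.
Context {R : realType}.
Notation leb := (@lebesgue_measure R).

Definition gauss : probability (measurableTypeR R) R := normal_prob 0 1.

Definition gauss_pdf (x : R) : R := normal_peak 1 * expR (- (x ^+ 2 / 2)).

Lemma gauss_pdfE : gauss_pdf = normal_pdf 0 1.
Proof.
rewrite normal_pdfE ?oner_neq0//; apply/funext => x.
by rewrite /gauss_pdf /normal_fun subr0 expr1n mulNr.
Qed.

Lemma gauss_pdf_gt0 x : 0 < gauss_pdf x.
Proof. by rewrite mulr_gt0 ?expR_gt0// normal_peak_gt0 ?oner_neq0. Qed.

Lemma measurable_gauss_pdf : measurable_fun [set: measurableTypeR R] gauss_pdf.
Proof. by rewrite gauss_pdfE; exact: measurable_normal_pdf. Qed.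

Lemma ge0_integral_gauss (f : R -> \bar R) :
  measurable_fun [set: measurableTypeR R] f -> (forall x, 0 <= f x)%E ->
  (\int[gauss]_x f x = \int[leb]_x ((gauss_pdf x)%:E * f x))%E.
Proof.
move=> mf f0.
apply: (@ge0_integral_weighted_image _ _ _ _ _ leb gauss idfun gauss_pdf _ _ _ _ f) => //.
- exact: measurable_id.
- exact: measurable_gauss_pdf.
- by move=> x; rewrite ltW// gauss_pdf_gt0.
move=> A mA; rewrite /= /normal_prob integral_mkcond gauss_pdfE.
apply: eq_integral => x _; rewrite patchE indicE.
by case: ifPn; rewrite ?mule1 ?mule0.
Qed.

Let M := measurableTypeR R.

Lemma ge0_integral_gauss2 (F : M -> M -> \bar R) :
  measurable_fun setT (fun z : M * M => F z.1 z.2) ->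
  (forall x y, 0 <= F x y)%E ->
  (\int[gauss]_x \int[gauss]_y F x y =
   \int[leb]_x \int[leb]_y ((gauss_pdf x * gauss_pdf y)%:E * F x y))%E.
Proof.
move=> mF F0; rewrite ge0_integral_gauss; first last.
- by move=> x; apply: integral_ge0.
- exact: measurable_integral_r.
apply: eq_integral => x _.
have mFx : measurable_fun [set: M] (F x) by exact: (measurable_fun_pair2 x mF).
rewrite ge0_integral_gauss// -ge0_integralZl//; first last.
- by rewrite lee_fin ltW// gauss_pdf_gt0.
- by move=> y _; rewrite mule_ge0// lee_fin ltW// gauss_pdf_gt0.
- apply: emeasurable_funM => //; apply/measurable_EFinP.
  exact: measurable_gauss_pdf.
by apply: eq_integral => y _; rewrite muleA -EFinM.
Qed.

Section rotation.
Variables (c s : R) (F : M -> M -> \bar R).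
Hypotheses (c0 : 0 < c) (cs1 : c ^+ 2 + s ^+ 2 = 1).
Hypotheses (mF : measurable_fun setT (fun z : M * M => F z.1 z.2))
  (F0 : forall x y, (0 <= F x y)%E).

Let P (x y : R) : \bar R := (gauss_pdf x * gauss_pdf y)%:E.

Let PE x y x' y' : x ^+ 2 + y ^+ 2 = x' ^+ 2 + y' ^+ 2 -> P x y = P x' y'.
Proof.
move=> e; rewrite /P /gauss_pdf; congr EFin.
rewrite mulrACA [RHS]mulrACA -!expRD; congr (_ * expR _).
by rewrite -!opprD -!mulrDl e.
Qed.

Let P0 x y : (0 <= P x y)%E.
Proof. by rewrite lee_fin mulr_ge0// ltW// gauss_pdf_gt0. Qed.

Let mPF d (T : measurableType d) (f1 f2 f3 f4 : T -> M) :
  measurable_fun setT f1 -> measurable_fun setT f2 ->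
  measurable_fun setT f3 -> measurable_fun setT f4 ->
  measurable_fun setT (fun z => P (f1 z) (f2 z) * F (f3 z) (f4 z))%E.
Proof.
move=> m1 m2 m3 m4; apply: emeasurable_funM.
  apply/measurable_EFinP; apply: measurable_funM.
    exact: (measurableT_comp measurable_gauss_pdf m1).
  exact: (measurableT_comp measurable_gauss_pdf m2).
exact: (measurableT_comp mF (measurable_fun_pair m3 m4)).
Qed.

Let PF0 x y x' y' : (0 <= P x y * F x' y')%E.
Proof. by rewrite mule_ge0. Qed.

(** The joint density depends on x^2 + y^2 only ([PE]), and a rotation preserves Lebesgue measure on
    the plane. This single fact yields both the law of a sum of normals and the independence of the
    two halves in a midpoint displacement. *)
Lemma gauss_rotation :
  (\int[gauss]_x \int[gauss]_y F (c * x + s * y)%R (c * y - s * x)%R =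
   \int[gauss]_x \int[gauss]_y F x y)%E.
Proof.
have mD d (T : measurableType d) (f g : T -> M) (k l : R) :
    measurable_fun setT f -> measurable_fun setT g ->
    measurable_fun setT (fun z => k * f z + l * g z : M).
  by move=> mf mg; apply: measurable_funD; apply: measurable_funM.
have mB d (T : measurableType d) (f g : T -> M) (k l : R) :
    measurable_fun setT f -> measurable_fun setT g ->
    measurable_fun setT (fun z => k * f z - l * g z : M).
  by move=> mf mg; apply: measurable_funB; apply: measurable_funM.
rewrite (@ge0_integral_gauss2 (fun x y => F (c * x + s * y) (c * y - s * x)))//;
  last exact: (measurableT_comp mF (measurable_fun_pair (mD _ _ _ _ _ _ _ _) (mB _ _ _ _ _ _ _ _))).
rewrite [RHS](ge0_integral_gauss2 mF F0).
(* A rotation is a product of two triangular maps, each of which is an affine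
   change of one variable with the other one frozen. *)
rewrite (@ge0_integral_swap _ _ _ _ _ leb leb (fun x y =>
   P x y * F (c * x + s * y)%R (c * y - s * x)%R)%E); [|by apply: mPF => //; [exact: mD|exact: mB]|by []].
have ci0 : 0 < c^-1 by rewrite invr_gt0.
have c00 : c != 0 by rewrite gt_eqF.
(* With y frozen the substitution is x = (u - s y) / c; later, with u frozen, it is y = c v + s u.
   The two Jacobians 1/c and c cancel. *)
transitivity (\int[leb]_y \int[leb]_u (c^-1%:E *
    (P (c^-1 * u + - s / c * y)%R y * F u (c^-1 * y + - s / c * u)%R)))%E.
  apply: eq_integral => y _.
  rewrite [LHS](ge0_integral_lebesgue_affine (- s / c * y) ci0)//; last first.
    by apply: mPF => //; [exact: mD|exact: mB].
  rewrite -ge0_integralZl//; last 2 first.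
  - apply: mPF => //.
    + by apply: measurable_funD => //; apply: measurable_funM.
    + by apply: mD => //; apply: measurable_funD => //; apply: measurable_funM.
    + by apply: mB => //; apply: measurable_funD => //; apply: measurable_funM.
  - by rewrite lee_fin ltW.
  apply: eq_integral => u _; congr (_ * (_ * F _ _))%E; first by field.
  suff -> : c * y = (c ^+ 2 / c) * y.
    by rewrite -(addrK (s ^+ 2) (c ^+ 2)) cs1; field.
  by congr (_ * _); rewrite expr2 mulfK.
rewrite ge0_integral_swap; last 2 first.
- apply: emeasurable_funM => //; apply: mPF => //; exact: mD.
- by move=> *; rewrite mule_ge0// lee_fin ltW.
apply: eq_integral => u _.
rewrite [LHS](ge0_integral_lebesgue_affine (s * u) c0); last 2 first.
- apply: emeasurable_funM => //; apply: mPF => //; exact: mD.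
- by move=> *; rewrite mule_ge0// lee_fin ltW.
rewrite -ge0_integralZl//; last 3 first.
- apply: emeasurable_funM => //; apply: mPF => //.
  + by apply: mD => //; apply: measurable_funD => //; apply: measurable_funM.
  + by apply: measurable_funD => //; apply: measurable_funM.
  + by apply: mD => //; apply: measurable_funD => //; apply: measurable_funM.
- by move=> *; rewrite mule_ge0// lee_fin ltW.
- by rewrite lee_fin ltW.
apply: eq_integral => v _.
rewrite muleA -EFinM mulfV// mul1e.
have -> : c^-1 * u + - s / c * (c * v + s * u) = c * u - s * v.
  have -> : c * u = (c ^+ 2 / c) * u by congr (_ * _); rewrite expr2 mulfK.
  by rewrite -(addrK (s ^+ 2) (c ^+ 2)) cs1; field.
have -> : c^-1 * (c * v + s * u) + - s / c * u = v by field.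
congr (_ * _)%E; apply: PE.
transitivity ((c ^+ 2 + s ^+ 2) * (u ^+ 2 + v ^+ 2)); first by ring.
by rewrite cs1 mul1r.
Qed.
End rotation.

(** Rotating by the unit vector (a/r, b/r) turns a x + b y into r times a single coordinate; the
    other coordinate integrates to 1. *)
Lemma gauss_convolution (a b : R) (f : M -> \bar R) : 0 < a ->
  measurable_fun setT f -> (forall x, 0 <= f x)%E ->
  (\int[gauss]_x \int[gauss]_y f (a * x + b * y)%R =
   \int[gauss]_x f (Num.sqrt (a ^+ 2 + b ^+ 2) * x)%R)%E.
Proof.
move=> a0 mf f0; set r := Num.sqrt _.
have s0 : 0 < a ^+ 2 + b ^+ 2 by rewrite ltr_wpDr ?sqr_ge0// exprn_gt0.
have r0 : 0 < r by rewrite sqrtr_gt0.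
have rr : r ^+ 2 = a ^+ 2 + b ^+ 2 by rewrite sqr_sqrtr// ltW.
have e : (a / r) ^+ 2 + (b / r) ^+ 2 = 1.
  by rewrite !exprMn -mulrDl -rr exprVn mulfV// gt_eqF// exprn_gt0.
have ar0 : 0 < a / r by rewrite divr_gt0.
pose F (x y : M) := f (r * x).
have mF : measurable_fun setT (fun z : M * M => F z.1 z.2).
  by apply: (measurableT_comp mf); apply: measurable_funM.
have := gauss_rotation ar0 e mF (fun x y => f0 _).
have -> : (\int[gauss]_x \int[gauss]_y F x y = \int[gauss]_x f (r * x)%R)%E.
  by apply: eq_integral => x _; rewrite integral_probability_cst.
move=> <-; apply: eq_integral => x _; apply: eq_integral => y _.
by rewrite /F; congr f; field; rewrite gt_eqF.
Qed.

End standard_normal.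

(** * Functions of lists and iterated integrals *)

Section list_measurability.
Context {R : realType}.
Implicit Types (F : seq R -> \bar R).

(** Functions are defined on all lists and only their restriction to length n is measured, so that
    lengths equal up to a proof, such as 2^n + 2^n and 2^(n+1), need no cast between tuple types. *)
Definition list_measurable n F :=
  measurable_fun [set: n.-tuple R] (fun t : n.-tuple R => F t).

Definition list_measurable2 d (T : measurableType d) n (H : T -> seq R -> \bar R) :=
  measurable_fun [set: T * n.-tuple R] (fun p : T * n.-tuple R => H p.1 p.2).

Lemma measurable_list_comp d (T : measurableType d) n F (h : T -> seq R) :
  list_measurable n F -> (forall t, size (h t) = n) ->
  (forall i, (i < n)%N -> measurable_fun [set: T] (fun t => nth 0 (h t) i)) ->
  measurable_fun [set: T] (fun t => F (h t)).
Proof.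
move=> mF sz mh.
pose h' t : n.-tuple R := Tuple (introT eqP (sz t)).
have mh' : measurable_fun setT h'.
  apply/measurable_fun_tnthP => i.
  have := mh i (ltn_ord i); apply: eq_measurable_fun => t _ /=.
  by rewrite (tnth_nth 0).
exact: (measurableT_comp mF mh').
Qed.

Lemma measurable_tuple_nth n i :
  measurable_fun [set: n.-tuple R] (fun t : n.-tuple R => nth 0 t i).
Proof.
have [ni|ni] := leqP n i.
  rewrite (_ : (fun _ => _) = cst 0); first exact: measurable_cst.
  by apply/funext => t; rewrite nth_default// size_tuple.
apply: (eq_measurable_fun (fun t : n.-tuple R => tnth t (Ordinal ni))).
  by move=> t _; rewrite (tnth_nth 0).
exact: measurable_tnth.
Qed.

Lemma list_measurable2_r d (T : measurableType d) n H (t : T) :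
  list_measurable2 n H -> list_measurable n (H t).
Proof. by move=> mH; exact: (measurable_fun_pair2 t mH). Qed.

Lemma list_measurable2_cons d (T : measurableType d) n H :
  list_measurable2 n.+1 H ->
  list_measurable2 n (fun (p : T * measurableTypeR R) l => H p.1 (p.2 :: l)).
Proof.
move=> mH.
pose c (q : (T * measurableTypeR R) * n.-tuple R) : T * n.+1.-tuple R :=
  (q.1.1, [tuple of (q.1.2 : R) :: q.2]).
have mc : measurable_fun setT c.
  apply: measurable_fun_pair.
    by apply: (measurableT_comp measurable_fst).
  apply: measurable_cons => //.
  by apply: (measurableT_comp measurable_snd).
exact: (measurableT_comp mH mc).
Qed.

Lemma list_measurable_cons2 n F : list_measurable n.+1 F ->
  list_measurable2 n (fun (x : measurableTypeR R) l => F (x :: l)).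
Proof.
move=> mF.
have mc : measurable_fun setT (fun q : measurableTypeR R * n.-tuple R =>
    [tuple of (q.1 : R) :: q.2]) by apply: measurable_cons.
exact: (measurableT_comp mF mc).
Qed.

Lemma list_measurable_cons n F x : list_measurable n.+1 F ->
  list_measurable n (fun l => F (x :: l)).
Proof.
by move=> /list_measurable_cons2 mF; exact: (list_measurable2_r x mF).
Qed.

End list_measurability.

Section iterated_integral.
Context {R : realType}.
Notation M := (measurableTypeR R).
Variable m : {sigma_finite_measure set M -> \bar R}.
Implicit Types (F : seq R -> \bar R).
Local Open Scope ereal_scope.

Fixpoint itint n F : \bar R :=
  if n is k.+1 then \int[m]_x itint k (fun l => F (x :: l)) else F [::].

Lemma itint_ge0 n F : (forall l, 0 <= F l) -> 0 <= itint n F.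
Proof.
elim: n F => [|n IH] F F0 //=; apply: integral_ge0 => x _.
by apply: IH => l.
Qed.

Lemma eq_itint n F G : (forall l, size l = n -> F l = G l) -> itint n F = itint n G.
Proof.
elim: n F G => [|n IH] F G FG /=; first exact: FG.
by apply: eq_integral => x _; apply: IH => l ln; apply: FG => /=; rewrite ln.
Qed.

Lemma itint_cat k n F :
  itint (k + n) F = itint k (fun l1 => itint n (fun l2 => F (l1 ++ l2))).
Proof.
elim: k F => [|k IH] F //=.
by apply: eq_integral => x _; rewrite IH.
Qed.

Lemma itint_rcons n F :
  itint n.+1 F = itint n (fun l => \int[m]_x F (rcons l x)).
Proof.
rewrite -addn1 itint_cat; apply: eq_itint => l _ /=.
by apply: eq_integral => x _; rewrite cats1.
Qed.

(** The parameter space is arbitrary because the induction moves the head of the list into it. *)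
Lemma measurable_itint n d (T : measurableType d) (H : T -> seq R -> \bar R) :
  list_measurable2 n H -> (forall t l, 0 <= H t l) ->
  measurable_fun [set: T] (fun t => itint n (H t)).
Proof.
elim: n d T H => [|n IH] d T H mH H0 /=.
  have mc : measurable_fun setT (fun t : T => (t, [tuple]) : T * 0.-tuple R).
    by apply: measurable_fun_pair.
  exact: (measurableT_comp mH mc).
apply: (@measurable_integral_r _ _ T M R m (fun t x => itint n (fun l => H t (x :: l)))).
  exact: (IH _ _ _ (list_measurable2_cons mH)).
by move=> t x; apply: itint_ge0 => l.
Qed.

Lemma measurable_itint_cons n F : list_measurable n.+1 F -> (forall l, 0 <= F l) ->
  measurable_fun [set: M] (fun x => itint n (fun l => F (x :: l))).
Proof.
by move=> mF F0; apply: measurable_itint => //; exact: list_measurable_cons2.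
Qed.

Lemma itintZl n (k : R) F : (0 <= k)%R -> list_measurable n F ->
  (forall l, 0 <= F l) -> itint n (fun l => k%:E * F l) = k%:E * itint n F.
Proof.
move=> k0; elim: n F => [|n IH] F mF F0 //=.
rewrite -ge0_integralZl//.
- by apply: eq_integral => x _; rewrite (IH (fun l => F (x :: l)))//; exact: list_measurable_cons.
- exact: measurable_itint_cons.
- by move=> x _; exact: itint_ge0.
Qed.

Lemma itint_swap n d (T : measurableType d)
    (m' : {sigma_finite_measure set T -> \bar R}) (H : T -> seq R -> \bar R) :
  list_measurable2 n H -> (forall t l, 0 <= H t l) ->
  \int[m']_t itint n (H t) = itint n (fun l => \int[m']_t H t l).
Proof.
elim: n H => [|n IH] H mH H0 //=.
rewrite ge0_integral_swap//; last 2 first.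
- exact: (measurable_itint (list_measurable2_cons mH)).
- by move=> t x; apply: itint_ge0 => l.
apply: eq_integral => x _; rewrite IH//.
pose c (q : T * n.-tuple R) : (T * M) * n.-tuple R := ((q.1, x), q.2).
have mc : measurable_fun setT c.
  by apply: measurable_fun_pair => //; apply: measurable_fun_pair.
exact: (measurableT_comp (list_measurable2_cons mH) mc).
Qed.

End iterated_integral.

(** Links the measure in the definition of [gibbs] to iterated integrals: [lebesgue_cons] is an
    image of a product measure, and the Dirac mass at the empty tuple matches the base case of
    [itint]. *)
Lemma ge0_integral_lebesgue_tuple {R : realType} n (F : seq R -> \bar R) :
  list_measurable n F -> (forall l, 0 <= F l)%E ->
  (\int[lebesgue_tuple R n]_t F t = itint (@lebesgue_measure R) n F)%E.
Proof.
elim: n F => [|n IH] F mF F0.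
  by rewrite [LHS]integral_dirac// diracT mul1e.
rewrite [LHS](@ge0_integral_pushforward _ _ _ _ _ _ (@measurable_tuple_cons R n))//.
rewrite preimage_setT.
rewrite (@ge0_integral_prod _ _ _ _ _ (@lebesgue_measure R) (lebesgue_tuple R n)
  (fun x t => F (x :: t)))//; last exact: list_measurable_cons2.
by apply: eq_integral => x _; rewrite (IH (fun l => F (x :: l)))//; exact: list_measurable_cons.
Qed.

(** * Sums over blocks of independent normals *)

Section gaussian_blocks.
Context {R : realType}.
Notation M := (measurableTypeR R).
Local Open Scope ereal_scope.

(** Iterates [gauss_convolution]. The case k = 0 is included because blocks are empty when the
    dyadic mesh is coarser than 1/N. *)
Lemma itint_gauss_sum k (f : M -> \bar R) :
  measurable_fun setT f -> (forall x, 0 <= f x) ->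
  itint (@gauss R) k (fun l => f (\sum_(y <- l) y)%R) =
  \int[gauss]_z f (Num.sqrt k%:R * z)%R.
Proof.
elim: k f => [|k IH] f mf f0.
  rewrite /= big_nil sqrtr0; under eq_integral do rewrite mul0r.
  by rewrite integral_probability_cst.
rewrite /= -(addn1 k) natrD addrC.
(* The variance 1 + k is written as 1^2 + (sqrt k)^2 to match [gauss_convolution]. *)
rewrite -[X in Num.sqrt (_ + X)](@sqr_sqrtr R)// -[X in Num.sqrt (X + _)](expr1n _ 2).
rewrite -gauss_convolution//.
apply: eq_integral => x _.
under eq_itint do rewrite big_cons.
rewrite (IH (fun y => f (x + y)%R))//; last first.
  by apply: (measurableT_comp mf); apply: measurable_funD.
by apply: eq_integral => z _; rewrite mul1r.
Qed.

Fixpoint block_sums (ms : seq nat) (l : seq R) : seq R :=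
  if ms is k :: ms' then (\sum_(y <- take k l) y)%R :: block_sums ms' (drop k l)
  else [::].

Definition block_scale (ms : seq nat) (y : seq R) : seq R :=
  [seq (Num.sqrt p.1%:R * p.2)%R | p <- zip ms y].

(** The blocks use disjoint coordinates, so [itint_cat] peels them off one at a time and
    [itint_gauss_sum] replaces each sum by one normal variable scaled by the root of the block
    length. *)
Lemma itint_gauss_blocks ms (F : seq R -> \bar R) :
  list_measurable (size ms) F -> (forall l, 0 <= F l) ->
  itint (@gauss R) (sumn ms) (fun l => F (block_sums ms l)) =
  itint (@gauss R) (size ms) (fun y => F (block_scale ms y)).
Proof.
elim: ms F => [|k ms IH] F mF F0 //=.
rewrite itint_cat.
transitivity (itint (@gauss R) k (fun l1 => itint (@gauss R) (size ms)
    (fun y => F ((\sum_(x <- l1) x)%R :: block_scale ms y)))).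
  apply: eq_itint => l1 sl1.
  rewrite -(IH (fun y => F (_ :: y)))//; last exact: list_measurable_cons.
  apply: eq_itint => l2 _.
  by rewrite take_size_cat// drop_size_cat.
rewrite (itint_gauss_sum k (f := fun x => itint (@gauss R) (size ms)
    (fun y => F (x :: block_scale ms y))))//.
- apply: measurable_itint => // .
  rewrite /list_measurable2; apply: (measurable_list_comp mF) => [p|i].
    by rewrite /= size_map size_zip size_tuple minnn.
  case: i => [|i] im //=; first exact: measurable_fst.
  apply: (eq_measurable_fun (fun p : M * (size ms).-tuple R =>
     (Num.sqrt (nth 0%N ms i)%:R * nth 0%R p.2 i)%R)).
    move=> p _; rewrite (nth_map (0%N, 0%R)) ?size_zip ?size_tuple ?minnn//.
    by rewrite nth_zip ?size_tuple.
  apply: measurable_funM => //.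
  apply: (@measurableT_comp _ _ _ _ _ _ (fun t : (size ms).-tuple R => nth 0%R t i) _ snd).
    exact: measurable_tuple_nth.
  exact: measurable_snd.
- by move=> x; apply: itint_ge0.
Qed.

End gaussian_blocks.

(** * Lebesgue measure on closed discrete loops *)

Section bridge.
Context {R : realType}.
Implicit Types (y l f : seq R) (a : R).

(* [y] lists the values at times 1/N, ..., N/N of a path starting at 0; the
   bridge is obtained by subtracting its linear drift. *)
Definition bridge N a y : seq R :=
  mkseq (fun i => a + (nth 0 (0 :: y) i - i%:R / N%:R * nth 0 (0 :: y) N)) N.

Definition loop_energy N f : R :=
  \sum_(i < N) (nth 0 f (i.+1 %% N) - nth 0 f i) ^+ 2.

Definition path_energy N y : R :=
  \sum_(i < N) (nth 0 (0 :: y) i.+1 - nth 0 (0 :: y) i) ^+ 2.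

(** The starting value [c] is not an entry of the list, which is why paths appear as
    [c :: partial_sums s c l] and [0 :: y]. *)
Definition partial_sums (s c : R) l : seq R := scanl (fun u x => u + s * x) c l.

Lemma size_bridge N a y : size (bridge N a y) = N.
Proof. exact: size_mkseq. Qed.

(** Pythagoras: the increments of the bridge are those of the path minus their mean s/N, and the
    increments of the path telescope to s. *)
Lemma loop_energy_bridge N a y : (0 < N)%N ->
  loop_energy N (bridge N a y) + nth 0 (0 :: y) N ^+ 2 / N%:R = path_energy N y.
Proof.
move=> N0; set z := nth 0 (0 :: y); set s := z N.
have NR : N%:R != 0 :> R by rewrite pnatr_eq0 -lt0n.
have dE (i : 'I_N) : nth 0 (bridge N a y) (i.+1 %% N) - nth 0 (bridge N a y) i =
    z i.+1 - z i - s / N%:R.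
  rewrite [X in _ - X]nth_mkseq// -/z -/s.
  (* At the last step the successor is entry 0, with value [a]; this is also what the formula for
     the bridge gives at time 1. *)
  have [iN|iN] := ltnP i.+1 N.
    rewrite modn_small// nth_mkseq// -/z -/s -(addn1 i) natrD; ring.
  have <- : N = i.+1 by apply/eqP; rewrite eqn_leq iN ltn_ord.
  rewrite modnn nth_mkseq// -/z -/s {1}/z/= mul0r mul0r subr0 addr0.
  have <- : N%:R - 1 = i%:R :> R.
    by rewrite -[N in N%:R](_ : i.+1 = N) -?natr1 ?addrK//; apply/eqP; rewrite eqn_leq iN ltn_ord.
  by field.
rewrite /loop_energy; under eq_bigr do rewrite dE sqrrB.
rewrite /path_energy big_split/= big_split/= sumr_const card_ord sumrN.
have -> : \sum_(i < N) (z i.+1 - z i) * (s / N%:R) *+ 2 = s * (s / N%:R) *+ 2.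
  rewrite sumrMnl -mulr_suml; congr (_ * _ *+ _).
  have := telescope_sumr z (leq0n N); rewrite big_mkord => ->.
  by rewrite /s /z /= subr0.
rewrite -mulr_natr; by field.
Qed.

Lemma path_energy_partial_sums (s c : R) l :
  \sum_(i < size l) (nth 0 (c :: partial_sums s c l) i.+1 -
    nth 0 (c :: partial_sums s c l) i) ^+ 2 = s ^+ 2 * \sum_(x <- l) x ^+ 2.
Proof.
elim: l c => [|x l IH] c; first by rewrite big_ord0 big_nil mulr0.
rewrite big_ord_recl /= big_cons mulrDr; congr (_ + _); last exact: IH.
by rewrite addrAC subrr add0r exprMn.
Qed.

End bridge.

(** * From Lebesgue measure on loops to independent normal increments *)

Section loop_change_of_variables.
Context {R : realType}.
Notation M := (measurableTypeR R).
Notation leb := (@lebesgue_measure R).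
Implicit Types (F : seq R -> \bar R).
Local Open Scope ereal_scope.

Lemma itint_lebesgue_shift (v : seq R) F :
  list_measurable (size v) F -> (forall l, 0 <= F l) ->
  itint leb (size v) F =
  itint leb (size v) (fun l => F [seq (p.1 + p.2)%R | p <- zip l v]).
Proof.
elim: v F => [|b v IH] F mF F0 //=.
rewrite (ge0_integral_lebesgue_shift b); last 2 first.
- exact: measurable_itint_cons.
- by move=> x; exact: itint_ge0.
apply: eq_integral => x _; rewrite (IH (fun l => F ((x + b)%R :: l)))//.
exact: list_measurable_cons.
Qed.

(** A triangular change of variables: given the previous value, each entry is an affine function of
    the next coordinate with slope s. The starting value is general because the induction moves
    it. *)
Lemma itint_lebesgue_partial_sums n (s c : R) F : (0 < s)%R ->
  list_measurable n F -> (forall l, 0 <= F l) ->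
  itint leb n (fun l => F (partial_sums s c l)) = (s^-1 ^+ n)%:E * itint leb n F.
Proof.
move=> s0; elim: n c F => [|n IH] c F mF F0 /=; first by rewrite mul1e.
pose f x := itint leb n (fun l => F (x :: l)).
have mf : measurable_fun [set: M] f by exact: measurable_itint_cons.
have f0 x : 0 <= f x by exact: itint_ge0.
transitivity (\int[leb]_x ((s^-1 ^+ n)%:E * f (s * x + c)%R)).
  apply: eq_integral => x _.
  rewrite (IH _ (fun l => F ((c + s * x)%R :: l)))//; last exact: list_measurable_cons.
  by rewrite /f addrC.
have s'0 : (0 <= s^-1)%R by rewrite invr_ge0 ltW.
rewrite ge0_integralZl//; last 2 first.
- apply: (measurableT_comp mf).
  by apply: measurable_funD => //; apply: measurable_funM.
- by rewrite lee_fin exprn_ge0.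
by rewrite ge0_integral_lebesgue_affineV// muleA -EFinM -exprSr.
Qed.

Lemma measurable_list_pdf n :
  measurable_fun [set: n.-tuple R] (fun t : n.-tuple R => \prod_(x <- t) gauss_pdf x)%R.
Proof.
apply: (eq_measurable_fun (fun t : n.-tuple R => \prod_(i < n) gauss_pdf (tnth t i))%R).
  by move=> t _; rewrite [RHS]big_tuple.
apply: measurable_prod => i _ .
apply: (measurableT_comp measurable_gauss_pdf); exact: measurable_tnth.
Qed.

Lemma list_pdf_ge0 (l : seq R) : (0 <= \prod_(x <- l) gauss_pdf x)%R.
Proof. by apply: prodr_ge0 => x _; rewrite ltW// gauss_pdf_gt0. Qed.

Lemma itint_gaussE n F : list_measurable n F -> (forall l, 0 <= F l) ->
  itint leb n (fun l => (\prod_(x <- l) gauss_pdf x)%R%:E * F l) =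
  itint (@gauss R) n F.
Proof.
elim: n F => [|n IH] F mF F0 /=; first by rewrite big_nil mul1e.
rewrite ge0_integral_gauss; last 2 first.
- exact: measurable_itint_cons.
- by move=> x; exact: itint_ge0.
apply: eq_integral => x _; rewrite -IH//; last exact: list_measurable_cons.
rewrite -itintZl//.
- by apply: eq_itint => l _; rewrite big_cons EFinM muleA.
- by rewrite ltW// gauss_pdf_gt0.
- apply: emeasurable_funM; last exact: list_measurable_cons.
  by apply/measurable_EFinP; apply: measurable_list_pdf.
- by move=> l; rewrite mule_ge0// lee_fin list_pdf_ge0.
Qed.

(** Rescaling by (2 b)^(-1/2) gives the standard normal density. Only finiteness and positivity of
    the value are recorded, since normalisation constants cancel in the end. *)
Lemma integral_expR_sqr (b : R) : (0 < b)%R ->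
  exists2 c : R, (0 < c)%R & \int[leb]_x (expR (- (b * x ^+ 2)))%:E = c%:E.
Proof.
move=> b0; pose k := (Num.sqrt (2 * b))^-1%R.
have k0 : (0 < k)%R by rewrite invr_gt0 sqrtr_gt0 mulr_gt0.
have p0 : (0 < normal_peak (1 : R))%R by rewrite normal_peak_gt0// oner_neq0.
exists (k / normal_peak 1)%R; first by rewrite divr_gt0.
have mf : measurable_fun [set: M] (fun x => (expR (- (b * x ^+ 2)))%:E).
  apply/measurable_EFinP/measurableT_comp => //; apply: measurableT_comp => //.
  by apply: measurable_funM => //; exact: measurable_funX.
rewrite (ge0_integral_lebesgue_affine 0 k0)//.
rewrite EFinM; congr (_ * _).
transitivity (\int[leb]_x ((normal_peak 1)^-1%:E * (gauss_pdf x)%:E)).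
  apply: eq_integral => x _; rewrite -EFinM /gauss_pdf mulKf ?gt_eqF//.
  congr (expR (- _))%:E; rewrite addr0 exprMn exprVn sqr_sqrtr ?mulr_ge0 ?ltW//.
  by field; rewrite gt_eqF.
rewrite ge0_integralZl//; last 3 first.
- by apply/measurable_EFinP; exact: measurable_gauss_pdf.
- by move=> x _; rewrite lee_fin ltW// gauss_pdf_gt0.
- by rewrite lee_fin invr_ge0 ltW.
by rewrite gauss_pdfE integral_normal_pdf mule1.
Qed.

Lemma expR_sqr_list (l : seq R) :
  expR (- ((\sum_(x <- l) x ^+ 2) / 2)) =
  ((normal_peak 1)^-1 ^+ size l * \prod_(x <- l) gauss_pdf x)%R.
Proof.
have p0 : normal_peak (1 : R) != 0%R.
  by rewrite gt_eqF// normal_peak_gt0// oner_neq0.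
elim: l => [|x l IH]; first by rewrite !big_nil mul0r oppr0 expR0 mulr1.
rewrite !big_cons mulrDl opprD expRD IH /= (exprS _ (size l)).
rewrite -[gauss_pdf x]/(normal_peak 1 * expR (- (x ^+ 2 / 2)))%R.
set e := expR _; set q := (_ ^+ _)%R; set P := (\prod_(j <- l) _)%R.
by field.
Qed.

Lemma measurable_nth_cons0 n i :
  measurable_fun [set: n.-tuple R] (fun t : n.-tuple R => nth 0%R (0%R :: t) i).
Proof. by case: i => [|i] //=; exact: measurable_tuple_nth. Qed.

Lemma measurable_loop_energy n k :
  measurable_fun [set: n.-tuple R] (fun t : n.-tuple R => loop_energy k t).
Proof.
apply: measurable_sum => i; apply: measurable_funX; apply: measurable_funB;
  exact: measurable_tuple_nth.
Qed.

Lemma measurable_nth_partial_sums n (s c : R) i :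
  measurable_fun [set: n.-tuple R]
    (fun t : n.-tuple R => nth 0%R (c :: partial_sums s c t) i).
Proof.
have [ni|] := ltnP n i.
  apply: (eq_measurable_fun (fun _ : n.-tuple R => 0%R : R)); last exact: measurable_cst.
  by move=> t _; rewrite nth_default//= size_scanl size_tuple.
elim: i => [|i IH] ni; first exact: measurable_cst.
apply: (eq_measurable_fun (fun t : n.-tuple R =>
    nth 0 (c :: partial_sums s c t) i + s * nth 0 t i)%R).
  move=> t _.
  have : (i < size t)%N by rewrite size_tuple.
  elim: (tval t) c i {IH ni} => [|x l IHl] u [|i]//= il.
  exact: (IHl (u + s * x)%R i il).
apply: measurable_funD; first by apply: IH; exact: ltnW.
by apply: measurable_funM => //; exact: measurable_tuple_nth.
Qed.

Lemma list_measurable_path_weight N (A a : R) (H : seq R -> \bar R) :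
  list_measurable N H ->
  list_measurable N (fun y => (expR (- (A * path_energy N y)))%:E * H (bridge N a y)).
Proof.
move=> mH; apply: emeasurable_funM.
  apply/measurable_EFinP/measurableT_comp => //; apply: measurableT_comp => //.
  apply: measurable_funM => //; apply: measurable_sum => i.
  by apply: measurable_funX; apply: measurable_funB; exact: measurable_nth_cons0.
apply: (measurable_list_comp mH) => [t|i iN]; first exact: size_bridge.
apply: (eq_measurable_fun (fun t : N.-tuple R =>
    a + (nth 0 (0 :: t) i - i%:R / N%:R * nth 0 (0 :: t) N))%R).
  by move=> t _; rewrite nth_mkseq.
apply: measurable_funD => //; apply: measurable_funB.
  exact: measurable_nth_cons0.
by apply: measurable_funM => //; exact: measurable_nth_cons0.
Qed.

Lemma list_measurable2_rcons n F : list_measurable n.+1 F ->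
  list_measurable2 n (fun (x : M) l => F (rcons l x)).
Proof.
move=> mF; apply: (measurable_list_comp mF) => [p|i ni].
  by rewrite size_rcons size_tuple.
have [i_n|n_i] := ltnP i n.
  apply: (eq_measurable_fun (fun p : M * n.-tuple R => nth 0%R p.2 i)).
    by move=> p _; rewrite nth_rcons size_tuple i_n.
  apply: (@measurableT_comp _ _ _ _ _ _ (fun t : n.-tuple R => nth 0%R t i) _ snd).
    exact: measurable_tuple_nth.
  exact: measurable_snd.
apply: (eq_measurable_fun (fun p : M * n.-tuple R => p.1)).
  have -> : i = n by apply/eqP; rewrite eqn_leq n_i -ltnS ni.
  by move=> p _; rewrite nth_rcons size_tuple ltnn eqxx.
exact: measurable_fst.
Qed.

(* The auxiliary Gaussian variable [s] releases the constraint that a loop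
   closes: the loop based at [a] together with [s] is the same datum as a free
   path of [N] steps ending at [s]. *)
Lemma lebesgue_loop N (A : R) : (0 < N)%N -> (0 < A)%R ->
  exists2 C : R, (0 < C)%R & forall H : seq R -> \bar R,
    list_measurable N H -> (forall l, 0 <= H l) ->
    itint leb N (fun f => (expR (- (A * loop_energy N f)))%:E * H f) =
    C%:E * \int[leb]_a itint (@gauss R) N
      (fun x => H (bridge N a (partial_sums (Num.sqrt (2 * A))^-1 0 x))).
Proof.
case: N => // n _ A0; set N := n.+1.
have NR0 : (0 < N%:R :> R)%R by rewrite ltr0n.
have AN0 : (0 < A / N%:R)%R by rewrite divr_gt0.
have [c c0 cE] := integral_expR_sqr AN0.
pose s0 := (Num.sqrt (2 * A))^-1%R.
have s00 : (0 < s0)%R by rewrite invr_gt0 sqrtr_gt0 mulr_gt0.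
have p0 : (0 < normal_peak (1 : R))%R by rewrite normal_peak_gt0// oner_neq0.
(* [s0 ^+ N] is the Jacobian of [partial_sums]; the other factor removes the constants of N normal
   densities. The number [c] above is the integral of the auxiliary Gaussian factor. *)
pose D := (s0 ^+ N * (normal_peak (1 : R))^-1 ^+ N)%R.
have D0 : (0 < D)%R by rewrite mulr_gt0// exprn_gt0// invr_gt0.
exists (D / c)%R; first by rewrite divr_gt0.
move=> H mH H0; set Q := fun f => _ * H f.
have mQ : list_measurable N Q.
  apply: emeasurable_funM => //; apply/measurable_EFinP.
  apply: measurableT_comp => //; apply: measurableT_comp => //.
  by apply: measurable_funM => //; exact: measurable_loop_energy.
have Q0 l : 0 <= Q l by rewrite mule_ge0// lee_fin expR_ge0.
(* With the base point fixed, both sides equal the integral of [Y] over free paths: on the right the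
   increments are the coordinates, on the left the auxiliary variable is the last value of the
   path. *)
have key a : c%:E * itint leb n (fun l => Q (a :: l)) =
    D%:E * itint (@gauss R) N (fun x => H (bridge N a (partial_sums s0 0 x))).
  pose Y y := (expR (- (A * path_energy N y)))%:E * H (bridge N a y).
  have mY : list_measurable N Y by exact: list_measurable_path_weight.
  have Y0 l : 0 <= Y l by rewrite mule_ge0// lee_fin expR_ge0.
  transitivity (itint leb N Y); last first.
    rewrite -(mul1e (itint leb N Y)) -[1]/(1%R%:E).
    rewrite -(mulfV (x := s0 ^+ N)%R) ?gt_eqF ?exprn_gt0//.
    rewrite EFinM -muleA -exprVn -(itint_lebesgue_partial_sums 0 s00 mY Y0).
    rewrite /D EFinM -muleA; congr (_ * _).
    have mG : list_measurable N (fun x => H (bridge N a (partial_sums s0 0 x))).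
      apply: (measurable_list_comp mH) => [t|i iN]; first exact: size_bridge.
      apply: (eq_measurable_fun (fun t : N.-tuple R =>
          a + (nth 0 (0 :: partial_sums s0 0 t) i -
            i%:R / N%:R * nth 0 (0 :: partial_sums s0 0 t) N))%R).
        by move=> t _; rewrite nth_mkseq.
      apply: measurable_funD => //; apply: measurable_funB.
        exact: measurable_nth_partial_sums.
      by apply: measurable_funM => //; exact: measurable_nth_partial_sums.
    rewrite -itint_gaussE// -itintZl//; last 3 first.
    - by rewrite exprn_ge0// invr_ge0 ltW.
    - apply: emeasurable_funM => //.
      by apply/measurable_EFinP; apply: measurable_list_pdf.
    - by move=> l; rewrite mule_ge0// lee_fin list_pdf_ge0.
    apply: eq_itint => l lN; rewrite muleA /Y -EFinM -lN -expR_sqr_list lN.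
    congr ((expR (- _)%R)%:E * _).
    rewrite /path_energy -[in LHS]lN path_energy_partial_sums mulrA mulrC; congr (_ * _)%R.
    rewrite exprVn sqr_sqrtr ?mulr_ge0 ?ltW//; field; by rewrite gt_eqF.
  rewrite itint_rcons -itint_swap; last 2 first.
  - exact: list_measurable2_rcons.
  - by [].
  rewrite -cE -ge0_integralZr//; last 2 first.
  - apply/measurable_EFinP/measurableT_comp => //; apply: measurableT_comp => //.
    by apply: measurable_funM => //; exact: measurable_funX.
  - exact: itint_ge0.
  apply: eq_integral => s _.
  rewrite -itintZl ?expR_ge0//; last exact: list_measurable_cons.
  (* Translation by [v] sends the path values at times 1/N, ..., n/N to those of the bridge; the
     value at time 0 is the head [a]. *)
  pose v : seq R := mkseq (fun i => a - i.+1%:R / N%:R * s)%R n.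
  have vn : size v = n by rewrite size_mkseq.
  rewrite -[in LHS]vn itint_lebesgue_shift; last 2 first.
  - rewrite vn; apply: emeasurable_funM => //; exact: list_measurable_cons.
  - by move=> l; rewrite mule_ge0// lee_fin expR_ge0.
  rewrite vn; apply: eq_itint => l ln.
  have brE : a :: [seq (p.1 + p.2)%R | p <- zip l v] = bridge N a (rcons l s).
    apply: (@eq_from_nth _ 0%R).
      by rewrite size_bridge /= size_map size_zip vn ln minnn.
    move=> i; rewrite /= size_map size_zip vn ln minnn => iN.
    rewrite nth_mkseq// /=; case: i iN => [|i] iN /=.
      by rewrite mul0r mul0r subr0 addr0.
    rewrite (nth_map (0, 0)%R) ?size_zip ?vn ?ln ?minnn// nth_zip ?vn ?ln//= nth_mkseq//.
    by rewrite !nth_rcons !ln ltnn eqxx -ltnS iN addrCA.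
  rewrite /Q brE /Y muleA -EFinM -expRD; congr ((expR _)%:E * _).
  rewrite -(@loop_energy_bridge _ N a)//.
  rewrite /= nth_rcons ln ltnn eqxx; ring.
transitivity ((c^-1)%:E * (c%:E * itint leb N Q)).
  by rewrite muleA -EFinM mulVf ?mul1e// gt_eqF.
rewrite (mulrC D) EFinM -muleA; congr (_ * _).
rewrite -ge0_integralZl//; last 3 first.
- exact: measurable_itint_cons.
- by move=> x _; exact: itint_ge0.
- by rewrite lee_fin ltW.
under eq_integral do rewrite key.
rewrite ge0_integralZl//; last 3 first.
- apply: measurable_itint => //; apply: (measurable_list_comp mH) => [p|i iN].
    exact: size_bridge.
  apply: (eq_measurable_fun (fun p : M * N.-tuple R =>
      p.1 + (nth 0 (0 :: partial_sums s0 0 p.2) i -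
        i%:R / N%:R * nth 0 (0 :: partial_sums s0 0 p.2) N))%R).
    by move=> t _; rewrite nth_mkseq.
  have mn j : measurable_fun [set: M * N.-tuple R]
      (fun p : M * N.-tuple R => nth 0%R (0%R :: partial_sums s0 0 p.2) j).
    apply: (@measurableT_comp _ _ _ _ _ _
      (fun t : N.-tuple R => nth 0%R (0%R :: partial_sums s0 0 t) j) _ snd).
      exact: measurable_nth_partial_sums.
    exact: measurable_snd.
  apply: measurable_funD => //; apply: measurable_funB => //.
  exact: measurable_funM.
- by move=> x _; exact: itint_ge0.
- by rewrite lee_fin ltW.
Qed.

End loop_change_of_variables.

(** * Independent variables from binary digits *)

Lemma probability_setT_lty d (T : measurableType d) (R : realType)
  (P : probability T R) : (P setT < +oo)%E.
Proof. by rewrite probability_setT ltry. Qed.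

Section circle_probability.
Context {R : realType}.
Notation M := (measurableTypeR R).
Notation leb := (@lebesgue_measure R).
Local Open Scope ereal_scope.

Lemma circle_measureE (A : set M) : circle_measure A = leb (A `&` `[0%R, 1%R[).
Proof. by []. Qed.

Let circle_setT : @circle_measure R setT = 1.
Proof.
rewrite circle_measureE setTI lebesgue_measure_itv/= lte_fin ltr01.
by rewrite -EFinB subr0.
Qed.

HB.instance Definition _ :=
  @Measure_isProbability.Build _ _ R (@circle_measure R) circle_setT.

Definition unif : probability M R := @circle_measure R.

Lemma ge0_integral_unif (f : M -> \bar R) :
  measurable_fun setT f -> (forall x, 0 <= f x) ->
  \int[unif]_x f x = \int[leb]_x ((\1_`[0%R, 1%R[ x)%:E * f x).
Proof.
move=> mf f0.
apply: (@ge0_integral_weighted_image _ _ _ _ _ leb unif idfun \1_`[0%R, 1%R[ _ _ _ _ f) => //.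
- exact: measurable_id.
move=> A mA; rewrite -[LHS]/(leb (A `&` `[0%R, 1%R[)).
rewrite -[in LHS](setIT (A `&` _)) -integral_indic//; last exact: measurableI.
by apply: eq_integral => x _; rewrite -EFinM indicI mulrC.
Qed.

End circle_probability.

(** * Laws on the line and the quantile transform *)

Section measure_rays.
Context {R : realType}.
Notation M := (measurableTypeR R).
Local Open Scope ereal_scope.

(** Half-open intervals are differences of rays; they are stable under intersection and generate the
    Borel sets. *)
Lemma measure_eq_rays (m1 m2 : {measure set M -> \bar R}) :
  m1 setT < +oo -> m2 setT < +oo ->
  (forall x : R, m1 `]-oo, x]%classic = m2 `]-oo, x]%classic) ->
  forall A, measurable A -> m1 A = m2 A.
Proof.
move=> m1oo m2oo m12 A mA.
have fin (m : {measure set M -> \bar R}) B : m setT < +oo -> measurable B -> m B < +oo.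
  by move=> moo mB; apply: le_lt_trans moo; rewrite le_measure ?inE.
have mray (x : R) : measurable (`]-oo, x]%classic : set M) by exact: measurable_itv.
apply: (@measure_unique _ R M (@ocitv R) (fun k => `](- k%:R)%R, k%:R]%classic)) => //.
- exact: ocitvI.
- by move=> k; exact: is_ocitv.
- rewrite -subTset => x _ /=; exists (Num.truncn `|x|).+1 => //=.
  rewrite in_itv/=; have := truncnS_gt `|x|%R.
  by rewrite lter_norml => /andP[-> /ltW].
- move=> B [[a b]/= _ <-].
  have [ab | ba] := leP a b; last first.
    by rewrite set_itv_ge ?measure0// bnd_simp -leNgt ltW.
  have -> : `]a, b]%classic = `]-oo, b] `\` `]-oo, a] :> set M.
    by rewrite -[RHS]setCK setCD setCitvl setUC -[LHS]setCK setCitv.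
  rewrite !measureD ?setIidr//; try exact: subset_itvl.
  + by congr (_ - _); exact: m12.
  + exact: fin.
  + exact: fin.
- by move=> k; exact: fin.
Qed.

End measure_rays.

Section quantile.
Context {R : realType} (P : probability (measurableTypeR R) R).
Notation M := (measurableTypeR R).

Let c (x : R) : R := fine (P `]-oo, x]%classic).

Let cE x : P `]-oo, x]%classic = (c x)%:E.
Proof. by rewrite fineK// fin_num_measure. Qed.

Let cfin x : (P `]-oo, x]%classic < +oo)%E. Proof. by rewrite cE ltry. Qed.

Let c_ge0 x : 0 <= c x. Proof. by rewrite fine_ge0. Qed.

Let c_le1 x : c x <= 1. Proof. by rewrite -lee_fin -cE probability_le1. Qed.

Let c_nd x y : x <= y -> c x <= c y.
Proof.
by move=> xy; rewrite -lee_fin -!cE le_measure ?inE//; exact: subset_itvl.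
Qed.

Let mray (x : R) : measurable (`]-oo, x]%classic : set M).
Proof. exact: measurable_itv. Qed.

Let c_rc x (u : R) : (forall e, 0 < e -> u <= c (x + e)) -> u <= c x.
Proof.
move=> h; rewrite -lee_fin -cE.
have lim : P `]-oo, (x + n.+1%:R^-1)]%classic @[n --> \oo] --> P `]-oo, x]%classic.
  rewrite (itvNycEbigcap false); apply: nonincreasing_cvg_mu => //.
  - exact: cfin.
  - exact: bigcapT_measurable.
  - move=> m n mn; apply/subsetPset; apply: subset_itvl.
    by rewrite bnd_simp lerD2l lef_pV2 ?posrE// ler_nat.
apply: (cvge_to_ge lim); apply: nearW => n /=.
by rewrite cE lee_fin h// invr_gt0.
Qed.

Let c_big (u : R) : u < 1 -> exists x, u <= c x.
Proof.
move=> u1; apply: contrapT => h.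
have lim : P `]-oo, n%:R]%classic @[n --> \oo] --> P (\bigcup_n (`]-oo, n%:R]%classic : set M)).
  apply: nondecreasing_cvg_mu => //; first exact: bigcupT_measurable.
  by move=> m n mn; apply/subsetPset; apply: subset_itvl; rewrite bnd_simp ler_nat.
have : (P (\bigcup_n (`]-oo, n%:R]%classic : set M)) <= u%:E)%E.
  apply: (cvge_to_le lim); apply: nearW => n /=; rewrite cE lee_fin leNgt.
  by apply/negP => /ltW un; apply: h; exists n%:R.
apply/negP; rewrite -ltNge (_ : \bigcup_n _ = setT).
  by rewrite [P setT]probability_setT lte_fin.
rewrite -subTset => x _ /=; exists (Num.truncn `|x|).+1 => //=.
by rewrite in_itv/= (le_trans (ler_norm x))// ltW// truncnS_gt.
Qed.

Let c_small (u : R) : 0 < u -> exists x, c x < u.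
Proof.
move=> u0; apply: contrapT => h.
have lim : P `]-oo, (- n%:R)]%classic @[n --> \oo] --> P (\bigcap_n (`]-oo, (- n%:R)]%classic : set M)).
  apply: nonincreasing_cvg_mu => //.
  - exact: cfin.
  - exact: bigcapT_measurable.
  - by move=> m n mn; apply/subsetPset; apply: subset_itvl; rewrite bnd_simp lerN2 ler_nat.
have : (u%:E <= P (\bigcap_n (`]-oo, (- n%:R)%R]%classic : set M)))%E.
  apply: (cvge_to_ge lim); apply: nearW => n /=; rewrite cE lee_fin leNgt.
  by apply/negP => un; apply: h; exists (- n%:R).
apply/negP; rewrite -ltNge (_ : \bigcap_n _ = set0) ?measure0//.
rewrite -subset0 => x /= /(_ (Num.truncn `|x|).+1 Logic.I) /=.
rewrite in_itv/= => xn; have := truncnS_gt `|x|.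
by rewrite ltNge ler_normr orbC lerNr xn.
Qed.

(** The generalised inverse of the distribution function [c]. The default 0 outside ]0, 1[ concerns
    only the null point 0 of [0, 1[. *)
Definition quantile (u : M) : M :=
  if (0 < u < 1) then inf [set x | u <= c x] else 0.

(** Right continuity of [c] makes the infimum a minimum; [c_big] and [c_small] make the set nonempty
    and bounded below. *)
Lemma quantile_le (u x : R) : 0 < u < 1 -> (quantile u <= x) = (u <= c x).
Proof.
move=> u01; rewrite /quantile u01; case/andP: u01 => u0 u1.
set S := [set x | u <= c x].
have S0 : S !=set0 by exact: c_big.
have lS : has_lbound S.
  have [y yu] := c_small u0.
  exists y => z /= uz; rewrite leNgt; apply/negP => /ltW/c_nd.
  by apply/negP; rewrite -ltNge (lt_le_trans yu).
apply/idP/idP => [qx|ux]; last exact: ge_inf.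
apply: c_rc => e e0.
have [y Sy yq] := inf_adherent e0 (conj S0 lS).
apply: (le_trans Sy); apply: c_nd; apply/ltW/(lt_le_trans yq).
by rewrite lerD2r.
Qed.

Lemma measurable_quantile : measurable_fun setT quantile.
Proof.
move=> mT; apply: (measurability _ (RGenOInfty.measurableE R)) => //.
move=> _ [_ [x ->] <-]; rewrite setTI.
have -> : quantile @^-1` `]x, +oo[ =
    (`]0, 1[ `&` `]c x, +oo[) `|` (~` `]0, 1[ `&` [set _ | x < 0]) :> set M.
  apply/seteqP; split => u /=; rewrite !in_itv/= !andbT.
    have [u01|nu01] := boolP (0 < u < 1).
      by rewrite ltNge quantile_le// -ltNge; left.
    by rewrite /quantile (negbTE nu01); right.
  case=> [[u01]|[/negP/negbTE nu01]]; last by rewrite /quantile nu01.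
  by rewrite ltNge => /negP cu; rewrite ltNge quantile_le//; apply/negP.
apply: measurableU; apply: measurableI; [exact: measurable_itv|
  exact: measurable_itv|by apply: measurableC; exact: measurable_itv|].
by have [x0|x0] := boolP (x < 0);
  [rewrite (_ : [set _ | _] = setT)|rewrite (_ : [set _ | _] = set0)] => //;
  apply/seteqP; split.
Qed.

Let pushq : {measure set M -> \bar R} :=
  measure_function_pushforward__canonical__measure_function_Measure unif measurable_quantile.

(** Inverse transform sampling: by [quantile_le] the preimage of the ray up to x meets ]0, 1[ in an
    interval of length c x, and rays determine the law. *)
Lemma quantile_law A : measurable A -> P A = unif (quantile @^-1` A).
Proof.
apply: (@measure_eq_rays R P pushq).
- exact: probability_setT_lty.
- exact: (probability_setT_lty unif).
move=> x; rewrite -[RHS]/(@lebesgue_measure R (quantile @^-1` `]-oo, x] `&` `[0, 1[)).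
etransitivity; first exact: cE.
have mq : measurable ((quantile @^-1` `]-oo, x] `&` `]0, 1[) : set M).
  apply: measurableI; last exact: measurable_itv.
  by rewrite -[X in measurable X]setTI; exact: measurable_quantile.
(* The point 0, where [quantile] takes its default value, has measure zero. *)
have -> : @lebesgue_measure R (quantile @^-1` `]-oo, x] `&` `[0, 1[) =
          @lebesgue_measure R (quantile @^-1` `]-oo, x] `&` `]0, 1[).
  apply/eqP; rewrite eq_le; apply/andP; split; last first.
    apply: le_measure; rewrite ?inE//.
      apply: measurableI; last exact: measurable_itv.
      by rewrite -[X in measurable X]setTI; exact: measurable_quantile.
    by apply: setIS; apply: subset_itvW.
  rewrite -[leRHS]adde0 -(lebesgue_measure_set1 (0 : R)).
  apply: (@le_trans _ _ (@lebesgue_measure R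
      ((quantile @^-1` `]-oo, x] `&` `]0, 1[) `|` [set 0]))); last first.
    exact: measureU2.
  apply: le_measure; rewrite ?inE//.
  - apply: measurableI; last exact: measurable_itv.
    by rewrite -[X in measurable X]setTI; exact: measurable_quantile.
  - exact: measurableU.
  move=> u [qu]; rewrite /= !in_itv/= => /andP[]; rewrite le_eqVlt => /predU1P[<-|u0] u1.
    by right.
  by left; split => //; rewrite u0 u1.
have -> : quantile @^-1` `]-oo, x] `&` `]0, 1[ = `]0, 1[ `&` `]-oo, c x] :> set M.
  apply/seteqP; split => u /=; rewrite !in_itv/=.
    by move=> [qx u01]; split=> //; rewrite -quantile_le.
  by move=> [u01 ux]; rewrite quantile_le.
have [c1|c1] := ltP (c x) 1.
  have -> : `]0, 1[ `&` `]-oo, c x] = `]0, c x]%classic :> set M.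
    apply/seteqP; split => u /=; rewrite !in_itv/=; first by move=> [/andP[-> _] ->].
    by move=> /andP[u0 uc]; rewrite u0 uc (le_lt_trans uc).
  rewrite lebesgue_measure_itv/= lte_fin -EFinB subr0; case: ltP => // c0.
  by apply/eqP; rewrite eqe eq_le c0 c_ge0.
have -> : c x = 1 by apply/eqP; rewrite eq_le c1 c_le1.
rewrite setIidl; first by rewrite lebesgue_measure_itv/= lte_fin ltr01 -EFinB subr0.
by move=> u /=; rewrite !in_itv/= => /andP[_ /ltW].
Qed.

End quantile.

(** * Even and odd binary digits of a uniform variable *)

Section binary_digits.
Context {R : realType}.
Notation M := (measurableTypeR R).
Notation leb := (@lebesgue_measure R).
Local Notation unif := (@unif R).

(** On [0, 1[, [bit] is the first binary digit and [bin_shift] the doubling map modulo 1; the values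
    elsewhere have no meaning. *)
Definition bit (w : M) : R := \1_`[2^-1, +oo[ w.
Definition bin_shift (w : M) : M := 2 * w - bit w.

Lemma measurable_bit : measurable_fun setT bit.
Proof. by apply: measurable_indic; exact: measurable_itv. Qed.

Lemma measurable_bin_shift : measurable_fun setT bin_shift.
Proof.
by apply: measurable_funB; [exact: measurable_funM|exact: measurable_bit].
Qed.

Lemma bit_ge0 w : 0 <= bit w. Proof. by rewrite /bit indicE. Qed.

Lemma bit_le1 w : bit w <= 1. Proof. by rewrite /bit indicE lern1 leq_b1. Qed.

(** The first digit is fair and independent of the remaining ones: on each half of [0, 1[ the shift
    is affine onto [0, 1[. *)
Lemma integral_unif_bit (G : R -> M -> \bar R) :
  (forall b, measurable_fun setT (G b)) -> (forall b w, 0 <= G b w)%E ->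
  measurable_fun setT (fun w => G (bit w) (bin_shift w)) ->
  (\int[unif]_w G (bit w) (bin_shift w) =
   2^-1%:E * (\int[unif]_w G 0%R w + \int[unif]_w G 1%R w))%E.
Proof.
move=> mG G0 mGb; rewrite ge0_integral_unif//.
pose f b (y : M) := ((\1_`[0%R, 1%R[ y)%:E * G b y)%E.
have mf b : measurable_fun setT (f b).
  apply: emeasurable_funM => //; apply/measurable_EFinP.
  by apply: measurable_indic; exact: measurable_itv.
have f0 b y : (0 <= f b y)%E by rewrite mule_ge0// lee_fin.
transitivity (\int[leb]_w (f 0%R (2 * w + 0)%R + f 1%R (2 * w + (-1))%R))%E.
  (* For w in [0, 1[ exactly one indicator survives, according to the half containing w, and none
     outside. The number 1/2 is generalised to some h with 2 h = 1 so that the cases are linear. *)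
  apply: eq_integral => w _; rewrite /f !indicE !mem_setE !in_itv/= addr0.
  rewrite /bit /bin_shift /bit indicE mem_setE in_itv/= andbT.
  move: w => w; have : (2 : R) * 2^-1 = 1 by rewrite mulfV.
  move: (2^-1 : R) (w : R) => h {}w h1.
  case: (leP h w) => w1; (case: (leP 0 w) => w2; try by exfalso; lra);
    (case: (ltP w 1) => w3; try by exfalso; lra);
    (case: (leP 0 (2 * w)) => w4; try by exfalso; lra);
    (case: (ltP (2 * w) 1) => w5; try by exfalso; lra);
    (case: (leP 0 (2 * w + -1)) => w6; try by exfalso; lra);
    case: (ltP (2 * w + -1) 1) => w7;
    rewrite /= ?mul0e ?mul1e ?add0e ?adde0 ?subr0//; exfalso; lra.
have mf2 b c : measurable_fun setT (fun w : M => f b (2 * w + c)).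
  apply: (measurableT_comp (mf b)).
  by apply: measurable_funD => //; exact: measurable_funM.
rewrite ge0_integralD//.
rewrite !ge0_integral_lebesgue_affineV// -ge0_muleDr ?integral_ge0//.
by rewrite !ge0_integral_unif.
Qed.

Lemma integral_unif_half (f : M -> \bar R) :
  measurable_fun setT f -> (forall w, 0 <= f w)%E ->
  (\int[unif]_w f w = 2^-1%:E *
    (\int[unif]_w f ((0 + w) / 2)%R + \int[unif]_w f ((1 + w) / 2)%R))%E.
Proof.
move=> mf f0; pose G b (v : M) := f ((b + v) / 2).
have wE (w : R) : (bit w + bin_shift w) / 2 = w by rewrite /bin_shift addrC subrK; field.
rewrite -(@integral_unif_bit G)//.
- by apply: eq_integral => w _; rewrite /G wE.
- move=> b; apply: (measurableT_comp mf); apply: measurable_funM => //.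
  exact: measurable_funD.
- by move=> b w; exact: f0.
- by rewrite [X in measurable_fun _ X](_ : _ = f)//; apply/funext => w; rewrite /G wE.
Qed.

(** The number whose binary digits are the first n among the digits 0, 2, 4, ... of [w]; composing
    with [bin_shift] selects the digits 1, 3, 5, ... instead. *)
Fixpoint even_digits_upto n (w : M) : R :=
  if n is k.+1 then (bit w + even_digits_upto k (bin_shift (bin_shift w))) / 2 else 0.

Lemma measurable_even_digits_upto n : measurable_fun setT (even_digits_upto n).
Proof.
elim: n => [|n IH] //=; apply: measurable_funM => //.
apply: measurable_funD; first exact: measurable_bit.
apply: (measurableT_comp IH); apply: (measurableT_comp measurable_bin_shift).
exact: measurable_bin_shift.
Qed.

Lemma even_digits_upto01 n w : 0 <= even_digits_upto n w <= 1.
Proof.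
elim: n w => [|n IH] w /=; first by rewrite lexx ler01.
have := IH (bin_shift (bin_shift w)); have := bit_ge0 w; have := bit_le1 w.
move=> ? ? /andP[? ?]; apply/andP; split; lra.
Qed.

Lemma even_digits_upto_nd n w : even_digits_upto n w <= even_digits_upto n.+1 w.
Proof.
elim: n w => [|n IH] w; first by case/andP: (even_digits_upto01 1 w).
rewrite [leLHS]/= [leRHS]/= ler_pM2r ?invr_gt0// lerD2l; exact: IH.
Qed.

Definition even_digits (w : M) : M := limn (even_digits_upto ^~ w).

Lemma cvg_even_digits w : even_digits_upto ^~ w @ \oo --> even_digits w.
Proof.
apply: nondecreasing_is_cvgn.
  by apply/nondecreasing_seqP => n; exact: even_digits_upto_nd.
by exists 1 => _ [n _ <-]; case/andP: (even_digits_upto01 n w).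
Qed.

Lemma measurable_even_digits : measurable_fun setT even_digits.
Proof.
apply: (measurable_fun_cvg (h := even_digits_upto)).
  exact: measurable_even_digits_upto.
by move=> w _; exact: cvg_even_digits.
Qed.

Lemma even_digits01 w : 0 <= even_digits w <= 1.
Proof.
apply/andP; split.
  apply: (cvgr_to_ge (@cvg_even_digits w)); apply: nearW => n.
  by case/andP: (even_digits_upto01 n w).
apply: (cvgr_to_le (@cvg_even_digits w)); apply: nearW => n.
by case/andP: (even_digits_upto01 n w).
Qed.

Lemma even_digitsE w : even_digits w = (bit w + even_digits (bin_shift (bin_shift w))) / 2.
Proof.
have h1 : even_digits_upto n.+1 w @[n --> \oo] --> even_digits w.
  by rewrite (cvg_shiftS (even_digits_upto ^~ w)); exact: cvg_even_digits.
have h2 : even_digits_upto n.+1 w @[n --> \oo] -->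
    (bit w + even_digits (bin_shift (bin_shift w))) / 2.
  by apply: cvgM; [apply: cvgD; [exact: cvg_cst|exact: cvg_even_digits]|exact: cvg_cst].
exact: (cvg_unique _ h1 h2).
Qed.

Local Notation D := even_digits.
(** Two laws on the square are compared: that of the even and odd digits of one uniform variable,
    and that of two independent uniform variables. Both integrals are the average ([avg4]) of the
    same integrals over the four quarters of the square, which forces them to agree. *)
Definition digits_integral (F : M -> M -> \bar R) : \bar R := (\int[unif]_w F (D w) (D (bin_shift w)))%E.
Definition square_integral (F : M -> M -> \bar R) : \bar R := (\int[unif]_x \int[unif]_y F x y)%E.
Definition quarter (F : M -> M -> \bar R) (b b' : R) (x y : M) := F ((b + x) / 2) ((b' + y) / 2).
Definition avg4 (a b c d : \bar R) : \bar R :=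
  (2^-1%:E * (2^-1%:E * (a + b) + 2^-1%:E * (c + d)))%E.
Definition measurable2 (F : M -> M -> \bar R) := measurable_fun setT (fun z : M * M => F z.1 z.2).

Lemma measurable2_comp d (T : measurableType d) F (f g : T -> M) : measurable2 F ->
  measurable_fun setT f -> measurable_fun setT g ->
  measurable_fun setT (fun t => F (f t) (g t)).
Proof. by move=> mF mf mg; exact: (measurableT_comp mF (measurable_fun_pair mf mg)). Qed.

Lemma measurable_half_sum d (T : measurableType d) (f g : T -> R) :
  measurable_fun setT f -> measurable_fun setT g ->
  measurable_fun setT (fun t => (f t + g t) / 2 : M).
Proof. by move=> mf mg; apply: measurable_funM => //; exact: measurable_funD. Qed.

Lemma measurable2_quarter F b b' : measurable2 F -> measurable2 (quarter F b b').
Proof. by move=> mF; apply: (measurable2_comp mF); exact: measurable_half_sum. Qed.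

(** Reads two digits by [integral_unif_bit]: the first goes to the first coordinate, the second to
    the second one. *)
Lemma digits_integral_avg F : measurable2 F -> (forall x y, 0 <= F x y)%E ->
  digits_integral F = avg4 (digits_integral (quarter F 0 0)) (digits_integral (quarter F 0 1))
    (digits_integral (quarter F 1 0)) (digits_integral (quarter F 1 1)).
Proof.
move=> mF F0.
have mD : measurable_fun setT D by exact: measurable_even_digits.
have ms : measurable_fun setT bin_shift by exact: measurable_bin_shift.
have mb : measurable_fun setT bit by exact: measurable_bit.
have mDs : measurable_fun setT (fun w => D (bin_shift w)) by exact: measurableT_comp.
have mDss : measurable_fun setT (fun w => D (bin_shift (bin_shift w)))
  by exact: (measurableT_comp mDs ms).
pose G b (v : M) := F ((b + D (bin_shift v)) / 2) ((bit v + D (bin_shift (bin_shift v))) / 2).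
have mG b : measurable_fun setT (G b) by apply: (measurable2_comp mF); exact: measurable_half_sum.
have GE b : (\int[unif]_v G b v = 2^-1%:E * (digits_integral (quarter F b 0) + digits_integral (quarter F b 1)))%E.
  rewrite -(@integral_unif_bit
    (fun b' v => F ((b + D v) / 2) ((b' + D (bin_shift v)) / 2)))//.
  - by move=> b'; apply: (measurable2_comp mF); exact: measurable_half_sum.
  - exact: mG.
rewrite /avg4 -!GE -(@integral_unif_bit G mG).
- by apply: eq_integral => w _; rewrite /G (even_digitsE w) (even_digitsE (bin_shift w)).
- by move=> b w; exact: F0.
- apply: (measurable2_comp mF); first exact: measurable_half_sum.
  apply: measurable_half_sum; first exact: (measurableT_comp mb ms).
  exact: (measurableT_comp mDss ms).
Qed.

Lemma square_integral_avg F : measurable2 F -> (forall x y, 0 <= F x y)%E ->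
  square_integral F = avg4 (square_integral (quarter F 0 0)) (square_integral (quarter F 0 1))
    (square_integral (quarter F 1 0)) (square_integral (quarter F 1 1)).
Proof.
move=> mF F0.
have mx d (T : measurableType d) (f : T -> M) (b' : R) : measurable_fun setT f ->
    measurable_fun setT (fun t => \int[unif]_y F (f t) ((b' + y) / 2)%R)%E.
  move=> mf; apply: (@measurable_integral_r _ _ T M R unif
    (fun t y => F (f t) ((b' + y) / 2)%R)) => //.
  apply: (measurable2_comp mF); first exact: (measurableT_comp mf).
  exact: measurable_half_sum.
rewrite /square_integral integral_unif_half; last 2 first.
- exact: measurable_integral_r.
- by move=> w; exact: integral_ge0.
have hE b : (\int[unif]_w \int[unif]_y F ((b + w) / 2)%R y =
    2^-1%:E * (square_integral (quarter F b 0) + square_integral (quarter F b 1)))%E.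
  have mb : measurable_fun setT (fun w : M => (b + w) / 2 : M) by exact: measurable_half_sum.
  rewrite /square_integral -ge0_integralD//; last 4 first.
  - by move=> x _; apply: integral_ge0 => y _; exact: F0.
  - exact: mx.
  - by move=> x _; apply: integral_ge0 => y _; exact: F0.
  - exact: mx.
  rewrite -ge0_integralZl//; last 2 first.
  - by apply: emeasurable_funD; exact: mx.
  - by move=> x _; rewrite adde_ge0//; apply: integral_ge0 => y _; exact: F0.
  apply: eq_integral => x _; rewrite integral_unif_half//.
  by apply: (measurable2_comp mF).
by rewrite !hE.
Qed.

End binary_digits.

(** * Independence of the even and the odd digits *)

Section digits_law.
Context {R : realType}.
Notation M := (measurableTypeR R).
Local Notation unif := (@unif R).
Local Notation D := (@even_digits R).

Lemma avg4_le a b c d a' b' c' d' (e : R) : (0 <= e) ->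
  (0 <= a')%E -> (0 <= b')%E -> (0 <= c')%E -> (0 <= d')%E ->
  (a <= a' + e%:E)%E -> (b <= b' + e%:E)%E -> (c <= c' + e%:E)%E -> (d <= d' + e%:E)%E ->
  (avg4 a b c d <= avg4 a' b' c' d' + e%:E)%E.
Proof.
move=> e0 a0 b0 c0 d0 aa bb cc dd.
have h2 : (0 <= 2^-1 :> R) by [].
apply: (@le_trans _ _ (avg4 (a' + e%:E) (b' + e%:E) (c' + e%:E) (d' + e%:E))%E).
  by rewrite /avg4; rewrite lee_wpmul2l// leeD// lee_wpmul2l// leeD.
have E0 : (0 <= e%:E)%E by rewrite lee_fin.
rewrite /avg4 (addeACA a') (addeACA c').
rewrite (ge0_muleDr _ (adde_ge0 a0 b0) (adde_ge0 E0 E0)).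
rewrite (ge0_muleDr _ (adde_ge0 c0 d0) (adde_ge0 E0 E0)) addeACA.
rewrite ge0_muleDr ?adde_ge0 ?mule_ge0 ?adde_ge0 ?lee_fin//.
by apply: leeD => //; rewrite !(=^~ EFinD, =^~ EFinM) lee_fin; lra.
Qed.

Lemma unif_le_integral (g h : M -> \bar R) : measurable_fun setT g -> measurable_fun setT h ->
  (forall x, 0 <= g x)%E -> (forall x, 0 <= h x)%E ->
  (forall x : R, (0 <= x < 1)%R -> g x <= h x)%E ->
  (\int[unif]_x g x <= \int[unif]_x h x)%E.
Proof.
move=> mg mh g0 h0 gh; rewrite !ge0_integral_unif//.
have mI : measurable_fun setT (fun x : M => (\1_`[0, 1[ x)%:E : \bar R).
  by apply/measurable_EFinP; apply: measurable_indic; exact: measurable_itv.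
apply: ge0_le_integral => //.
- by move=> x _; rewrite mule_ge0// lee_fin.
- exact: emeasurable_funM.
- exact: emeasurable_funM.
move=> x _; rewrite indicE mem_setE in_itv/=.
by case: (boolP (0 <= x < 1)) => [x01|_]; rewrite ?mul1e ?mul0e ?gh.
Qed.

Definition lipschitz2 (L : R) (f : M -> M -> R) := forall x y x' y' : R,
  f x y <= f x' y' + L * (`|x - x'| + `|y - y'|).

Lemma lipschitz2_quarter L f b b' : lipschitz2 L f ->
  lipschitz2 (L / 2) (fun x y => f ((b + x) / 2) ((b' + y) / 2)).
Proof.
move=> fL x y x' y'; apply: (le_trans (fL _ _ ((b + x') / 2) ((b' + y') / 2))).
have h (p q r : R) : `|(p + q) / 2 - (p + r) / 2| = `|q - r| / 2.
  rewrite -mulrBl opprD addrACA subrr add0r normrM; congr (_ * _).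
  by rewrite ger0_norm// invr_ge0.
by rewrite lerD2l !h le_eqVlt; apply/orP; left; apply/eqP; ring.
Qed.

(** On the unit square f oscillates by at most 2 L, which is the case n = 0. Passing to the quarters
    halves the Lipschitz constant, and averaging four quantities with the same error keeps that
    error. *)
Lemma digits_integral_close n L f : 0 <= L -> lipschitz2 L f -> (forall x y, 0 <= f x y) ->
  measurable2 (fun x y => (f x y)%:E) ->
  let e : R := 2 * L / 2 ^+ n in
  (digits_integral (fun x y => (f x y)%:E) <= square_integral (fun x y => (f x y)%:E) + e%:E)%E /\
  (square_integral (fun x y => (f x y)%:E) <= digits_integral (fun x y => (f x y)%:E) + e%:E)%E.
Proof.
elim: n L f => [|n IH] L f L0 fL f0 mf e.
  have mD : measurable_fun setT D by exact: measurable_even_digits.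
  have mDs : measurable_fun setT (fun w => D (bin_shift w)).
    exact: (measurableT_comp mD measurable_bin_shift).
  have e0 : 0 <= e by rewrite /e mulr_ge0// mulr_ge0.
  have mJ : measurable_fun setT (fun w => (f (D w) (D (bin_shift w)))%:E).
    exact: (measurable2_comp mf).
  have mfx x : measurable_fun setT (fun y => (f x y)%:E).
    exact: (measurable2_comp mf).
  have mfI : measurable_fun setT (fun x => \int[unif]_y (f x y)%:E)%E.
    apply: (@measurable_integral_r _ _ M M R unif (fun x y => (f x y)%:E)).
      exact: mf.
    by move=> x y; rewrite lee_fin.
  have eE : e = L * (1 + 1) by rewrite /e expr0 invr1 mulr1 mulrC.
  have near (x y x' y' : R) : 0 <= x <= 1 -> 0 <= y <= 1 -> 0 <= x' <= 1 -> 0 <= y' <= 1 ->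
      f x y <= f x' y' + e.
    move=> /andP[x0 x1] /andP[y0 y1] /andP[x0' x1'] /andP[y0' y1'].
    apply: (le_trans (fL x y x' y')); rewrite lerD2l eE ler_wpM2l// lerD//.
      by rewrite ler_norml; apply/andP; split; lra.
    by rewrite ler_norml; apply/andP; split; lra.
  have D01 w : 0 <= D w <= 1 by exact: even_digits01.
  have w01 (x : R) : 0 <= x < 1 -> 0 <= x <= 1 by case/andP => -> /ltW.
  have mDe (g : M -> R) : measurable_fun setT (fun w => (g w)%:E) ->
      measurable_fun setT (fun w => (g w)%:E + e%:E)%E.
    by move=> mg; exact: emeasurable_funD.
  have Ie (g : M -> \bar R) : measurable_fun setT g -> (forall w, 0 <= g w)%E ->
      (\int[unif]_w (g w + e%:E) = \int[unif]_w g w + e%:E)%E.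
    move=> mg g0; rewrite ge0_integralD//.
    by rewrite integral_probability_cst.
  split.
    have h1 (x y : R) : 0 <= x < 1 -> 0 <= y < 1 ->
        (digits_integral (fun x y => (f x y)%:E) <= (f x y)%:E + e%:E)%E.
      move=> x01 y01.
      rewrite -[leRHS](integral_probability_cst unif).
      apply: ge0_le_integral => //.
      - by move=> w _; rewrite lee_fin.
      - by move=> w _; rewrite -EFinD lee_fin near//; exact: w01.
    rewrite -Ie//; last by move=> x; apply: integral_ge0 => y _; rewrite lee_fin.
    rewrite -[leLHS](integral_probability_cst unif).
    have J0 : (0 <= digits_integral (fun x y => (f x y)%:E))%E.
      by apply: integral_ge0 => w _; rewrite lee_fin.
    apply: unif_le_integral => //.
    - exact: emeasurable_funD.
    - by move=> x; rewrite adde_ge0 ?lee_fin// integral_ge0// => y _; rewrite lee_fin.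
    move=> x x01; rewrite -Ie//; last by move=> y; rewrite lee_fin.
    rewrite -[leLHS](integral_probability_cst unif).
    apply: unif_le_integral => //.
    - exact: mDe.
    - by move=> y; rewrite -EFinD lee_fin addr_ge0.
    by move=> y y01; exact: h1.
  rewrite -Ie//; last by move=> w; rewrite lee_fin.
  rewrite -[leLHS](integral_probability_cst unif).
  apply: ge0_le_integral => //.
  - move=> w _; apply: integral_ge0 => x _; apply: integral_ge0 => y _.
    by rewrite lee_fin.
  - exact: mDe.
  move=> w _; rewrite -[leRHS](integral_probability_cst unif).
  apply: unif_le_integral => //.
  - by move=> x; apply: integral_ge0 => y _; rewrite lee_fin.
  - by move=> x; rewrite -EFinD lee_fin addr_ge0.
  move=> x x01; rewrite -[leRHS](integral_probability_cst unif).
  apply: unif_le_integral => //.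
  - by move=> y; rewrite lee_fin.
  - by move=> y; rewrite -EFinD lee_fin addr_ge0.
  by move=> y y01; rewrite -EFinD lee_fin near//; exact: w01.
have L20 : 0 <= L / 2 by rewrite divr_ge0.
have h b b' := IH (L / 2) (fun x y => f ((b + x) / 2) ((b' + y) / 2)) L20
  (lipschitz2_quarter b b' fL) (fun x y => f0 _ _) (measurable2_quarter b b' mf).
have eE : 2 * (L / 2) / 2 ^+ n = e.
  by rewrite /e exprS invfM; field; rewrite expf_neq0.
have e0 : 0 <= e by rewrite /e !mulr_ge0// invr_ge0 exprn_ge0.
have f0' x y : (0 <= (f x y)%:E)%E by rewrite lee_fin.
have Jge0 b b' : (0 <= digits_integral (quarter (fun x y => (f x y)%:E) b b'))%E.
  by apply: integral_ge0 => w _; rewrite lee_fin.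
have Ige0 b b' : (0 <= square_integral (quarter (fun x y => (f x y)%:E) b b'))%E.
  by apply: integral_ge0 => x _; apply: integral_ge0 => y _; rewrite lee_fin.
rewrite (digits_integral_avg mf f0') (square_integral_avg mf f0').
have h1 b b' : (digits_integral (quarter (fun x y => (f x y)%:E) b b') <=
    square_integral (quarter (fun x y => (f x y)%:E) b b') + e%:E)%E.
  by rewrite -eE; exact: (h b b').1.
have h2 b b' : (square_integral (quarter (fun x y => (f x y)%:E) b b') <=
    digits_integral (quarter (fun x y => (f x y)%:E) b b') + e%:E)%E.
  by rewrite -eE; exact: (h b b').2.
split; [apply: (avg4_le e0 (Ige0 _ _) (Ige0 _ _) (Ige0 _ _) (Ige0 _ _)); exact: h1|
  apply: (avg4_le e0 (Jge0 _ _) (Jge0 _ _) (Jge0 _ _) (Jge0 _ _)); exact: h2].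
Qed.

Lemma digits_integral_lipschitz L f : 0 <= L -> lipschitz2 L f -> (forall x y, 0 <= f x y) ->
  measurable2 (fun x y => (f x y)%:E) ->
  digits_integral (fun x y => (f x y)%:E) = square_integral (fun x y => (f x y)%:E).
Proof.
move=> L0 fL f0 mf.
have small (e : R) : 0 < e -> exists n, 2 * L / 2 ^+ n <= e.
  move=> e0; pose k := (Num.truncn (2 * L / e)).+1; exists k.
  rewrite ler_pdivrMr ?exprn_gt0// [e * _]mulrC -ler_pdivrMr//.
  apply: (@le_trans _ _ k%:R); first by rewrite ltW// truncnS_gt.
  by rewrite -natrX ler_nat ltnW// ltn_expl.
apply/eqP; rewrite eq_le; apply/andP; split; apply/lee_addgt0Pr => e e0;
  have [n ne] := small e e0; have [h1 h2] := digits_integral_close n L0 fL f0 mf.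
  by apply: (le_trans h1); rewrite leeD2l// lee_fin.
by apply: (le_trans h2); rewrite leeD2l// lee_fin.
Qed.

(** A k-Lipschitz approximation from above of the indicator of ]-oo, a]; the comparison of the two
    laws is available for Lipschitz functions only. *)
Definition ray_cutoff (a : R) (k : nat) (x : R) : R :=
  Num.max 0 (1 - k%:R * Num.max 0 (x - a)).

Lemma ray_cutoff01 a k x : 0 <= ray_cutoff a k x <= 1.
Proof.
rewrite /ray_cutoff le_max lexx/= ge_max ler01/= lerBlDr lerDl mulr_ge0//.
by rewrite le_max lexx.
Qed.

Lemma ray_cutoff_lip a k x y :
  ray_cutoff a k x <= ray_cutoff a k y + k%:R * `|x - y|.
Proof.
have m0 (z : R) : 0 <= Num.max 0 z by rewrite le_max lexx.
have mle (z : R) : z <= Num.max 0 z by rewrite le_max lexx orbT.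
rewrite {1}/ray_cutoff ge_max; apply/andP; split.
  by rewrite addr_ge0 ?mulr_ge0//; case/andP: (ray_cutoff01 a k y).
apply: (@le_trans _ _ (1 - k%:R * Num.max 0 (y - a) + k%:R * `|x - y|)); last first.
  by rewrite lerD2r.
rewrite -addrA lerD2l lerNl opprD opprK -mulrN -mulrDr ler_wpM2l//.
rewrite lerBlDr ge_max addr_ge0//=.
have := mle (x - a); have := ler_norm (y - x); rewrite (distrC y x); lra.
Qed.

Lemma cvg_ray_cutoff a x : ray_cutoff a k x @[k --> \oo] --> (\1_`]-oo, a] x : R).
Proof.
rewrite indicE mem_setE in_itv/=; have [xa|ax] := leP x a.
  apply: cvg_near_cst; apply: nearW => k.
  rewrite /ray_cutoff (_ : Num.max 0 (x - a) = 0).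
    by rewrite mulr0 subr0; apply/max_idPr.
  by apply/max_idPl; rewrite subr_le0.
apply: cvg_near_cst; near=> k; rewrite /ray_cutoff.
have xa0 : 0 < x - a by rewrite subr_gt0.
rewrite (max_r (ltW xa0)); apply/max_idPl; rewrite subr_le0 -ler_pdivrMr//.
near: k; exact: nbhs_infty_ger.
Unshelve. all: by end_near. Qed.

Lemma measurable_ray_cutoff a k : measurable_fun setT (ray_cutoff a k : M -> M).
Proof.
apply: measurable_maxr => //; apply: measurable_funB => //.
by apply: measurable_funM => //; apply: measurable_maxr => //; exact: measurable_funB.
Qed.

Lemma cvg_quadrant_cutoff (m : {measure set (M * M) -> \bar R}) a b :
  (m setT < +oo)%E ->
  (\int[m]_z (ray_cutoff a k z.1 * ray_cutoff b k z.2)%:E @[k --> \oo] -->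
    m (`]-oo, a]%classic `*` `]-oo, b]%classic))%E.
Proof.
move=> moo.
have mR c (f : M * M -> M) k : measurable_fun setT f ->
    measurable_fun setT (fun z => ray_cutoff c k (f z)).
  by move=> mf; exact: (measurableT_comp (measurable_ray_cutoff c k) mf).
have mAB : measurable (`]-oo, a]%classic `*` `]-oo, b]%classic : set (M * M)).
  by apply: measurableX; exact: measurable_itv.
rewrite -[X in m X]setIT -integral_indic//.
apply: (@dominated_cvg _ _ _ m setT measurableT
  (fun k z => (ray_cutoff a k z.1 * ray_cutoff b k z.2)%:E)
  _ (cst 1%E)) => //.
- by move=> k; apply/measurable_EFinP; apply: measurable_funM; exact: mR.
- move=> z _; apply/cvg_EFin; first exact: nearW.
  rewrite (_ : \1__ z = \1_`]-oo, a] z.1 * \1_`]-oo, b] z.2); last first.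
    by rewrite !indicE in_setX -natrM mulnb.
  by apply: cvgM; exact: cvg_ray_cutoff.
- apply/integrableP; split => //.
  by rewrite integral_cst//= normr1 mul1e.
move=> k z _; rewrite lee_fin ger0_norm.
  have /andP[? ?] := ray_cutoff01 a k z.1.
  have /andP[? ?] := ray_cutoff01 b k z.2.
  by rewrite mulr_ile1.
by rewrite mulr_ge0//; [case/andP: (ray_cutoff01 a k z.1)|case/andP: (ray_cutoff01 b k z.2)].
Qed.

End digits_law.

Section quadrants.
Context {R : realType}.
Notation M := (measurableTypeR R).
Variable m : {measure set (M * M) -> \bar R}.

Lemma slice_fst (B : set M) : measurable B ->
  exists n : {measure set M -> \bar R}, forall A, n A = m (A `*` B).
Proof.
move=> mB.
have mTB : measurable (setT `*` B : set (M * M)) by exact: measurableX.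
exists (measure_function_pushforward__canonical__measure_function_Measure
  (mrestr m mTB) measurable_fst) => A.
by rewrite -[LHS]/(m (fst @^-1` A `&` (setT `*` B))); congr (m _);
  apply/seteqP; split => z [] //= ? [].
Qed.

Lemma slice_snd (A : set M) : measurable A ->
  exists n : {measure set M -> \bar R}, forall B, n B = m (A `*` B).
Proof.
move=> mA.
have mAT : measurable (A `*` setT : set (M * M)) by exact: measurableX.
exists (measure_function_pushforward__canonical__measure_function_Measure
  (mrestr m mAT) measurable_snd) => B.
by rewrite -[LHS]/(m (snd @^-1` B `&` (A `*` setT))); congr (m _);
  apply/seteqP; split => z [] //= ? [].
Qed.

End quadrants.

(** [measure_eq_rays] is applied in one coordinate at a time, the other side of the rectangle being
    frozen. *)
Lemma measure_eq_quadrants {R : realType}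
    (m1 m2 : {measure set (measurableTypeR R * measurableTypeR R) -> \bar R}) :
  (m1 setT < +oo)%E -> (m2 setT < +oo)%E ->
  (forall a b : R, m1 (`]-oo, a]%classic `*` `]-oo, b]%classic) =
                   m2 (`]-oo, a]%classic `*` `]-oo, b]%classic)) ->
  forall A B, measurable A -> measurable B -> m1 (A `*` B) = m2 (A `*` B).
Proof.
move=> m1oo m2oo m12 A B mA mB.
have fin (m : {measure set (measurableTypeR R * measurableTypeR R) -> \bar R}) C :
    (m setT < +oo)%E -> measurable C -> (m C < +oo)%E.
  by move=> moo mC; apply: le_lt_trans moo; rewrite le_measure ?inE.
have [n1 n1E] := slice_snd m1 mA; have [n2 n2E] := slice_snd m2 mA.
rewrite -n1E -n2E; apply: measure_eq_rays => //.
- by rewrite n1E fin//; exact: measurableX.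
- by rewrite n2E fin//; exact: measurableX.
move=> b; rewrite n1E n2E.
have mb : measurable (`]-oo, b]%classic : set (measurableTypeR R)).
  exact: measurable_itv.
have [k1 k1E] := slice_fst m1 mb; have [k2 k2E] := slice_fst m2 mb.
rewrite -k1E -k2E; apply: measure_eq_rays => //.
- by rewrite k1E fin//; exact: measurableX.
- by rewrite k2E fin//; exact: measurableX.
by move=> a; rewrite k1E k2E.
Qed.

Section digits_law.
Context {R : realType}.
Notation M := (measurableTypeR R).
Local Notation unif := (@unif R).

Definition digits_pair (w : M) : M * M := (even_digits w, even_digits (bin_shift w)).

Lemma measurable_digits_pair : measurable_fun setT digits_pair.
Proof.
apply: measurable_fun_pair; first exact: measurable_even_digits.
exact: (measurableT_comp measurable_even_digits measurable_bin_shift).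
Qed.

Let m1 : {measure set (M * M) -> \bar R} :=
  measure_function_pushforward__canonical__measure_function_Measure
    unif measurable_digits_pair.

(** Products of cutoffs have equal integrals under both laws and converge to indicators of
    quadrants; quadrants determine the mass of rectangles, and rectangles determine the product
    measure. *)
Lemma digits_pair_law (X : set (M * M)) : measurable X ->
  (unif \x unif)%E X = unif (digits_pair @^-1` X).
Proof.
apply: (@product_measure_unique _ _ M M R unif unif m1) => A B mA mB.
rewrite -product_measure1E//; apply: measure_eq_quadrants => //.
- exact: (probability_setT_lty unif).
- exact: probability_setT_lty.
move=> a b.
have h k : (\int[m1]_z (ray_cutoff a k z.1 * ray_cutoff b k z.2)%:E =
   \int[(unif \x unif)%E]_z (ray_cutoff a k z.1 * ray_cutoff b k z.2)%:E)%E.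
  pose f (x y : M) := ray_cutoff a k x * ray_cutoff b k y.
  have f0 x y : 0 <= f x y.
    by rewrite mulr_ge0//; [case/andP: (ray_cutoff01 a k x)|case/andP: (ray_cutoff01 b k y)].
  have mf : measurable2 (fun x y => (f x y)%:E).
    apply/measurable_EFinP; apply: measurable_funM.
      exact: (measurableT_comp (measurable_ray_cutoff a k) measurable_fst).
    exact: (measurableT_comp (measurable_ray_cutoff b k) measurable_snd).
  rewrite (@ge0_integral_prod _ _ M M R unif unif (fun x y => (f x y)%:E))//.
  (* The product is still k-Lipschitz because both factors lie between 0 and 1. *)
  rewrite -[RHS](@digits_integral_lipschitz R k%:R f)//; last first.
    move=> x y x' y'; rewrite /f.
    have /andP[] := ray_cutoff01 a k x; have /andP[] := ray_cutoff01 a k x'.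
    have /andP[] := ray_cutoff01 b k y; have /andP[] := ray_cutoff01 b k y'.
    have := ray_cutoff_lip a k x x'; have := ray_cutoff_lip b k y y'.
    rewrite mulrDr.
    move: (ray_cutoff a k x) (ray_cutoff a k x') (ray_cutoff b k y) (ray_cutoff b k y').
    have : 0 <= k%:R * `|x - x'| by rewrite mulr_ge0.
    have : 0 <= k%:R * `|y - y'| by rewrite mulr_ge0.
    move: (k%:R * `|x - x'|) (k%:R * `|y - y'|) => p q q0 p0 u u' v v' hv hu.
    move=> v'0 v'1 v0 v1 u'0 u'1 u0 u1.
    apply: (@le_trans _ _ ((u' + p) * v)); first by rewrite ler_wpM2r.
    apply: (@le_trans _ _ (u' * (v' + q) + p)).
      by rewrite mulrDl lerD ?ler_wpM2l// ler_piMr.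
    by rewrite mulrDr -addrA lerD2l addrC lerD2l ler_piMl.
  rewrite (@ge0_integral_pushforward _ _ _ _ _ _ measurable_digits_pair unif setT)//.
  by move=> z _; rewrite lee_fin; exact: f0.
have c1 := @cvg_quadrant_cutoff R m1 a b (probability_setT_lty unif).
have c2 := @cvg_quadrant_cutoff R (unif \x unif)%E a b (probability_setT_lty _).
apply: (cvg_unique (@ereal_hausdorff R) c1); apply: cvg_trans c2.
by apply: near_eq_cvg; apply: nearW => k; rewrite h.
Qed.

Lemma integral_digits_pair (F : M -> M -> \bar R) :
  measurable2 F -> (forall x y, 0 <= F x y)%E ->
  (\int[unif]_w F (even_digits w) (even_digits (bin_shift w)) =
   \int[unif]_x \int[unif]_y F x y)%E.
Proof.
move=> mF F0; rewrite -(ge0_integral_prod unif unif mF F0).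
rewrite (@ge0_integral_weighted_image _ _ _ _ _ unif (unif \x unif)%E digits_pair (fun=> 1) _ _ _ _ (fun z => F z.1 z.2))//.
- by apply: eq_integral => w _; rewrite mul1e.
- exact: measurable_digits_pair.
move=> A mA; etransitivity; first exact: (digits_pair_law mA).
under eq_integral do rewrite mul1e.
rewrite -[in LHS](setIT (digits_pair @^-1` A)) -integral_indic//.
by rewrite -[X in measurable X]setTI; exact: measurable_digits_pair.
Qed.

End digits_law.

(** * Splitting one noise variable into two independent copies *)

Section gaussian_splitting.
Context {R : realType}.
Notation M := (measurableTypeR R).
Local Notation unif := (@unif R).
Local Notation gauss := (@gauss R).

Definition noise : probability (M * M)%type R := (gauss \x unif)%E.

Let z (w : M) : R := quantile gauss (even_digits w).
Let w1 (w : M) : M := even_digits (bin_shift w).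

(* One uniform variable [e.2] yields a normal variable and two further uniform
   ones; midpoint displacement by that normal variable splits [e.1]. *)
Definition split_l (e : M * M) : M * M :=
  ((e.1 + z e.2) / Num.sqrt 2, even_digits (w1 e.2)).
Definition split_r (e : M * M) : M * M :=
  ((e.1 - z e.2) / Num.sqrt 2, even_digits (bin_shift (w1 e.2))).

Let mz : measurable_fun setT z.
Proof. exact: (measurableT_comp (measurable_quantile gauss) measurable_even_digits). Qed.

Let mw1 : measurable_fun setT w1.
Proof. exact: (measurableT_comp measurable_even_digits measurable_bin_shift). Qed.

Lemma measurable_split_l : measurable_fun setT split_l.
Proof.
apply: measurable_fun_pair.
  apply: measurable_funM => //; apply: measurable_funD => //.
  exact: (measurableT_comp mz).
apply: (measurableT_comp measurable_even_digits).
exact: (measurableT_comp mw1 measurable_snd).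
Qed.

Lemma measurable_split_r : measurable_fun setT split_r.
Proof.
apply: measurable_fun_pair.
  apply: measurable_funM => //; apply: measurable_funB => //.
  exact: (measurableT_comp mz).
apply: (measurableT_comp measurable_even_digits).
apply: (measurableT_comp measurable_bin_shift).
exact: (measurableT_comp mw1 measurable_snd).
Qed.

Lemma split_sum e : e.1 = ((split_l e).1 + (split_r e).1) / Num.sqrt 2.
Proof.
rewrite /split_l /split_r /=.
have s2 : Num.sqrt 2 * Num.sqrt 2 = 2 :> R by rewrite -expr2 sqr_sqrtr.
have s0 : Num.sqrt 2 != 0 :> R by rewrite gt_eqF// sqrtr_gt0.
rewrite -mulrDl addrACA subrr addr0 -mulrA -invfM s2.
by field.
Qed.

Lemma integral_quantile (f : M -> \bar R) : measurable_fun setT f ->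
  (forall x, 0 <= f x)%E -> (\int[unif]_u f (quantile gauss u) = \int[gauss]_x f x)%E.
Proof.
move=> mf f0.
rewrite [RHS](@ge0_integral_weighted_image _ _ _ _ _ unif gauss (quantile gauss) (fun=> 1) _ _ _ _ f)//.
- by apply: eq_integral => u _; rewrite mul1e.
- exact: measurable_quantile.
move=> A mA; etransitivity; first exact: (quantile_law gauss mA).
under eq_integral do rewrite mul1e.
rewrite -[in LHS](setIT (quantile gauss @^-1` A)) -integral_indic//.
by rewrite -[X in measurable X]setTI; exact: measurable_quantile.
Qed.

Lemma integral_noise (F : M * M -> \bar R) : measurable_fun setT F ->
  (forall e, 0 <= F e)%E ->
  (\int[noise]_e F e = \int[gauss]_x \int[unif]_w F (x, w))%E.
Proof.
move=> mF F0.
rewrite -(@ge0_integral_prod _ _ M M R gauss unif (fun x w => F (x, w)))//.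
  by apply: eq_integral => -[].
by apply: (eq_measurable_fun F) => // -[].
Qed.

(** The digits of [e.2] provide three independent variables: a normal z and two uniform ones. The
    pair (e.1 + z) / sqrt 2, (e.1 - z) / sqrt 2 arises from e.1 and z by a rotation of angle pi/4,
    hence is again a pair of independent standard normals. *)
Lemma noise_split (F : M * M -> M * M -> \bar R) :
  measurable_fun setT (fun p : (M * M) * (M * M) => F p.1 p.2) ->
  (forall e e', 0 <= F e e')%E ->
  (\int[noise]_e F (split_l e) (split_r e) = \int[noise]_e \int[noise]_e' F e e')%E.
Proof.
move=> mF F0.
have mFc d (T : measurableType d) (f1 f2 f3 f4 : T -> M) :
    measurable_fun setT f1 -> measurable_fun setT f2 ->
    measurable_fun setT f3 -> measurable_fun setT f4 ->
    measurable_fun setT (fun t => F (f1 t, f2 t) (f3 t, f4 t)).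
  move=> m1 m2 m3 m4; apply: (measurableT_comp mF (_ : measurable_fun setT
     (fun t => ((f1 t, f2 t), (f3 t, f4 t))))).
  by apply: measurable_fun_pair; exact: measurable_fun_pair.
have s0 : 0 < (Num.sqrt 2)^-1 :> R by rewrite invr_gt0 sqrtr_gt0.
set c := (Num.sqrt 2)^-1 in s0 *.
have cc : c ^+ 2 + c ^+ 2 = 1 by rewrite exprVn sqr_sqrtr//; field.
have mq : measurable_fun setT (quantile gauss) by exact: measurable_quantile.
have med : measurable_fun setT (@even_digits R) by exact: measurable_even_digits.
have meds : measurable_fun setT (fun w => @even_digits R (bin_shift w)).
  exact: (measurableT_comp med measurable_bin_shift).
(* With the two new uniform variables integrated out, only a function of two normal variables
   remains to be rotated. *)
pose Phi (x y : M) : \bar R := (\int[unif]_u \int[unif]_v F (x, u) (y, v))%E.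
have Phi0 x y : (0 <= Phi x y)%E.
  by apply: integral_ge0 => u _; apply: integral_ge0.
have mPhi : measurable2 Phi.
  apply: (@measurable_integral_r _ _ (M * M)%type M R unif (fun p u =>
    \int[unif]_v F (p.1, u) (p.2, v))%E); last by move=> *; exact: integral_ge0.
  apply: (@measurable_integral_r _ _ ((M * M) * M)%type M R unif (fun q v =>
    F (q.1.1, q.2) (q.1.2, v))%E) => //.
  apply: mFc.
  + exact: (measurableT_comp measurable_fst (measurableT_comp measurable_fst measurable_fst)).
  + exact: (measurableT_comp measurable_snd measurable_fst).
  + exact: (measurableT_comp measurable_snd (measurableT_comp measurable_fst measurable_fst)).
  + exact: measurable_snd.
rewrite integral_noise; last 2 first.
- have := measurableT_comp mF (measurable_fun_pair measurable_split_l measurable_split_r).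
  exact.
- by move=> e; exact: F0.
transitivity (\int[gauss]_s \int[gauss]_x Phi (c * x + c * s)%R (c * s - c * x)%R)%E.
  apply: eq_integral => s _.
  rewrite -integral_quantile//; last first.
    by apply: (measurable2_comp mPhi);
      [apply: measurable_funD|apply: measurable_funB] => //; exact: measurable_funM.
  pose G (x y : M) := F ((s + quantile gauss x) * c, even_digits y)
                        ((s - quantile gauss x) * c, even_digits (bin_shift y)).
  have mG : measurable2 G.
    apply: mFc.
    + apply: measurable_funM => //; apply: measurable_funD => //.
      exact: (measurableT_comp mq).
    + exact: (measurableT_comp med).
    + apply: measurable_funM => //; apply: measurable_funB => //.
      exact: (measurableT_comp mq).
    + exact: (measurableT_comp meds).
  rewrite -[LHS]/(\int[unif]_w G (even_digits w) (even_digits (bin_shift w)))%E.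
  rewrite (integral_digits_pair mG (fun _ _ => F0 _ _)).
  apply: eq_integral => x _.
  rewrite (@integral_digits_pair R (fun u v => F ((s + quantile gauss x) * c, u)
                        ((s - quantile gauss x) * c, v)) _ (fun _ _ => F0 _ _)); last exact: mFc.
  by rewrite /Phi -mulrDr -mulrBr (addrC (quantile _ _)) !(mulrC c).
rewrite (@ge0_integral_swap _ _ _ _ _ gauss gauss
  (fun s x => Phi (c * x + c * s)%R (c * s - c * x)%R) _ (fun _ _ => Phi0 _ _)); last first.
  apply: (measurable2_comp mPhi); [apply: measurable_funD|apply: measurable_funB];
    exact: measurable_funM.
rewrite (gauss_rotation s0 cc mPhi Phi0).
have mne : measurable_fun setT (fun e : M * M => \int[noise]_e' F e e')%E.
  exact: (@measurable_integral_r _ _ _ _ R noise F mF F0).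
rewrite (integral_noise mne); last by move=> e; exact: integral_ge0.
apply: eq_integral => x _.
rewrite /Phi ge0_integral_swap; last 2 first.
- apply: (@measurable_integral_r _ _ (M * M)%type M R unif (fun p v =>
    F (x, p.2) (p.1, v))%E) => //.
  apply: mFc => //.
  + exact: (measurableT_comp measurable_snd measurable_fst).
  + exact: (measurableT_comp measurable_fst measurable_fst).
- by move=> *; exact: integral_ge0.
apply: eq_integral => u _; rewrite integral_noise//.
by apply: (measurable_fun_pair2 (x, u) mF).
Qed.

Lemma integral_noise_fst (f : M -> \bar R) : measurable_fun setT f ->
  (forall x, 0 <= f x)%E -> (\int[noise]_e f e.1 = \int[gauss]_x f x)%E.
Proof.
move=> mf f0; rewrite integral_noise//; last exact: (measurableT_comp mf).
by apply: eq_integral => x _; exact: (integral_probability_cst unif (f x)).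
Qed.

End gaussian_splitting.

(** * Brownian paths *)

Section leaves.
Context {R : realType}.
Notation M := (measurableTypeR R).
Local Notation gauss := (@gauss R).
Local Notation noise := (@noise R).
Local Notation s := ((Num.sqrt 2)^-1 : R).

(* The increments, rescaled to unit variance, of a Brownian path over the
   dyadic intervals of length 2^-n. *)
Fixpoint leaves n (e : M * M) : seq R :=
  if n is k.+1 then leaves k (split_l e) ++ leaves k (split_r e) else [:: e.1 : R].

Lemma size_leaves n e : size (leaves n e) = (2 ^ n)%N.
Proof.
by elim: n e => [|n IH] e //=; rewrite size_cat !IH addnn -mul2n expnS.
Qed.

Lemma measurable_nth_leaves n i : measurable_fun setT (fun e => nth 0 (leaves n e) i).
Proof.
elim: n i => [|n IH] i /=.
  case: i => [|i]; first exact: measurable_fst.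
  by under eq_fun do rewrite /= nth_nil; exact: measurable_cst.
under eq_fun do rewrite nth_cat size_leaves.
case: ltnP => _.
  exact: (measurableT_comp (IH i) measurable_split_l).
exact: (measurableT_comp (IH (i - 2 ^ n)%N) measurable_split_r).
Qed.

Lemma list_measurable_cat2 k n (F : seq R -> \bar R) : list_measurable (k + n) F ->
  measurable_fun setT (fun p : k.-tuple R * n.-tuple R => F (p.1 ++ p.2)).
Proof.
move=> mF; apply: (measurable_list_comp mF).
  by move=> p; rewrite size_cat !size_tuple.
move=> i _; under eq_fun do rewrite nth_cat size_tuple.
case: ltnP => _.
  apply: (@measurableT_comp _ _ _ _ _ _ (fun t : k.-tuple R => nth 0 t i) _ fst).
    exact: measurable_tuple_nth.
  exact: measurable_fst.
apply: (@measurableT_comp _ _ _ _ _ _ (fun t : n.-tuple R => nth 0 t (i - k)) _ snd).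
  exact: measurable_tuple_nth.
exact: measurable_snd.
Qed.

(** By [noise_split] the two subtrees below a node are independent copies of the whole tree of depth
    one less. *)
Lemma leaves_law n (F : seq R -> \bar R) : list_measurable (2 ^ n) F ->
  (forall l, 0 <= F l)%E ->
  (\int[noise]_e F (leaves n e) = itint gauss (2 ^ n) F)%E.
Proof.
elim: n F => [|n IH] F mF F0.
  rewrite (@integral_noise_fst R (fun x => F [:: x]))//.
  have := list_measurable_cons2 mF; rewrite /list_measurable2 => mF2.
  have mc : measurable_fun setT (fun x : M => (x, [tuple]) : M * 0.-tuple R).
    by apply: measurable_fun_pair.
  exact: (measurableT_comp mF2 mc).
have e2 : (2 ^ n.+1 = 2 ^ n + 2 ^ n)%N by rewrite expnS mul2n addnn.
rewrite e2 in mF *; rewrite itint_cat.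
have mF2 := list_measurable_cat2 mF.
pose tl (e : M * M) : (2 ^ n).-tuple R := Tuple (introT eqP (size_leaves n e)).
have mtl : measurable_fun setT tl.
  apply/measurable_fun_tnthP => i.
  have := measurable_nth_leaves n i; apply: eq_measurable_fun => e _ /=.
  by rewrite (tnth_nth 0).
rewrite (@noise_split R (fun e e' => F (leaves n e ++ leaves n e')))//; last first.
  apply: (measurableT_comp mF2 (_ : measurable_fun setT
     (fun p : (M * M) * (M * M) => (tl p.1, tl p.2)))).
  by apply: measurable_fun_pair; [exact: (measurableT_comp mtl measurable_fst)|
    exact: (measurableT_comp mtl measurable_snd)].
rewrite -IH; last 2 first.
- exact: (@measurable_itint _ _ _ _ _ (fun (t : (2 ^ n).-tuple R) l2 => F (t ++ l2))).
- by move=> l; exact: itint_ge0.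
apply: eq_integral => e _; rewrite -IH//.
exact: (measurable_fun_pair2 (tl e) mF2).
Qed.

Lemma integral_split_l (f : M * M -> \bar R) : measurable_fun setT f ->
  (forall e, 0 <= f e)%E -> (\int[noise]_e f (split_l e) = \int[noise]_e f e)%E.
Proof.
move=> mf f0; rewrite (@noise_split R (fun e _ => f e))//.
  by apply: eq_integral => e _; exact: (integral_probability_cst noise (f e)).
exact: (measurableT_comp mf).
Qed.

Lemma integral_split_r (f : M * M -> \bar R) : measurable_fun setT f ->
  (forall e, 0 <= f e)%E -> (\int[noise]_e f (split_r e) = \int[noise]_e f e)%E.
Proof.
move=> mf f0; rewrite (@noise_split R (fun _ e => f e))//.
  exact: (integral_probability_cst noise).
exact: (measurableT_comp mf measurable_snd).
Qed.

Fixpoint pair_sums (l : seq R) : seq R :=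
  if l is a :: b :: l' then (a + b) * s :: pair_sums l' else [::].

Lemma pair_sums_cat l1 l2 : ~~ odd (size l1) ->
  pair_sums (l1 ++ l2) = pair_sums l1 ++ pair_sums l2.
Proof.
have [n] := ubnP (size l1); elim: n l1 => // n IH [|a [|b l]] //= ln.
by rewrite negbK => ol; rewrite IH//; exact: ltnW.
Qed.

(** [split_sum] at every node. This is why a refinement leaves the path unchanged at the coarser
    dyadic times. *)
Lemma leaves_pair_sums n e : leaves n e = pair_sums (leaves n.+1 e).
Proof.
elim: n e => [|n IH] e; first by rewrite /= [in LHS](split_sum e).
rewrite [LHS]/= [leaves n.+2 e]/= -/(leaves n.+1 (split_l e)) -/(leaves n.+1 (split_r e)).
by rewrite pair_sums_cat -?IH// size_leaves expnS mul2n odd_double.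
Qed.

Lemma sum_take_pair_sums k l : ~~ odd (size l) ->
  \sum_(y <- take k (pair_sums l)) y = s * \sum_(y <- take k.*2 l) y.
Proof.
elim: k l => [|k IH] [|a [|b l]] //=; rewrite ?take0 ?big_nil ?mulr0//.
by rewrite negbK => ol; rewrite !big_cons IH//; ring.
Qed.

Lemma sum_takeS k (l : seq R) :
  \sum_(y <- take k.+1 l) y = \sum_(y <- take k l) y + nth 0 l k.
Proof.
have [kl|lk] := ltnP k (size l).
  by rewrite (take_nth 0 kl) -cats1 big_cat /= big_seq1.
by rewrite nth_default// addr0 !take_oversize// ltnW.
Qed.

End leaves.

Lemma geometric_cauchy {R : realType} (C q : R) (u : nat -> R) : 0 < q < 1 ->
  0 <= C -> (forall n, `|u n.+1 - u n| <= C * q ^+ n) ->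
  cvgn u /\ forall n, `|limn u - u n| <= C / (1 - q) * q ^+ n.
Proof.
move=> /andP[q0 q1] C0 du.
have q1' : 0 < 1 - q by rewrite subr_gt0.
have cu : cvgn u.
  have cs : cvgn (series (fun n => u n.+1 - u n)).
    apply: normed_cvg; apply: (series_le_cvg _ _ du) => //=.
    - by move=> n; rewrite mulr_ge0// exprn_ge0// ltW.
    - by apply: is_cvg_geometric_series; rewrite ger0_norm// ltW.
  have -> : u = (fun n => u 0%N + series (fun n => u n.+1 - u n) n).
    apply/funext => n; rewrite /series /= telescope_sumr//.
    by rewrite addrC subrK.
  by apply: is_cvgD => //; exact: is_cvg_cst.
split => // n.
(* The factor 1 - q^k makes the induction on k close with equality; it is dropped afterwards. *)
have step k : `|u (n + k)%N - u n| <= C / (1 - q) * q ^+ n * (1 - q ^+ k).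
  elim: k => [|k IH]; first by rewrite addn0 subrr normr0 expr0 subrr mulr0.
  rewrite addnS -[X in `|X|](subrKA (u (n + k)%N)).
  apply: (le_trans (ler_normD _ _)).
  apply: (le_trans (lerD (du _) IH)).
  rewrite le_eqVlt; apply/orP; left; apply/eqP.
  rewrite exprS exprD; move: (q ^+ n) (q ^+ k) => a b; field.
  by rewrite gt_eqF.
have lim1 : `|u (n + k)%N - u n| @[k --> \oo] --> `|limn u - u n|.
  apply: cvg_norm; apply: cvgB; last exact: cvg_cst.
  have h : [sequence u (k + n)%N]_k @ \oo --> limn u by rewrite cvg_shiftn.
  by apply: cvg_trans h; apply: near_eq_cvg; apply: nearW => k; rewrite /= addnC.
apply: (cvgr_to_le lim1); apply: nearW => k.
apply: (le_trans (step k)); rewrite ler_piMr//.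
  by rewrite mulr_ge0 ?exprn_ge0 ?divr_ge0// ltW.
by rewrite lerBlDr lerDl exprn_ge0// ltW.
Qed.

(** Used with x = 2^n t: at the next dyadic level the sum up to time t gains at most one leaf. *)
Lemma truncn_double {R : realType} (x : R) : 0 <= x ->
  Num.truncn (2 * x) = (Num.truncn x).*2 \/ Num.truncn (2 * x) = (Num.truncn x).*2.+1.
Proof.
move=> x0; have /andP[kx xk] := truncn_itv x0; set k := Num.truncn x in kx xk *.
have k1 : k.+1%:R = k%:R + 1 :> R by rewrite natr1.
have k2 : k.*2%:R = 2 * k%:R :> R by rewrite -mul2n natrM.
have k3 : k.*2.+1%:R = 2 * k%:R + 1 :> R by rewrite -natr1 k2.
have k4 : k.*2.+2%:R = 2 * k%:R + 2 :> R by rewrite -natr1 k3 -addrA.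
have [h|h] := ltP (2 * x) (k.*2.+1%:R).
  by left; apply: truncn_def; rewrite h andbT k2; lra.
by right; apply: truncn_def; rewrite h k4; lra.
Qed.

(** * Fourth moments and continuity of the paths *)

Section gaussian_moment.
Context {R : realType}.

(** With y = x^2 / 8, the inequality y <= exp y gives x^4 exp(- x^2 / 2) <= 64 exp(- x^2 / 4), which
    is integrable. *)
Lemma gauss_moment4 : exists2 c : R, 0 <= c &
  (\int[@gauss R]_x (x ^+ 4)%:E = c%:E)%E.
Proof.
suff h : (\int[@gauss R]_x (x ^+ 4)%:E < +oo)%E.
  have i0 : (0 <= \int[@gauss R]_x (x ^+ 4)%:E)%E.
    by apply: integral_ge0 => x _; rewrite lee_fin exprn_even_ge0.
  exists (fine (\int[@gauss R]_x (x ^+ 4)%:E)%E); first exact: fine_ge0.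
  by rewrite fineK// ge0_fin_numE.
have mx4 : measurable_fun [set: measurableTypeR R] (fun x => (x ^+ 4)%:E).
  by apply/measurable_EFinP; exact: measurable_funX.
rewrite ge0_integral_gauss//; last by move=> x; rewrite lee_fin exprn_even_ge0.
have b0 : 0 < 4^-1 :> R by [].
have [c c0 cE] := integral_expR_sqr b0.
have p0 : 0 < normal_peak (1 : R) by rewrite normal_peak_gt0// oner_neq0.
have me : measurable_fun [set: measurableTypeR R]
    (fun x => (expR (- (4^-1 * x ^+ 2)))%:E).
  apply/measurable_EFinP/measurableT_comp => //; apply: measurableT_comp => //.
  by apply: measurable_funM => //; exact: measurable_funX.
apply: (@le_lt_trans _ _ (\int[@lebesgue_measure R]_x
    ((64 * normal_peak 1)%:E * (expR (- (4^-1 * x ^+ 2)))%:E))%E); last first.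
  rewrite ge0_integralZl//; last by rewrite lee_fin mulr_ge0// ltW.
  by rewrite cE -EFinM ltry.
apply: ge0_le_integral => //.
- by move=> x _; rewrite -EFinM lee_fin mulr_ge0 ?exprn_even_ge0// ltW// gauss_pdf_gt0.
- by apply: emeasurable_funM => //; apply/measurable_EFinP; exact: measurable_gauss_pdf.
- exact: measurable_funeM.
move=> x _; rewrite -!EFinM lee_fin /gauss_pdf.
rewrite -[leLHS]mulrA -[leRHS]mulrA [leRHS]mulrCA ler_pM2l//.
set y := x ^+ 2 / 8.
have y0 : 0 <= y by rewrite divr_ge0// sqr_ge0.
have -> : x ^+ 2 / 2 = 4 * y by rewrite /y; field.
have -> : 4^-1 * x ^+ 2 = 2 * y by rewrite /y; field.
have -> : x ^+ 4 = 64 * y ^+ 2 by rewrite /y; field.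
have -> : expR (- (2 * y)) = expR (- (4 * y)) * expR y ^+ 2.
  by rewrite expr2 -!expRD; congr expR; ring.
rewrite mulrCA ler_wpM2l// ler_wpM2l ?expR_ge0//.
rewrite lerXn2r ?nnegrE ?expR_ge0//.
by apply: le_trans (expR_ge1Dx y); rewrite lerDr.
Qed.

End gaussian_moment.

Section brownian.
Context {R : realType}.
Notation M := (measurableTypeR R).
Local Notation noise := (@noise R).
Local Notation s := ((Num.sqrt 2)^-1 : R).
Local Notation q := (9 / 10 : R).
Local Notation r := ((4 * q ^+ 4)^-1 : R).
Implicit Types (e : M * M) (t : R).

(** A step function of t, not a linear interpolation. Negative times give 0 and times beyond 1 the
    value at 1, so that t ranges over the whole line. *)
Definition level n e t : R :=
  s ^+ n * \sum_(y <- take (Num.truncn (2 ^+ n * t)) (leaves n e)) y.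

Definition energy n e : R := \sum_(y <- leaves n e) y ^+ 4.

(** Since r = (s/q)^4, this is the sum over all n and j of (s^n x / q^n)^4, x being leaf j of level
    n. Its expectation is a geometric series of ratio 2 r, and 2 r < 1 for q = 9/10. *)
Definition total_energy e : \bar R :=
  (\sum_(0 <= n <oo) (r ^+ n * energy n e)%:E)%E.

Definition good : set (M * M) := [set e | (total_energy e < +oo)%E].

Let q0 : 0 < q. Proof. lra. Qed.
Let q1 : q < 1. Proof. lra. Qed.
Let s0 : 0 < s. Proof. by rewrite invr_gt0 sqrtr_gt0. Qed.
Let s2 : s ^+ 2 = 2^-1. Proof. by rewrite exprVn sqr_sqrtr. Qed.
Let r0 : 0 < r. Proof. by rewrite invr_gt0 mulr_gt0// exprn_gt0. Qed.

Lemma energy_ge0 n e : 0 <= energy n e.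
Proof. by apply: sumr_ge0 => y _; rewrite exprn_even_ge0. Qed.

Lemma measurable_energy n : measurable_fun setT (energy n).
Proof.
elim: n => [|n IH].
  rewrite /energy /=; under eq_fun do rewrite big_seq1.
  by apply: measurable_funX; exact: measurable_fst.
rewrite /energy /=; under eq_fun do rewrite big_cat /=.
apply: measurable_funD.
  exact: (measurableT_comp IH measurable_split_l).
exact: (measurableT_comp IH measurable_split_r).
Qed.

Lemma integral_energy : exists2 c : R, 0 <= c &
  forall n, (\int[noise]_e (energy n e)%:E = (2 ^+ n * c)%:E)%E.
Proof.
have [c c0 cE] := @gauss_moment4 R; exists c => //.
have mE n : measurable_fun setT (fun e => (energy n e)%:E).
  by apply/measurable_EFinP; exact: measurable_energy.
elim=> [|n IH].
  rewrite mul1r -cE -(@integral_noise_fst R (fun x => (x ^+ 4)%:E)).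
  - by apply: eq_integral => e _; rewrite /energy big_seq1.
  - by apply/measurable_EFinP; exact: measurable_funX.
  - by move=> x; rewrite lee_fin exprn_even_ge0.
transitivity (\int[noise]_e ((energy n (split_l e))%:E + (energy n (split_r e))%:E))%E.
  by apply: eq_integral => e _; rewrite -EFinD /energy /= big_cat.
have e0 (f : M * M -> M * M) e : (0 <= (energy n (f e))%:E)%E.
  by rewrite lee_fin energy_ge0.
rewrite ge0_integralD//; last 2 first.
- exact: (measurableT_comp (mE n) measurable_split_l).
- exact: (measurableT_comp (mE n) measurable_split_r).
rewrite (@integral_split_l R (fun e => (energy n e)%:E))//; last by move=> e; exact: (e0 id).
rewrite (@integral_split_r R (fun e => (energy n e)%:E))//; last by move=> e; exact: (e0 id).
by rewrite IH -EFinD exprS; congr EFin; ring.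
Qed.

Lemma measurable_total_energy : measurable_fun setT total_energy.
Proof.
apply: ge0_emeasurable_sum.
- by move=> n e _ _; rewrite lee_fin mulr_ge0 ?energy_ge0// exprn_ge0// ltW.
move=> n _; apply/measurable_EFinP; apply: measurable_funM => //.
exact: measurable_energy.
Qed.

Lemma measurable_good : measurable good.
Proof.
rewrite /good -[X in measurable X]setTI.
by apply: emeasurable_fun_infty_o => //; exact: measurable_total_energy.
Qed.

Lemma integral_total_energy : (\int[noise]_e total_energy e < +oo)%E.
Proof.
have [c c0 cE] := integral_energy.
rewrite integral_nneseries//; last 2 first.
- move=> n; apply/measurable_EFinP; apply: measurable_funM => //.
  exact: measurable_energy.
- by move=> n e _; rewrite lee_fin mulr_ge0 ?energy_ge0// exprn_ge0// ltW.
have r20 : 0 < r * 2 by rewrite mulr_gt0.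
have r21 : r * 2 < 1.
  rewrite mulrC ltr_pdivrMr; last by rewrite mulr_gt0// exprn_gt0.
  by rewrite mul1r; lra.
have tE n : (\int[noise]_e (r ^+ n * energy n e)%:E = (c * (r * 2) ^+ n)%:E)%E.
  under eq_integral do rewrite EFinM.
  rewrite ge0_integralZl//; last 2 first.
  - by apply/measurable_EFinP; exact: measurable_energy.
  - by move=> e _; rewrite lee_fin energy_ge0.
  by rewrite cE -EFinM [(r * 2) ^+ n]exprMn [in RHS]mulrC mulrA.
under eq_eseriesr do rewrite tE.
apply: (@le_lt_trans _ _ (c * (1 - r * 2)^-1)%:E); last by rewrite ltry.
apply: lime_le.
  apply: is_cvg_nneseries => n _ _.
  by rewrite lee_fin mulr_ge0// exprn_ge0// ltW.
apply: nearW => n; rewrite sumEFin lee_fin.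
by apply: (geometric_le_lim n c0 r20); rewrite ger0_norm// ltW.
Qed.

Lemma good_ae : noise (~` good) = 0%E.
Proof.
apply/eqP; rewrite eq_le measure_ge0 andbT leNgt; apply/negP => h.
have mC : measurable (~` good) by apply: measurableC; exact: measurable_good.
have : (\int[noise]_(e in ~` good) total_energy e <= \int[noise]_e total_energy e)%E.
  apply: ge0_subset_integral => //; first exact: measurable_total_energy.
  move=> e _; apply: nneseries_ge0 => n _ _.
  by rewrite lee_fin mulr_ge0 ?energy_ge0// exprn_ge0// ltW.
apply/negP; rewrite -ltNge; apply: (lt_le_trans integral_total_energy).
rewrite (@eq_integral _ _ _ noise _ (cst +oo%E)); last first.
  move=> e; rewrite inE /good/= => /negP; rewrite -leNgt leye_eq => /eqP.
  by move=> ->.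
by rewrite integral_cst// gt0_mulye.
Qed.

(** Every single term of a finite sum of nonnegative terms is at most the sum, here [y], so the
    ratio of an increment to q^n has fourth power at most [y]. *)
Lemma good_bound e : good e -> exists2 C : R, 0 <= C &
  forall n j, `|s ^+ n * nth 0 (leaves n e) j| <= C * q ^+ n.
Proof.
move=> ge.
have term0 n : (0 <= (r ^+ n * energy n e)%:E)%E.
  by rewrite lee_fin mulr_ge0 ?energy_ge0// exprn_ge0// ltW.
have y0 : (0 <= total_energy e)%E by apply: nneseries_ge0.
pose y := fine (total_energy e).
have yE : total_energy e = y%:E by rewrite fineK// ge0_fin_numE.
have yge0 : 0 <= y by rewrite fine_ge0.
have bound n : r ^+ n * energy n e <= y.
  rewrite -lee_fin -yE.
  apply: (le_trans _ (nneseries_lim_ge n.+1 (fun k _ _ => term0 k))).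
  by rewrite big_nat_recr//= leeDr// sume_ge0.
(* A nonnegative v with v^4 <= y is at most 1 or at most y, hence at most 1 + y. *)
exists (1 + y); first by rewrite addr_ge0.
move=> n j; have [jn|nj] := ltnP j (size (leaves n e)); last first.
  by rewrite nth_default// mulr0 normr0 mulr_ge0 ?addr_ge0// exprn_ge0// ltW.
rewrite -ler_pdivrMr ?exprn_gt0//; set x := nth 0 _ _; set v := `|s ^+ n * x| / q ^+ n.
have v0 : 0 <= v by rewrite divr_ge0// exprn_ge0// ltW.
have v4 : v ^+ 4 <= y.
  apply: le_trans (bound n).
  have -> : v ^+ 4 = r ^+ n * x ^+ 4.
    rewrite /v expr_div_n -normrX ger0_norm ?exprn_even_ge0// exprMn.
    rewrite -[(s ^+ n) ^+ 4]exprM -[(q ^+ n) ^+ 4]exprM ![(n * 4)%N]mulnC.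
    rewrite (exprM s 4 n) (exprM q 4 n) (_ : s ^+ 4 = 4^-1); last first.
      by rewrite (exprM s 2 2) s2; field.
    by rewrite mulrAC; congr (_ * _); rewrite [r]invfM [RHS]exprMn [in RHS](exprVn (q ^+ 4)).
  rewrite ler_pM2l ?exprn_gt0//.
  rewrite /energy (big_nth 0) big_mkord (bigD1 (Ordinal jn))//= lerDl.
  by apply: sumr_ge0 => i _; rewrite exprn_even_ge0.
have [v1|v1] := leP v 1; first by rewrite (le_trans v1)// lerDl.
apply: (le_trans _ (_ : y <= 1 + y)); last by rewrite lerDr.
apply: (le_trans _ v4); rewrite -[leLHS]expr1.
by apply: ler_weXn2l => //; exact: ltW.
Qed.

(** By [leaves_pair_sums] and [truncn_double] the two sums differ by at most one leaf of level n +
    1. *)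
Lemma level_step e (C : R) :
  (forall n j, `|s ^+ n * nth 0 (leaves n e) j| <= C * q ^+ n) ->
  forall n t, `|level n.+1 e t - level n e t| <= C * q * q ^+ n.
Proof.
move=> hC n t.
have C0 : 0 <= C.
  by have := le_trans (normr_ge0 _) (hC 0%N 0%N); rewrite expr0 mulr1.
have b0 : 0 <= C * q * q ^+ n.
  by rewrite mulr_ge0 ?exprn_ge0// ?mulr_ge0// ltW.
rewrite /level (leaves_pair_sums n e) sum_take_pair_sums; last first.
  by rewrite size_leaves expnS mul2n odd_double.
rewrite [s ^+ n * (s * _)]mulrA -exprSr -mulrBr.
(* For negative t the truncation is 0 at every level, so both sums are empty. *)
have [t0|t0] := ltP t 0.
  have z k : Num.truncn (2 ^+ k * t) = 0%N.
    by apply/truncn0Pn; rewrite -ltNge (lt_trans _ ltr01)// pmulr_rlt0// exprn_gt0.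
  by rewrite !z !take0 big_nil subrr mulr0 normr0.
have x0 : 0 <= 2 ^+ n * t by rewrite mulr_ge0// exprn_ge0.
rewrite [2 ^+ n.+1]exprS -[2 * _ * t]mulrA; have [->|->] := truncn_double x0.
  by rewrite subrr mulr0 normr0.
by rewrite sum_takeS addrAC subrr add0r -[C * q * _]mulrA -[q * _]exprS; exact: hC.
Qed.

(** Within a time 2^-n the number of summed leaves grows by at most one. *)
Lemma level_modulus e (C : R) :
  (forall n j, `|s ^+ n * nth 0 (leaves n e) j| <= C * q ^+ n) ->
  forall n t t', t <= t' <= t + 2 ^- n -> `|level n e t' - level n e t| <= C * q ^+ n.
Proof.
move=> hC n t t' /andP[tt' t't].
have C0 : 0 <= C.
  by have := le_trans (normr_ge0 _) (hC 0%N 0%N); rewrite expr0 mulr1.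
have b0 : 0 <= C * q ^+ n by rewrite mulr_ge0 ?exprn_ge0// ltW.
have p0 : 0 < 2 ^+ n :> R by rewrite exprn_gt0.
rewrite /level -mulrBr.
have le1 : (Num.truncn (2 ^+ n * t) <= Num.truncn (2 ^+ n * t'))%N.
  by apply: le_truncn; rewrite ler_pM2l.
have le2 : (Num.truncn (2 ^+ n * t') <= (Num.truncn (2 ^+ n * t)).+1)%N.
  rewrite truncn_le_nat; apply: (@le_lt_trans _ _ (2 ^+ n * t + 1)).
    apply: (@le_trans _ _ (2 ^+ n * (t + 2 ^- n))); first by rewrite ler_pM2l.
    by rewrite mulrDr mulfV// gt_eqF.
  by rewrite -[ltRHS]natr1 ltrD2r truncnS_gt.
move: le2; rewrite leq_eqVlt => /predU1P[->|].
  by rewrite sum_takeS addrAC subrr add0r; exact: hC.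
rewrite ltnS => le2; have -> : Num.truncn (2 ^+ n * t') = Num.truncn (2 ^+ n * t).
  by apply/eqP; rewrite eqn_leq le1 le2.
by rewrite subrr mulr0 normr0.
Qed.

(** The value 0 off [good] makes every path continuous, so that the later limits hold for each
    sample point and not only almost surely. *)
Definition brownian e t : R :=
  if `[< good e >] then limn (fun n => level n e t) else 0.

Lemma cvg_brownian e t : good e -> level n e t @[n --> \oo] --> brownian e t.
Proof.
move=> ge; rewrite /brownian asboolT//.
have [C C0 hC] := good_bound ge.
have C0' : 0 <= C * q by rewrite mulr_ge0// ltW.
have q01 : 0 < q < 1 by rewrite q0 q1.
by have [] := geometric_cauchy q01 C0' (fun n => level_step hC n t).
Qed.

(** A Hoelder modulus of exponent log_2 (10/9), stated on dyadic scales. *)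
Lemma brownian_modulus e : exists C : R, forall n t t',
  t <= t' <= t + 2 ^- n -> `|brownian e t' - brownian e t| <= C * q ^+ n.
Proof.
have [ge|nge] := pselect (good e); last first.
  by exists 0 => n t t' _; rewrite /brownian asboolF// subrr normr0 mul0r.
have [C C0 hC] := good_bound ge.
have C0' : 0 <= C * q by rewrite mulr_ge0// ltW.
have q01 : 0 < q < 1 by rewrite q0 q1.
(* [D] controls the distance from level n to the limit at each of the two times, and [C] the
   increment at level n. *)
pose D := C * q / (1 - q); exists (D + C + D) => n t t' tt'.
have lim u : `|brownian e u - level n e u| <= D * q ^+ n.
  rewrite /brownian asboolT//.
  by have [_] := geometric_cauchy q01 C0' (fun n => level_step hC n u); apply.
have lt := lim t; have lt' := lim t'; have lv := level_modulus hC tt'.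
have -> : brownian e t' - brownian e t = (brownian e t' - level n e t') +
    (level n e t' - level n e t) + (level n e t - brownian e t) by ring.
rewrite [leRHS]mulrDl [in leRHS]mulrDl; apply: (le_trans (ler_normD _ _)).
apply: lerD; last by rewrite distrC.
by apply: (le_trans (ler_normD _ _)); exact: lerD.
Qed.

Lemma brownian_continuous e : continuous (brownian e).
Proof.
have [C hC] := brownian_modulus e; move=> t.
have C0 : 0 <= C.
  have := hC 0%N 0 0; rewrite subrr normr0 expr0 mulr1; apply.
  by rewrite lexx/= add0r invr_ge0.
apply/cvgrPdist_le => eps eps0.
have /cvgrPdist_le/(_ _ eps0)[n _ hn] : geometric C q @ \oo --> 0.
  by apply: cvg_geometric; rewrite ger0_norm ?q1 ?(ltW q0).
have := hn n (leqnn n); rewrite /= sub0r normrN ger0_norm; last first.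
  by rewrite mulr_ge0// exprn_ge0// ltW.
move=> Cn; near=> t'.
apply: le_trans Cn.
have d : `|t - t'| <= 2 ^- n.
  near: t'; apply: cvgr_dist_le; first exact: cvg_id.
  by rewrite invr_gt0 exprn_gt0.
have [tt'|t't] := leP t t'.
  rewrite distrC; apply: hC; rewrite tt'/= -lerBlDl.
  by rewrite (le_trans _ d)// distrC ler_norm.
apply: hC; rewrite (ltW t't)/= -lerBlDl.
by rewrite (le_trans _ d)// ler_norm.
Unshelve. all: by end_near. Qed.

Lemma brownian0 e : brownian e 0 = 0.
Proof.
rewrite /brownian; case: ifPn => // _.
rewrite (_ : (fun _ => _) = cst 0) ?lim_cst//.
by apply/funext => n; rewrite /level mulr0 truncn0 take0 big_nil mulr0.
Qed.

Lemma measurable_level n t : measurable_fun setT (fun e => level n e t).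
Proof.
apply: measurable_funM => //.
elim: (Num.truncn _) => [|k IH].
  by under eq_fun do rewrite take0 big_nil; exact: measurable_cst.
under eq_fun do rewrite sum_takeS.
by apply: measurable_funD => //; exact: measurable_nth_leaves.
Qed.

Lemma measurable_brownian t : measurable_fun setT (fun e => brownian e t).
Proof.
apply: (measurable_fun_cvg (h := fun n e => \1_good e * level n e t)).
  move=> n; apply: measurable_funM; last exact: measurable_level.
  by apply: measurable_indic; exact: measurable_good.
move=> e _; have [ge|nge] := pselect (good e).
  rewrite indicE mem_set//; under eq_fun do rewrite mul1r.
  exact: cvg_brownian.
rewrite indicE memNset//; under eq_fun do rewrite mul0r.
rewrite /brownian asboolF//; exact: cvg_cst.
Qed.

End brownian.

Lemma cvg_sumr {R : realType} (I : Type) (r : seq I) (f : I -> nat -> R) (l : I -> R) :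
  (forall i, f i n @[n --> \oo] --> l i) ->
  \sum_(i <- r) f i n @[n --> \oo] --> \sum_(i <- r) l i.
Proof.
move=> fl; elim: r => [|i r IH].
  by rewrite big_nil; under eq_fun do rewrite big_nil; exact: cvg_cst.
by rewrite big_cons; under eq_fun do rewrite big_cons; exact: cvgD.
Qed.

(** * The law of the path on the mesh of width 1/N *)

Section gaussian_limits.
Context {R : realType}.
Local Notation gauss := (@gauss R).
Implicit Types H : seq R -> R.

(** Sequential and coordinatewise, hence free of any topology on lists and in the form that
    dominated convergence uses. *)
Definition list_continuous N H := forall (u : nat -> seq R) (v : seq R),
  (forall n, size (u n) = N) -> size v = N ->
  (forall i, (i < N)%N -> nth 0 (u n) i @[n --> \oo] --> nth 0 v i) ->
  H (u n) @[n --> \oo] --> H v.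

Lemma itint_gauss_le N (F : seq R -> \bar R) (C : R) :
  list_measurable N F -> (forall l, 0 <= F l)%E -> (forall l, F l <= C%:E)%E ->
  (itint gauss N F <= C%:E)%E.
Proof.
elim: N F => [|N IH] F mF F0 FC //=.
rewrite -[leRHS](integral_probability_cst gauss); apply: ge0_le_integral => //.
- by move=> x _; exact: itint_ge0.
- exact: measurable_itint_cons.
- by move=> x _; apply: IH => //; exact: list_measurable_cons.
Qed.

Lemma itint_gauss_cvg N (H_ : nat -> seq R -> R) H (C : R) :
  (forall k, list_measurable N (fun l => (H_ k l)%:E)) ->
  (forall k l, 0 <= H_ k l <= C) ->
  (forall l, size l = N -> H_ k l @[k --> \oo] --> H l) ->
  (itint gauss N (fun l => (H_ k l)%:E) @[k --> \oo] -->
   itint gauss N (fun l => (H l)%:E))%E.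
Proof.
elim: N H_ H => [|N IH] H_ H mH HC cH /=.
  by apply/cvg_EFin; [exact: nearW|exact: cH].
have H0 k l : (0 <= (H_ k l)%:E)%E by rewrite lee_fin; case/andP: (HC k l).
have HC' k l : ((H_ k l)%:E <= C%:E)%E by rewrite lee_fin; case/andP: (HC k l).
apply: (@dominated_cvg _ _ _ gauss setT measurableT
  (fun k x => itint gauss N (fun l => (H_ k (x :: l))%:E)) _ (cst C%:E)) => //.
- by move=> k; exact: (measurable_itint_cons gauss (mH k) (H0 k)).
- move=> x _; apply: IH => //.
    by move=> k; exact: (list_measurable_cons x (mH k)).
  by move=> l lN; apply: cH; rewrite /= lN.
- apply/integrableP; split => //.
  by rewrite integral_cst//= -[X in (_ * X)%E]/(gauss setT) probability_setT mule1 ltry.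
move=> k x _; rewrite gee0_abs ?itint_ge0//.
apply: itint_gauss_le => //; exact: (list_measurable_cons x (mH k)).
Qed.

End gaussian_limits.

Section dyadic_blocks.
Context (R : realType).

Lemma nth_partial_sums_blocks (c d : R) ms l i : (i < size ms)%N ->
  nth 0 (partial_sums c d (block_sums ms l)) i =
  d + c * \sum_(y <- take (sumn (take i.+1 ms)) l) y.
Proof.
elim: ms l d i => // m ms IH l d [|i] /= im.
  by rewrite take0 /= addn0.
rewrite IH// takeD big_cat /= mulrDr addrA; congr (_ + _ * _).
Qed.

Lemma size_block_sums ms (l : seq R) : size (block_sums ms l) = size ms.
Proof. by elim: ms l => //= m ms IH l; rewrite IH. Qed.

Lemma size_partial_sums (c d : R) l : size (partial_sums c d l) = size l.
Proof. exact: size_scanl. Qed.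

Lemma nth_partial_sums (c d : R) l i : (i < size l)%N ->
  nth 0 (partial_sums c d l) i = d + c * \sum_(j < i.+1) nth 0 l j.
Proof.
elim: l d i => // x l IH d [|i] /= il.
  by rewrite big_ord_recl big_ord0 addr0.
by rewrite IH// [in RHS]big_ord_recl /= mulrDr addrA.
Qed.

(** The number of leaves that [level n] sums at time i/N. *)
Definition dyadic_index n N i : nat := Num.truncn (2 ^+ n * (i%:R / N%:R) : R).

Definition dyadic_blocks n N : seq nat :=
  mkseq (fun i => dyadic_index n N i.+1 - dyadic_index n N i)%N N.

Lemma dyadic_index_nd n N i : (dyadic_index n N i <= dyadic_index n N i.+1)%N.
Proof.
apply: le_truncn; rewrite ler_pM2l ?exprn_gt0// ler_wpM2r ?invr_ge0// ler_nat.
exact: leqnSn.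
Qed.

Lemma sumn_dyadic_blocks n N i : (i <= N)%N ->
  sumn (take i (dyadic_blocks n N)) = dyadic_index n N i.
Proof.
elim: i => [|i IH] iN.
  by rewrite take0 /dyadic_index mul0r mulr0 truncn0.
rewrite (take_nth 0%N) ?size_mkseq// sumn_rcons IH 1?ltnW// nth_mkseq//.
by rewrite subnKC// dyadic_index_nd.
Qed.

Lemma sumn_dyadic_blocksT n N : (0 < N)%N -> sumn (dyadic_blocks n N) = (2 ^ n)%N.
Proof.
move=> N0; rewrite -[X in sumn X](take_size) size_mkseq sumn_dyadic_blocks//.
rewrite /dyadic_index divff ?pnatr_eq0 -?lt0n// mulr1.
by rewrite -natrX natrK.
Qed.

Lemma cvg_pow_half : (2^-1 ^+ n : R) @[n --> \oo] --> (0 : R).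
Proof.
rewrite exprn_geometric; apply: cvg_geometric.
by rewrite ger0_norm ?invr_ge0// invf_lt1// ltr1n.
Qed.

Lemma cvg_dyadic_index N i :
  (2^-1 ^+ n * (dyadic_index n N i)%:R : R) @[n --> \oo] --> (i%:R / N%:R : R).
Proof.
apply/cvgrPdist_le => eps eps0.
have := cvg_pow_half => /cvgrPdist_le/(_ _ eps0) h.
near=> n; apply: (@le_trans _ _ (2^-1 ^+ n)); last first.
  have : `|0 - 2^-1 ^+ n| <= eps by near: n.
  by rewrite sub0r normrN ger0_norm// exprn_ge0// invr_ge0.
set x := i%:R / N%:R.
have x0 : 0 <= 2 ^+ n * x by rewrite mulr_ge0 ?exprn_ge0// divr_ge0.
have /andP[kx xk] := truncn_itv x0; rewrite -/(dyadic_index n N i) in kx xk.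
have p0 : 0 < 2^-1 ^+ n :> R by rewrite exprn_gt0// invr_gt0.
have px : 2^-1 ^+ n * (2 ^+ n * x) = x.
  by rewrite mulrA -exprMn mulVf// expr1n mul1r.
rewrite -{1}px -mulrBr normrM gtr0_norm// -[leRHS]mulr1 ler_pM2l//.
by rewrite ger0_norm ?subr_ge0// lerBlDr addrC natr1 ltW.
Unshelve. all: by end_near. Qed.

(** With the power moved under the root, the claim is that the block length divided by 2^n tends to
    1/N, a difference of two limits from [cvg_dyadic_index]. *)
Lemma cvg_dyadic_block N i : (i < N)%N ->
  ((Num.sqrt 2)^-1 ^+ n * Num.sqrt (nth 0%N (dyadic_blocks n N) i)%:R : R)
    @[n --> \oo] --> ((Num.sqrt N%:R)^-1 : R).
Proof.
move=> iN.
have sE n (m : nat) : (Num.sqrt 2)^-1 ^+ n * Num.sqrt m%:R =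
    Num.sqrt (2^-1 ^+ n * m%:R) :> R.
  rewrite sqrtrM ?exprn_ge0 ?invr_ge0//; congr (_ * _).
  rewrite -[LHS]ger0_norm ?exprn_ge0 ?invr_ge0 ?sqrtr_ge0// -sqrtr_sqr.
  by rewrite -exprM mulnC exprM [_^-1 ^+ 2]exprVn sqr_sqrtr.
under eq_fun do rewrite sE.
rewrite -sqrtrV//; apply: (@cvg_comp _ _ _ _ (@Num.sqrt R)); last exact: sqrt_continuous.
under eq_fun do rewrite nth_mkseq// natrB ?dyadic_index_nd// mulrBr.
rewrite (_ : N%:R^-1 = i.+1%:R / N%:R - i%:R / N%:R).
  exact: (cvgB (cvg_dyadic_index (N := N) (i := i.+1)) (cvg_dyadic_index (N := N) (i := i))).
by rewrite -mulrBl -natr1 addrAC subrr add0r mul1r.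
Qed.

Lemma nth_block_sums ms (l : seq R) i : (i < size ms)%N ->
  nth 0 (block_sums ms l) i = \sum_(y <- take (sumn (take i.+1 ms)) l) y -
                              \sum_(y <- take (sumn (take i ms)) l) y.
Proof.
elim: ms l i => // m ms IH l [|i] /= im.
  by rewrite take0 /= addn0 !take0 big_nil subr0.
by rewrite IH// !takeD !big_cat /= opprD addrACA subrr add0r.
Qed.

Lemma measurable_sum_take n k :
  measurable_fun [set: n.-tuple R] (fun t : n.-tuple R => \sum_(y <- take k t) y).
Proof.
elim: k => [|k IH].
  by under eq_fun do rewrite take0 big_nil; exact: measurable_cst.
under eq_fun do rewrite sum_takeS.
by apply: measurable_funD => //; exact: measurable_tuple_nth.
Qed.

Lemma nth_block_scale ms (y : seq R) i : size y = size ms -> (i < size ms)%N ->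
  nth 0 (block_scale ms y) i = Num.sqrt (nth 0%N ms i)%:R * nth 0 y i.
Proof.
move=> sy im; rewrite (nth_map (0%N, 0)) ?size_zip ?sy ?minnn//.
by rewrite nth_zip.
Qed.

Lemma size_block_scale ms (y : seq R) : size y = size ms ->
  size (block_scale ms y) = size ms.
Proof. by move=> sy; rewrite size_map size_zip sy minnn. Qed.

End dyadic_blocks.

Section brownian_law.
Context {R : realType}.
Notation M := (measurableTypeR R).
Local Notation gauss := (@gauss R).
Local Notation noise := (@noise R).

(** The integrals of [f n] have two limits: the left side, because the levels converge on [good],
    and the right side, because at level n the mesh values are partial sums of block sums, whose
    scales converge. Uniqueness of limits concludes. *)
Lemma brownian_law N (H : seq R -> R) (C : R) : (0 < N)%N ->
  list_measurable N (fun l => (H l)%:E) -> list_continuous N H ->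
  (forall l, 0 <= H l <= C) ->
  (\int[noise]_e (H (mkseq (fun i => brownian e (i.+1%:R / N%:R)) N))%:E =
   itint gauss N (fun x => (H (partial_sums (Num.sqrt N%:R)^-1 0 x))%:E))%E.
Proof.
move=> N0 mH cH HC.
have H0 l : (0 <= (H l)%:E)%E by rewrite lee_fin; case/andP: (HC l).
pose f n e := (H (mkseq (fun i => level n e (i.+1%:R / N%:R)) N))%:E.
have mf n : measurable_fun setT (f n).
  apply: (measurable_list_comp mH) => [e|i iN]; first by rewrite size_mkseq.
  apply: (eq_measurable_fun (fun e => level n e (i.+1%:R / N%:R))).
    by move=> e _; rewrite nth_mkseq.
  exact: measurable_level.
have lim1 : (\int[noise]_e f n e @[n --> \oo] -->
    \int[noise]_e (H (mkseq (fun i => brownian e (i.+1%:R / N%:R)) N))%:E)%E.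
  have [] := @dominated_convergence _ _ _ noise setT measurableT f
    (fun e => (H (mkseq (fun i => brownian e (i.+1%:R / N%:R)) N))%:E) (cst C%:E).
  - exact: mf.
  - apply: (measurable_list_comp mH) => [e|i iN]; first by rewrite size_mkseq.
    apply: (eq_measurable_fun (fun e => brownian e (i.+1%:R / N%:R))).
      by move=> e _; rewrite nth_mkseq.
    exact: measurable_brownian.
  - exists (~` good); split.
    + by apply: measurableC; exact: measurable_good.
    + exact: good_ae.
    move=> e /= h ge; apply: h => _; apply/cvg_EFin; first exact: nearW.
    apply: cH; [by move=> n; rewrite size_mkseq|by rewrite size_mkseq|].
    move=> i iN; rewrite nth_mkseq//; under eq_fun do rewrite nth_mkseq//.
    exact: cvg_brownian.
  - apply/integrableP; split => //.
    by rewrite integral_cst//= -[X in (_ * X)%E]/(noise setT) probability_setT mule1 ltry.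
  - by apply: aeW => e n _; rewrite gee0_abs// lee_fin; case/andP: (HC (mkseq (fun i => level n e (i.+1%:R / N%:R)) N)).
  - by [].
have szb n : size (dyadic_blocks R n N) = N by rewrite size_mkseq.
have fE n : (\int[noise]_e f n e = itint gauss N (fun y =>
    (H (partial_sums ((Num.sqrt 2)^-1 ^+ n) 0 (block_scale (dyadic_blocks R n N) y)))%:E))%E.
  pose F l := (H (partial_sums ((Num.sqrt 2)^-1 ^+ n) 0 l))%:E.
  have mF : list_measurable N F.
    apply: (measurable_list_comp mH) => [t|i iN]; first by rewrite size_partial_sums size_tuple.
    have := @measurable_nth_partial_sums R N ((Num.sqrt 2)^-1 ^+ n) 0 i.+1.
    exact: eq_measurable_fun.
  have F0 l : (0 <= F l)%E by exact: H0.
  have := @itint_gauss_blocks R (dyadic_blocks R n N) F.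
  rewrite szb sumn_dyadic_blocksT// => <-//.
  rewrite -leaves_law//.
  - apply: eq_integral => e _; rewrite /f /F; congr (H _)%:E.
    apply: (@eq_from_nth _ 0); first by rewrite size_mkseq size_partial_sums size_block_sums szb.
    rewrite size_mkseq => i iN; rewrite nth_mkseq// nth_partial_sums_blocks ?szb//.
    by rewrite add0r sumn_dyadic_blocks.
  - apply: (measurable_list_comp mF) => [t|i iN]; first by rewrite size_block_sums.
    apply: (eq_measurable_fun (fun t : (2 ^ n).-tuple R =>
      \sum_(y <- take (sumn (take i.+1 (dyadic_blocks R n N))) t) y -
      \sum_(y <- take (sumn (take i (dyadic_blocks R n N))) t) y)).
      by move=> t _; rewrite nth_block_sums ?szb.
    by apply: measurable_funB; exact: measurable_sum_take.
have lim2 : (\int[noise]_e f n e @[n --> \oo] -->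
    itint gauss N (fun x => (H (partial_sums (Num.sqrt N%:R)^-1 0 x))%:E))%E.
  under eq_fun do rewrite fE.
  apply: (itint_gauss_cvg (C := C)) => //.
    move=> n; apply: (measurable_list_comp mH) => [t|i iN].
      by rewrite size_partial_sums size_block_scale ?szb ?size_tuple.
    apply: (eq_measurable_fun (fun t : N.-tuple R => (Num.sqrt 2)^-1 ^+ n *
        \sum_(j < i.+1) (Num.sqrt (nth 0%N (dyadic_blocks R n N) j)%:R * nth 0 t j))).
      move=> t _; rewrite nth_partial_sums ?size_block_scale ?szb ?size_tuple//.
      rewrite add0r; congr (_ * _); apply: eq_bigr => j _.
      by rewrite nth_block_scale ?szb ?size_tuple// (leq_trans (ltn_ord j)).
    apply: measurable_funM => //; apply: measurable_sum => j.
    by apply: measurable_funM => //; exact: measurable_tuple_nth.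
  move=> y yN; apply: cH.
  - by move=> n; rewrite size_partial_sums size_block_scale ?szb.
  - by rewrite size_partial_sums.
  move=> i iN; rewrite nth_partial_sums ?yN// add0r mulr_sumr.
  under eq_fun => n.
    rewrite nth_partial_sums ?size_block_scale ?szb// add0r mulr_sumr.
    under eq_bigr => j _ do rewrite nth_block_scale ?szb// ?(leq_trans (ltn_ord j))// mulrA.
    over.
  apply: cvg_sumr => j; apply: cvgM; last exact: cvg_cst.
  by apply: cvg_dyadic_block; exact: (leq_trans (ltn_ord j)).
exact: (cvg_unique (@ereal_hausdorff R) lim1 lim2).
Qed.

End brownian_law.

(** * Random loops *)

Section random_loop.
Context {R : realType}.
Notation M := (measurableTypeR R).
Local Notation leb := (@lebesgue_measure R).
Local Notation gauss := (@gauss R).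
Local Notation noise := (@noise R).
Variable kappa : R.
Hypothesis kappa0 : 0 < kappa.
Local Notation c := ((Num.sqrt kappa)^-1).

Definition loop (e : M * M) (t : R) : R := c * (brownian e t - t * brownian e 1).

Definition loop_mean N (e : M * M) : R := N%:R^-1 * \sum_(i < N) loop e (i%:R / N%:R).

Definition loop_list N (p : M * (M * M)) : seq R :=
  mkseq (fun i => (p.1 : R) + (loop p.2 (i%:R / N%:R) - loop_mean N p.2)) N.

Lemma measurable_loop t : measurable_fun setT (loop ^~ t).
Proof.
apply: measurable_funM => //; apply: measurable_funB; first exact: measurable_brownian.
by apply: measurable_funM => //; exact: measurable_brownian.
Qed.

Lemma measurable_loop_mean N : measurable_fun setT (loop_mean N).
Proof.
apply: measurable_funM => //; apply: measurable_sum => i; exact: measurable_loop.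
Qed.

Lemma loop_continuous e : continuous (loop e).
Proof.
move=> t; apply: cvgM; first exact: cvg_cst.
apply: cvgB; first exact: brownian_continuous.
by apply: cvgM; [exact: cvg_id|exact: cvg_cst].
Qed.

Lemma measurable_nth_loop_list N i :
  measurable_fun setT (fun p : M * (M * M) => nth 0 (loop_list N p) i).
Proof.
have [iN|Ni] := ltnP i N; last first.
  under eq_fun do rewrite nth_default ?size_mkseq//; exact: measurable_cst.
under eq_fun do rewrite nth_mkseq//.
apply: measurable_funD; first exact: measurable_fst.
apply: measurable_funB.
  exact: (measurableT_comp (measurable_loop _) measurable_snd).
exact: (measurableT_comp (measurable_loop_mean N) measurable_snd).
Qed.

Lemma partial_sums_scale (a b d : R) l :
  partial_sums (a * b) (a * d) l = [seq a * y | y <- partial_sums b d l].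
Proof.
rewrite /partial_sums; elim: l d => //= x l IH d.
by rewrite -IH mulrDr mulrA.
Qed.

Lemma bridge_brownian N a e : (0 < N)%N ->
  bridge N a [seq c * y | y <- mkseq (fun i => brownian e (i.+1%:R / N%:R)) N] =
  mkseq (fun i => a + loop e (i%:R / N%:R)) N.
Proof.
move=> N0; apply/eq_in_map => i; rewrite mem_iota/= add0n => iN.
have nthE j : (j <= N)%N -> nth 0 (0 :: [seq c * y | y <-
    mkseq (fun i => brownian e (i.+1%:R / N%:R)) N]) j = c * brownian e (j%:R / N%:R).
  case: j => [|j] jN /=; first by rewrite mul0r brownian0 mulr0.
  by rewrite (nth_map 0) ?size_mkseq// nth_mkseq.
rewrite !nthE// 1?ltnW// divff ?pnatr_eq0 -?lt0n// /loop; congr (_ + _); ring.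
Qed.

Lemma list_continuous_bridge N a H : list_continuous N H ->
  list_continuous N (fun y => H (bridge N a [seq c * x | x <- y])).
Proof.
move=> cH u v su sv uv; apply: cH.
- by move=> n; rewrite size_bridge.
- by rewrite size_bridge.
have nthv j : nth 0 (0 :: [seq c * x | x <- u n]) j @[n --> \oo] -->
    nth 0 (0 :: [seq c * x | x <- v]) j.
  case: j => [|j] /=; first exact: cvg_cst.
  have [jN|Nj] := ltnP j N.
    rewrite (nth_map 0) ?sv//; under eq_fun do rewrite (nth_map 0) ?su//.
    by apply: cvgM; [exact: cvg_cst|exact: uv].
  rewrite nth_default ?size_map ?sv//.
  by under eq_fun do rewrite nth_default ?size_map ?su//; exact: cvg_cst.
move=> i iN; rewrite nth_mkseq//; under eq_fun do rewrite nth_mkseq//.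
apply: cvgD; first exact: cvg_cst.
by apply: cvgB => //; apply: cvgM => //; exact: cvg_cst.
Qed.

(** [lebesgue_loop] with A = kappa N / 2, for which (2 A)^(-1/2) = c N^(-1/2), then [brownian_law]
    for each base point, then a shift of the base point by minus the loop mean. The constant depends
    on N but not on [H], hence cancels in quotients. *)
Lemma loop_law N : (0 < N)%N -> exists2 C : R, 0 < C &
  forall (H : seq R -> R) (B : R), list_measurable N (fun l => (H l)%:E) ->
    list_continuous N H -> (forall l, 0 <= H l <= B) ->
  (itint leb N (fun f => (expR (- (kappa * N%:R / 2 * loop_energy N f)))%:E * (H f)%:E) =
   C%:E * \int[leb \x noise]_p (H (loop_list N p))%:E)%E.
Proof.
move=> N0; have NR0 : 0 < N%:R :> R by rewrite ltr0n.
have A0 : 0 < kappa * N%:R / 2 by rewrite !mulr_gt0.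
have [C C0 CE] := lebesgue_loop N0 A0; exists C => // H B mH cH HB.
have H0 l : (0 <= (H l)%:E)%E by rewrite lee_fin; case/andP: (HB l).
rewrite CE//; congr (_ * _)%E.
have -> : (Num.sqrt (2 * (kappa * N%:R / 2)))^-1 = c * (Num.sqrt N%:R)^-1.
  by rewrite mulrCA mulfV// mulr1 sqrtrM ?ltW// invfM.
pose G (a : M) (e : M * M) := (H (mkseq (fun i => (a : R) + loop e (i%:R / N%:R)) N))%:E.
have mG : measurable_fun setT (fun p : M * (M * M) => G p.1 p.2).
  apply: (measurable_list_comp mH) => [p|i iN]; first by rewrite size_mkseq.
  under eq_fun do rewrite nth_mkseq//.
  apply: measurable_funD; first exact: measurable_fst.
  exact: (measurableT_comp (measurable_loop _) measurable_snd).
transitivity (\int[leb]_a \int[noise]_e G a e)%E.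
  apply: eq_integral => a _.
  transitivity (\int[noise]_e (H (bridge N a [seq c * x | x <-
      mkseq (fun i => brownian e (i.+1%:R / N%:R)) N]))%:E)%E; last first.
    by apply: eq_integral => e _; rewrite bridge_brownian.
  rewrite (brownian_law (H := fun y => H (bridge N a [seq c * x | x <- y])) (C := B))//.
  - apply: eq_itint => l _; rewrite -partial_sums_scale mulr0//.
  - apply: (measurable_list_comp mH) => [t|i iN]; first by rewrite size_bridge.
    under eq_fun do rewrite nth_mkseq//.
    have mn j : measurable_fun [set: N.-tuple R]
        (fun t : N.-tuple R => nth 0 (0 :: [seq c * x | x <- t]) j).
      case: j => [|j] /=; first exact: measurable_cst.
      have [jN|Nj] := ltnP j N.
        under eq_fun do rewrite (nth_map 0) ?size_tuple//.
        by apply: measurable_funM => //; exact: measurable_tuple_nth.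
      by under eq_fun do rewrite nth_default ?size_map ?size_tuple//; exact: measurable_cst.
    apply: measurable_funD => //; apply: measurable_funB => //.
    exact: measurable_funM.
  - exact: list_continuous_bridge.
have G0 a e : (0 <= G a e)%E by exact: H0.
(* The shift depends on [e], so the integral over the base point has to be the inner one. *)
rewrite (ge0_integral_swap leb noise mG G0).
have mL : measurable_fun setT (fun p : M * (M * M) => (H (loop_list N (p.1, p.2)))%:E).
  apply: (measurable_list_comp mH) => [p|i iN]; first by rewrite size_mkseq.
  by under eq_fun do rewrite -surjective_pairing; exact: measurable_nth_loop_list.
transitivity (\int[leb \x noise]_p (H (loop_list N (p.1, p.2)))%:E)%E; last first.
  by apply: eq_integral => -[a e] _.
rewrite (@ge0_integral_prod _ _ _ _ _ leb noise (fun a e => (H (loop_list N (a, e)))%:E) mL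
  (fun a e => H0 _)).
rewrite (@ge0_integral_swap _ _ _ _ _ leb noise (fun a e => (H (loop_list N (a, e)))%:E) mL
  (fun a e => H0 _)).
apply: eq_integral => e _.
rewrite (ge0_integral_lebesgue_shift (- loop_mean N e))//; last first.
  exact: (measurable_fun_pair1 e mG).
apply: eq_integral => a _; congr (H _)%:E; apply: eq_mkseq => i /=.
by rewrite -addrA; congr (_ + _); rewrite addrC.
Qed.

End random_loop.

(** * Measurability and laws on Borel spaces *)

Section list_continuity.
Context {R : realType}.

Definition dyadic_floor k (x : R) : R := (Num.floor (2 ^+ k * x))%:~R / 2 ^+ k.

Lemma cvg_dyadic_floor x : dyadic_floor k x @[k --> \oo] --> x.
Proof.
apply/cvgrPdist_le => eps eps0.
have := @cvg_pow_half R => /cvgrPdist_le/(_ _ eps0) h.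
near=> k; apply: (@le_trans _ _ (2^-1 ^+ k)); last first.
  have : `|0 - 2^-1 ^+ k| <= eps by near: k.
  by rewrite sub0r normrN ger0_norm// exprn_ge0// invr_ge0.
have p0 : 0 < 2 ^+ k :> R by rewrite exprn_gt0.
rewrite /dyadic_floor -{1}(mulfK (x := 2 ^+ k) (lt0r_neq0 p0) x) -mulrBl normrM.
rewrite normfV (gtr0_norm p0) exprVn -[leRHS]mul1r ler_pM2r ?invr_gt0//.
have /andP[fl fu] := floor_itv (2 ^+ k * x).
rewrite mulrC ger0_norm ?subr_ge0// lerBlDl ltW//.
by move: fu; rewrite intrD.
Unshelve. all: by end_near. Qed.

Lemma measurable_floorR :
  measurable_fun [set: measurableTypeR R] (fun x : R => (Num.floor x)%:~R : R).
Proof.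
apply: nondecreasing_measurable => // x y xy.
by rewrite ler_int; exact: le_floor.
Qed.

(** Rounding the coordinates down to multiples of 2^-k gives functions that are constant on
    countably many measurable boxes, and sequential continuity makes [H] their pointwise limit. *)
Lemma list_continuous_measurable N (H : seq R -> R) : list_continuous N H ->
  list_measurable N (fun l => (H l)%:E).
Proof.
move=> cH; apply/measurable_EFinP.
apply: (measurable_fun_cvg (h := fun k (t : N.-tuple R) => H (map (dyadic_floor k) t))).
  move=> k mT A mA.
  (* Encoded as the zero set of one measurable sum, which makes it measurable at once; [boxP]
     recovers the coordinates. *)
  pose box (z : N.-tuple int) : set (N.-tuple R) :=
    [set t | \sum_(i < N) `|(Num.floor (2 ^+ k * tnth t i))%:~R - (tnth z i)%:~R : R| = 0].
  have mbox z : measurable (box z).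
    rewrite (_ : box z = setT `&` (fun t : N.-tuple R => \sum_(i < N)
      `|(Num.floor (2 ^+ k * tnth t i))%:~R - (tnth z i)%:~R : R|) @^-1` [set 0]).
      apply: measurable_sum => [i||]//; apply: measurableT_comp => //.
      apply: measurable_funB => //.
      apply: (@measurableT_comp _ _ _ _ _ _ (fun x : R => (Num.floor x)%:~R : R)).
        exact: measurable_floorR.
      by apply: measurable_funM => //; exact: measurable_tnth.
    by apply/seteqP; split => t //= [].
  have boxP z t : box z t <-> forall i, Num.floor (2 ^+ k * tnth t i) = tnth z i.
    rewrite /box/=; split => [/eqP|h].
      rewrite psumr_eq0// => /allP h i.
      have := h i (mem_index_enum i); rewrite normr_eq0 subr_eq0.
      by rewrite eqr_int => /eqP.
    by apply: big1 => i _; rewrite h subrr normr0.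
  rewrite setTI (_ : _ @^-1` A = \bigcup_(z in [set z : N.-tuple int |
      A (H [seq z%:~R / 2 ^+ k | z <- z])]) box z).
    rewrite bigcup_mkcond; apply: countable_bigcupT_measurable => [|z]; first exact: countableP.
    by case: ifPn.
  have mapE (t : N.-tuple R) (z : N.-tuple int) : box z t ->
      map (dyadic_floor k) t = [seq (z%:~R : R) / 2 ^+ k | z <- z].
    move=> /boxP tz; apply: (@eq_from_nth _ 0); first by rewrite !size_map !size_tuple.
    rewrite size_map size_tuple => i iN.
    rewrite (nth_map 0) ?size_tuple// (nth_map 0) ?size_tuple//.
    have := tz (Ordinal iN); rewrite !(tnth_nth 0) /= /dyadic_floor => ->.
    by [].
  apply/seteqP; split => t.
    move=> At; pose z := [tuple Num.floor (2 ^+ k * tnth t i) | i < N].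
    have bz : box z t by apply/boxP => i; rewrite tnth_mktuple.
    by exists z => //; move: At; rewrite /preimage /mkset (mapE _ _ bz).
  by move=> [z /= Az /mapE tz]; rewrite /preimage/= tz.
move=> t _; apply: cH.
- by move=> k; rewrite size_map size_tuple.
- by rewrite size_tuple.
move=> i iN; under eq_fun do rewrite (nth_map 0) ?size_tuple//.
exact: cvg_dyadic_floor.
Qed.

End list_continuity.

(** * Maps into Borel spaces and weighted laws *)

Section borel_maps.
Context {R : realType} (V : normedModType R) d (T : measurableType d).

(** An open set is where a continuous function, the distance to its complement, is positive; so real
    continuous test functions suffice. *)
Lemma measurable_borel (X : T -> V) :
  (forall phi : V -> R, continuous phi -> measurable_fun setT (phi \o X)) ->
  measurable_fun setT (X : T -> borel V).
Proof.
move=> mX; apply: (@measurability _ _ T (borel V) setT X (@open V)) => //.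
move=> _ [U oU <-]; rewrite setTI.
(* For the whole space the distance would be an infimum over the empty set. *)
have [CU0|/set0P[y0 Uy0]] := eqVneq (~` U) set0.
  by rewrite (_ : U = setT) ?preimage_setT//; rewrite -[U]setCK CU0 setC0.
pose S x := [set `|x - y| | y in ~` U].
pose dU x := inf (S x).
have S0 x : S x !=set0 by exists `|x - y0|, y0.
have lbS x : has_lbound (S x) by exists 0 => _ [y _ <-].
have dle x y : dU x <= dU y + `|x - y|.
  rewrite -lerBlDr; apply: lb_le_inf => // _ [z Uz <-].
  rewrite lerBlDr; apply: (@le_trans _ _ `|x - z|).
    by apply: ge_inf => //; exists z.
  by rewrite -[x - z](subrKA y) addrC ler_normD.
have cd : continuous dU.
  move=> x; apply/cvgrPdist_le => e e0; near=> y.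
  have xy : `|x - y| <= e.
    by near: y; apply: cvgr_dist_le => //; exact: cvg_id.
  rewrite ler_norml; apply/andP; split.
    by rewrite lerNl opprB lerBlDr addrC (le_trans (dle y x))// lerD2l distrC.
  by rewrite lerBlDr addrC (le_trans (dle x y))// lerD2l.
rewrite (_ : X @^-1` U = setT `&` (dU \o X) @^-1` `]0, +oo[%classic).
  by apply: (mX _ cd) => //; exact: measurable_itv.
rewrite setTI; apply/seteqP; split => t /=; rewrite in_itv/= andbT.
  move=> Ut; have /nbhs_ballP[e /= e0 he] := open_nbhs_nbhs (conj oU Ut).
  apply: (lt_le_trans e0); apply: lb_le_inf => // _ [y Uy <-].
  rewrite leNgt; apply/negP => ye; apply: Uy; apply: he.
  by rewrite -ball_normE.
move=> d0; apply: contrapT => nU; move: d0; apply/negP; rewrite -leNgt.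
by apply: ge_inf => //; exists (X t) => //; rewrite subrr normr0.
Unshelve. all: by end_near. Qed.

End borel_maps.

(** Adding its bound to a bounded function makes it nonnegative; identities for nonnegative
    integrands thus extend to bounded ones. *)
Lemma integral_probability_shift d (T : measurableType d) (R : realType)
    (P : probability T R) (phi : T -> R) (B : R) : measurable_fun setT phi ->
  (forall y, `|phi y| <= B) ->
  (\int[P]_y (phi y + B)%:E = \int[P]_y (phi y)%:E + B%:E)%E.
Proof.
move=> mphi phiB.
have iphi : P.-integrable setT (fun y => (phi y)%:E).
  apply: (le_integrable measurableT _ _
    (finite_measure_integrable_cst P B measurableT)) => //.
    exact/measurable_EFinP.
  by move=> y _ /=; rewrite lee_fin (le_trans (phiB _))// ler_norm.
rewrite -[X in (_ = _ + X)%E](integral_probability_cst P).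
rewrite -(integralD measurableT iphi (finite_measure_integrable_cst P B measurableT)).
by apply: eq_integral => y _; rewrite EFinD.
Qed.

Section weighted_law.
Context d d' (T : measurableType d) (T' : measurableType d') (R : realType).
Variables (m : {measure set T -> \bar R}) (X : T -> T') (h : T -> R).
Hypotheses (mX : measurable_fun [set: T] X) (mh : measurable_fun [set: T] h).
Hypothesis h0 : forall t, 0 <= h t.
Hypothesis h1 : (\int[m]_t (h t)%:E = 1)%E.
Local Open Scope ereal_scope.

Let nu (A : set T') : \bar R := \int[m]_(t in X @^-1` A) (h t)%:E.

Let mhE : measurable_fun setT (EFin \o h).
Proof. exact/measurable_EFinP. Qed.

Let nu0 : nu set0 = 0.
Proof. by rewrite /nu preimage_set0 integral_set0. Qed.

Let nu_ge0 A : 0 <= nu A.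
Proof. by apply: integral_ge0 => t _; rewrite lee_fin. Qed.

Let nu_additive : semi_sigma_additive nu.
Proof.
move=> F mF tF mUF; rewrite /nu preimage_bigcup.
have mXF A : measurable A -> measurable (X @^-1` A).
  by move=> mA; rewrite -[_ @^-1` _]setTI; exact: mX.
apply: (@semi_sigma_additive_nng_induced _ _ _ m (EFin \o h)) => //.
- by move=> i; exact: mXF.
- move=> i j _ _ [t [/= Fi Fj]]; apply: tF => //; by exists (X t).
- by rewrite -preimage_bigcup; exact: mXF.
Qed.

Let nu_setT : nu setT = 1.
Proof. by rewrite /nu preimage_setT. Qed.

(** Used twice: with the Gibbs density on tuples and [interp] for [X], and with the limit weight and
    the limit loop. *)
Lemma weighted_law : exists P : probability T' R,
  (forall A, P A = \int[m]_(t in X @^-1` A) (h t)%:E) /\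
  forall phi : T' -> R, measurable_fun setT phi ->
    (exists B : R, forall y, (`|phi y| <= B)%R) ->
    \int[P]_y (phi y)%:E = \int[m]_t (h t * phi (X t))%:E.
Proof.
pose mnu : {measure set T' -> \bar R} :=
  HB.pack nu (isMeasure.Build _ _ _ nu nu0 nu_ge0 nu_additive).
pose P : probability T' R :=
  HB.pack nu (isMeasure.Build _ _ _ nu nu0 nu_ge0 nu_additive)
    (Measure_isProbability.Build _ _ _ mnu nu_setT).
exists P; split => [//|phi mphi [B phiB]].
have mphiX : measurable_fun setT (phi \o X) by exact: measurableT_comp.
have ih : m.-integrable setT (EFin \o h).
  apply/integrableP; split => //.
  rewrite (_ : (fun _ => _) = (fun t => (h t)%:E)) ?h1 ?ltry//.
  by apply/funext => t /=; rewrite ger0_norm.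
have iphiX : m.-integrable setT (fun t => (h t * phi (X t))%:E).
  apply: (le_integrable measurableT _ _ (integrableZl measurableT B ih)) => //.
    by apply/measurable_EFinP; exact: measurable_funM.
  move=> t _ /=; rewrite lee_fin !normrM mulrC.
  by rewrite ler_wpM2r// (le_trans (phiB _))// ler_norm.
have B0 y : (0 <= phi y + B)%R.
  by have := phiB y; rewrite ler_norml => /andP[+ _]; rewrite -subr_ge0 opprK.
have E : \int[P]_y (phi y + B)%:E = \int[m]_t ((h t)%:E * (phi (X t) + B)%:E).
  apply: (ge0_integral_weighted_image mX mh h0).
  - move=> A mA; rewrite /P/= /nu integral_mkcond; apply: eq_integral => t _.
    rewrite patchE indicE -[X t \in A]/(t \in X @^-1` A).
    by case: ifP => _; rewrite ?mule1 ?mule0.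
  - by apply/measurable_EFinP; exact: measurable_funD.
  - by move=> y; rewrite lee_fin.
have Er : \int[m]_t ((h t)%:E * (phi (X t) + B)%:E) =
    \int[m]_t (h t * phi (X t))%:E + B%:E.
  rewrite -[X in _ = _ + X]mule1 -h1 -(integralZl measurableT ih).
  rewrite -(integralD measurableT iphiX (integrableZl measurableT B ih)).
  by apply: eq_integral => t _; rewrite -EFinM mulrDr EFinD [(h _ * B)%R]mulrC EFinM.
by move: E; rewrite (integral_probability_shift P mphi phiB) Er => /(congr1 (fun x => x - B%:E)); rewrite !addeK.
Qed.

End weighted_law.

(** * Estimates in L2 and convergence of the potential *)

Section L2_bounds.
Context {R : realType}.
Notation M := (measurableTypeR R).
Local Notation mu := (@circle_measure R).

Lemma Lnorm2_le_sup (f : M -> R) (eps : R) : measurable_fun [set: M] f -> 0 <= eps ->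
  (forall t : R, 0 <= t < 1 -> `|f t| <= eps) ->
  ('N[mu]_2%:E[EFin \o f] <= eps%:E)%E.
Proof.
move=> mf eps0 feps; rewrite unlock.
have mpow : measurable_fun [set: M] (fun x => (`|f x| `^ 2)%:E).
  apply/measurable_EFinP; apply: (@measurableT_comp _ _ _ _ _ _ (@powR R ^~ 2)) => //.
  exact: measurableT_comp.
have le2 : (\int[mu]_x (`|f x| `^ 2)%:E <= (eps `^ 2)%:E)%E.
  rewrite -[leRHS](integral_probability_cst (@unif R)).
  apply: unif_le_integral => //; [by move=> x; rewrite lee_fin powR_ge0 ..|].
  by move=> x x01; rewrite lee_fin ge0_ler_powR// ?nnegrE// feps.
rewrite [leRHS](_ : _ = ((eps `^ 2)%:E `^ 2^-1)%E); last first.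
  by rewrite poweR_EFin -powRrM mulfV// powRr1.
apply: gt0_ler_poweR => //=; rewrite ?invr_ge0// in_itv/= ?andbT.
- by rewrite leey andbT; apply: integral_ge0 => x _; rewrite lee_fin powR_ge0.
- by rewrite leey andbT lee_fin powR_ge0.
Qed.

Lemma bounded_Lfun2 (f : M -> R) (B : R) : measurable_fun [set: M] f ->
  (forall t : R, 0 <= t < 1 -> `|f t| <= B) -> f \in Lfun mu 2%:E.
Proof.
move=> mf fB; rewrite inE; apply/andP; split; rewrite inE//.
have B0 : 0 <= B by apply: le_trans (fB 0 _) => //; rewrite lexx ltr01.
exact: le_lt_trans (Lnorm2_le_sup mf B0 fB) (ltry _).
Qed.

Lemma L2_class_pi (f : M -> R) (fL : f \in Lfun mu 2%:E) :
  L2_class fL = L2_pi (Lfun_Sub (lee1n 2) fL).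
Proof.
apply: L2_aeP; have := L2_pi_ae (Lfun_Sub (lee1n 2) fL); have := L2_quot_ae fL.
by apply: filterS2 => x h1 h2 _; rewrite h2// h1.
Qed.

(** The circle has mass 1, so the sup norm dominates; convergence of interpolated functions in [L2]
    is always obtained from such uniform estimates. *)
Lemma L2_class_dist (f g : M -> R) (fL : f \in Lfun mu 2%:E) (gL : g \in Lfun mu 2%:E)
    (eps : R) : 0 <= eps ->
  (forall t : R, 0 <= t < 1 -> `|f t - g t| <= eps) ->
  `|L2_class fL - L2_class gL| <= eps.
Proof.
move=> eps0 fg; rewrite !L2_class_pi.
set F := Lfun_Sub _ fL; set G := Lfun_Sub _ gL.
have -> : L2_pi F - L2_pi G = L2_pi (F - G).
  by rewrite -L2_addE -L2_oppE.
have mfg : measurable_fun [set: M] (fun t => f t - g t).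
  by move: (fL) (gL); rewrite !inE => /andP[/[!inE] mf _] /andP[/[!inE] mg _];
    exact: measurable_funB.
have h := Lnorm2_le_sup mfg eps0 fg.
suff -> : `|L2_pi (F - G)| = fine ('N[mu]_2%:E[EFin \o (fun t : M => (f t - g t)%R)])%E.
  rewrite -lee_fin fineK// ge0_fin_numE ?Lnorm_ge0//.
  exact: le_lt_trans h (ltry _).
exact: L2_normE.
Qed.

End L2_bounds.

Section Rintegral_facts.
Context d (T : measurableType d) (R : realType) (m : {measure set T -> \bar R}).

Lemma dominated_cvg_Rintegral (f_ : nat -> T -> R) (f g : T -> R) :
  (forall n, measurable_fun setT (f_ n)) ->
  (forall x, f_ n x @[n --> \oo] --> f x) ->
  m.-integrable setT (EFin \o g) ->
  (forall n x, `|f_ n x| <= g x) ->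
  m.-integrable setT (EFin \o f) /\
  \int[m]_x f_ n x @[n --> \oo] --> \int[m]_x f x.
Proof.
move=> mf_ ff ig fg.
have mf : measurable_fun setT f by apply: (measurable_fun_cvg mf_) => x _; exact: ff.
have [|||||if_ _ cf] := @dominated_convergence _ _ _ m setT measurableT
  (fun n x => (f_ n x)%:E) (fun x => (f x)%:E) (fun x => (g x)%:E).
- by move=> n; exact/measurable_EFinP.
- exact/measurable_EFinP.
- by apply: aeW => x _; apply: cvg_EFin; [exact: nearW|exact: ff].
- exact: ig.
- by apply: aeW => x n _; rewrite lee_fin.
split => //; apply: fine_cvg.
by move: cf; rewrite -[X in _ --> X -> _]fineK//; exact: integrable_fin_num.
Qed.

(** The integral is the difference of those of the positive and negative parts, and +oo - +oo is not
    finite by convention. Applied to [w], whose integral is 1. *)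
Lemma integrable_of_integral_fin_num (f : T -> R) : measurable_fun setT f ->
  (\int[m]_x (f x)%:E \is a fin_num)%E -> m.-integrable setT (EFin \o f).
Proof.
move=> mf; rewrite integralE => h; have mfE : measurable_fun setT (EFin \o f).
  exact/measurable_EFinP.
apply/integrableP; split => //.
have -> : (\int[m]_x `|(f x)%:E| =
    \int[m]_x ((EFin \o f) ^\+ x) + \int[m]_x ((EFin \o f) ^\- x))%E.
  rewrite -ge0_integralD//; [|exact: measurable_funepos|exact: measurable_funeneg].
  by apply: eq_integral => x _; rewrite -[RHS]/((_ \+ _)%E x) -fune_abse.
have : (0 <= \int[m]_x ((EFin \o f) ^\+ x))%E by apply: integral_ge0.
have : (0 <= \int[m]_x ((EFin \o f) ^\- x))%E by apply: integral_ge0.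
by move: h; case: (integral _ _ _) => [r||]; case: (integral _ _ _) => [s||]//= *;
  rewrite ltry.
Qed.

End Rintegral_facts.

Section Rintegral_lebesgue.
Context {R : realType}.
Notation M := (measurableTypeR R).
Local Notation leb := (@lebesgue_measure R).

Lemma Rintegral_lebesgue_affine (a b : R) (f : R -> R) : 0 < a ->
  leb.-integrable setT (EFin \o f) ->
  \int[leb]_x f (a * x + b) = a^-1 * \int[leb]_x f x.
Proof.
move=> a0 intf; have mf := measurable_int _ intf.
rewrite /Rintegral (integralE leb setT (fun x => (f (a * x + b))%:E)).
have -> : (\int[leb]_x ((fun x => (f (a * x + b))%:E) ^\+ x) =
    (a^-1)%:E * \int[leb]_x ((EFin \o f) ^\+ x))%E.
  rewrite -(ge0_integral_lebesgue_affineV b a0 (measurable_funepos mf) (funepos_ge0 _)).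
  by apply: eq_integral => x _; rewrite !funeposE.
have -> : (\int[leb]_x ((fun x => (f (a * x + b))%:E) ^\- x) =
    (a^-1)%:E * \int[leb]_x ((EFin \o f) ^\- x))%E.
  rewrite -(ge0_integral_lebesgue_affineV b a0 (measurable_funeneg mf) (funeneg_ge0 _)).
  by apply: eq_integral => x _; rewrite !funenegE.
rewrite [X in _ = _ * fine X]integralE.
have := integrable_pos_fin_num measurableT intf.
have := integrable_neg_fin_num measurableT intf.
case: (integral _ _ _) => [r||]//= _; case: (integral _ _ _) => [s||]//= _.
by rewrite mulrBr.
Qed.

End Rintegral_lebesgue.

(** * Step functions and Riemann sums *)

Section step_functions.
Context {R : realType}.
Notation M := (measurableTypeR R).
Local Notation leb := (@lebesgue_measure R).
Local Notation unif := (@unif R).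

Lemma step_value N (t : R) : (0 < N)%N -> 0 <= t < 1 ->
  exists i : 'I_N, [/\ i%:R / N%:R <= t, t < i%:R / N%:R + N%:R^-1
    & forall f : N.-tuple R, step f t = tnth f i].
Proof.
move=> N0 /andP[t0 t1]; have NR : 0 < N%:R :> R by rewrite ltr0n.
have Nt0 : 0 <= N%:R * t by rewrite mulr_ge0// ltW.
have /andP[kt tk] := truncn_itv Nt0; set k := Num.truncn _ in kt tk.
have kN : (k < N)%N by rewrite -(ltr_nat R) (le_lt_trans kt)// gtr_pMr.
exists (Ordinal kN); split => [||f] /=.
- by rewrite ler_pdivrMr// mulrC.
- by rewrite -[X in _ + X]mul1r -mulrDl natr1 ltr_pdivlMr// mulrC.
rewrite /step (bigD1 (Ordinal kN))//= indicE mem_set ?mulr1; last first.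
  by rewrite /= in_itv/= ler_pdivrMr// ltr_pdivlMr// mulrC kt tk.
rewrite big1 ?addr0// => j jk; rewrite indicE memNset ?mulr0//=.
rewrite in_itv/= ler_pdivrMr// ltr_pdivlMr// mulrC -truncn_eq// => /eqP kj.
by move: jk; rewrite -val_eqE/= -kj eqxx.
Qed.

Lemma step_out N (f : N.-tuple R) (t : R) : ~~ (0 <= t < 1) -> step f t = 0.
Proof.
move=> t01; rewrite /step big1// => i _; rewrite indicE memNset ?mulr0//=.
rewrite in_itv/= => /andP[it ti]; move/negP: t01; apply; apply/andP; split.
  by rewrite (le_trans _ it)// divr_ge0.
have N0 : (0 < N)%N by exact: leq_ltn_trans (ltn_ord i).
rewrite (lt_le_trans ti)// ler_pdivrMr ?ltr0n// mul1r ler_nat.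
exact: ltn_ord.
Qed.

Lemma step_le N (f : N.-tuple R) (B : R) (t : R) : 0 <= B ->
  (forall i, `|tnth f i| <= B) -> `|step f t| <= B.
Proof.
move=> B0 fB; have [N0|N0] := posnP N.
  move: f fB; rewrite N0 => f fB; rewrite /step big_ord0 normr0//.
have [t01|t01] := boolP (0 <= t < 1); last by rewrite step_out// normr0.
by have [i [_ _ ->]] := step_value N0 t01.
Qed.

Lemma measurable_step N (f : N.-tuple R) : measurable_fun [set: M] (step f).
Proof. by have := step_Lfun f; rewrite inE => /andP[/[!inE]]. Qed.

Lemma unif_cell N (i : 'I_N) :
  unif `[i%:R / N%:R, i.+1%:R / N%:R[%classic = (N%:R^-1)%:E.
Proof.
have N0 : (0 < N)%N by exact: leq_ltn_trans (ltn_ord i).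
have NR : 0 < N%:R :> R by rewrite ltr0n.
rewrite /unif/= /circle_measure /mrestr setIidl; last first.
  move=> t /=; rewrite !in_itv/= => /andP[it ti]; apply/andP; split.
    by rewrite (le_trans _ it)// divr_ge0.
  by rewrite (lt_le_trans ti)// ler_pdivrMr// mul1r ler_nat.
rewrite lebesgue_measure_itv/= lte_fin ltr_pM2r ?invr_gt0// ltr_nat ltnSn.
by rewrite -EFinB -mulrBl -natrB ?leqnSn// subSnn mul1r.
Qed.

(** Turns means over the mesh, whose index set varies with N, into integrals over one fixed space,
    where dominated convergence applies. *)
Lemma Rintegral_step N (f : N.-tuple R) :
  \int[unif]_t step f t = N%:R^-1 * \sum_(i < N) tnth f i.
Proof.
rewrite /Rintegral; pose F i (t : M) : \bar R :=
  ((tnth f i)%:E * (\1_(`[i%:R / N%:R, i.+1%:R / N%:R[%classic : set R) t)%:E)%E.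
have mI (i : 'I_N) : measurable (`[i%:R / N%:R, i.+1%:R / N%:R[%classic : set M).
  exact: measurable_itv.
have iI (i : 'I_N) : unif.-integrable setT (fun t : M =>
    (\1_(`[i%:R / N%:R, i.+1%:R / N%:R[%classic : set R) t)%:E).
  apply: (le_integrable measurableT _ _ (finite_measure_integrable_cst unif 1 measurableT)).
    by apply/measurable_EFinP; exact: measurable_indic.
  by move=> t _ /=; rewrite lee_fin !ger0_norm// indicE; case: (_ \in _).
rewrite (eq_integral (fun t => \sum_(i < N) F i t)%E); last first.
  by move=> t _; rewrite /step -sumEFin.
rewrite integral_sum//; last by move=> i; exact: (integrableZl measurableT).
rewrite (eq_bigr (fun i => (N%:R^-1 * tnth f i)%:E)).
  by rewrite sumEFin/= mulr_sumr.
move=> i _; rewrite integralZl// integral_indic// setIT [(_ * tnth _ _)%R]mulrC EFinM.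
by congr (_ * _)%E; exact: unif_cell.
Qed.

(* The limit [psi] is cut off outside [0, 1), where [step] vanishes. *)
Lemma cvg_mean_step (c : forall N, N.-tuple R) (B : R) (psi : R -> R) :
  (forall N i, `|tnth (c N) i| <= B) ->
  (forall t, 0 <= t < 1 -> step (c N) t @[N --> \oo] --> psi t) ->
  N%:R^-1 * (\sum_(i < N) tnth (c N) i) @[N --> \oo]
    --> \int[unif]_t (psi t * (0 <= (t : R) < 1)%R%:R).
Proof.
move=> cB cpsi; have B0 : 0 <= B by exact: le_trans (cB 1%N ord0).
pose psi' (t : M) := psi t * (0 <= (t : R) < 1)%R%:R.
have cpsi' t : step (c N) t @[N --> \oo] --> psi' t.
  rewrite /psi'; have [t01|t01] := boolP (0 <= (t : R) < 1).
    by rewrite mulr1; exact: cpsi.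
  by rewrite mulr0; under eq_fun do rewrite step_out//; exact: cvg_cst.
have cB' N t : `|step (c N) t| <= B by exact: step_le.
have [_ h] := dominated_cvg_Rintegral (fun N => measurable_step (c N)) cpsi'
  (finite_measure_integrable_cst unif B measurableT) cB'.
by under eq_fun do rewrite -Rintegral_step.
Qed.

End step_functions.

(** * Local averages *)

Section averages.
Context {R : realType}.
Notation M := (measurableTypeR R).
Local Notation leb := (@lebesgue_measure R).

(** For t in [0, 1[ and N > 0, [step (nodes N) t] is the mesh point floor(N t) / N to the left of
    t. *)
Definition nodes N : N.-tuple R := [tuple i%:R / N%:R | i < N].

Lemma node_itv N (i : 'I_N) : 0 <= (node i : R) <= 1.
Proof.
have N0 : (0 < N)%N by exact: leq_ltn_trans (ltn_ord i).
by rewrite divr_ge0//= ler_pdivrMr ?ltr0n// mul1r ler_nat ltnW.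
Qed.

Lemma step_mktuple N (F : R -> R) (t : R) : (0 < N)%N -> 0 <= t < 1 ->
  step [tuple F (node i) | i < N] t = F (step (nodes N) t).
Proof.
move=> N0 t01; have [i [_ _ h]] := step_value N0 t01.
by rewrite !h !tnth_mktuple.
Qed.

Lemma step_nodes_near N (t : R) : (0 < N)%N -> 0 <= t < 1 ->
  `|t - step (nodes N) t| <= N%:R^-1.
Proof.
move=> N0 t01; have [i [h1 h2 ->]] := step_value N0 t01.
by rewrite tnth_mktuple ger0_norm ?subr_ge0// lerBlDl ltW.
Qed.

Lemma cvg_invn : (n%:R^-1 : R) @[n --> \oo] --> (0 : R).
Proof.
apply/(cvgrPdist_le) => e e0; near=> n.
rewrite sub0r normrN ger0_norm// invf_ple ?posrE//; last first.
  by rewrite ltr0n; near: n; exists 1%N.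
by apply: ltW; near: n; exact: nbhs_infty_gtr.
Unshelve. all: by end_near. Qed.

Lemma cvg_step_nodes (t : R) : 0 <= t < 1 -> step (nodes N) t @[N --> \oo] --> t.
Proof.
move=> t01; apply/cvgrPdist_le => e e0.
have /cvgrPdist_le/(_ _ e0) h := cvg_invn; near=> N.
apply: (@le_trans _ _ N%:R^-1).
  by apply: step_nodes_near => //; near: N; exists 1%N.
have : `|0 - N%:R^-1 : R| <= e by near: N.
by rewrite sub0r normrN ger0_norm.
Unshelve. all: by end_near. Qed.

Variable w : R -> R.
Hypothesis mw : measurable_fun [set: M] w.
Hypothesis w1 : (\int[leb]_t (w t)%:E = 1)%E.

Let iw : leb.-integrable setT (EFin \o w).
Proof. by apply: integrable_of_integral_fin_num => //; rewrite w1. Qed.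

(** The local average after the substitution s = N (t - x), at an arbitrary base point: the weight
    no longer varies with N and can dominate. *)
Definition average N (x : R) (h : R -> R) : R := \int[leb]_s (w s * h (x + s / N%:R)).

Lemma integrable_weight (phi : R -> R) (B : R) : measurable_fun [set: M] phi ->
  (forall s, `|phi s| <= B) -> leb.-integrable setT (fun s : M => (w s * phi s)%:E).
Proof.
move=> mphi phiB; apply: (le_integrable measurableT _ _ (integrableZl measurableT B iw)).
  by apply/measurable_EFinP; exact: measurable_funM.
move=> s _ /=; rewrite lee_fin !normrM mulrC ler_wpM2r//.
by rewrite (le_trans (phiB _))// ler_norm.
Qed.

Lemma cvg_weight (phi_ : nat -> R -> R) (phi : R -> R) (B : R) :
  (forall n, measurable_fun [set: M] (phi_ n)) -> (forall n s, `|phi_ n s| <= B) ->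
  (forall s, phi_ n s @[n --> \oo] --> phi s) ->
  \int[leb]_s (w s * phi_ n s) @[n --> \oo] --> \int[leb]_s (w s * phi s).
Proof.
move=> mphi phiB cphi.
have iBw : leb.-integrable setT (EFin \o (fun s : M => `|w s| * B)).
  rewrite (_ : _ \o _ = (fun s => (B%:E * `|(w s)%:E|)%E)).
    by apply: integrableZl => //; exact: integrable_abse.
  by apply/funext => s; rewrite /= -EFinM mulrC.
apply: (proj2 (dominated_cvg_Rintegral _ _ iBw _)).
- by move=> n; exact: measurable_funM.
- by move=> s; apply: cvgM; [exact: cvg_cst|exact: cphi].
- by move=> n s; rewrite normrM ler_wpM2l.
Qed.

Lemma measurable_rescale (h : R -> R) (x : R) N : continuous h ->
  measurable_fun [set: M] (fun s => h (x + s / N%:R)).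
Proof.
move=> ch; apply: continuous_measurable_fun => s; apply: continuous_comp; last exact: ch.
by apply: cvgD; [exact: cvg_cst|apply: cvgMl; exact: cvg_id].
Qed.

Lemma local_averageE N (i : 'I_N) (h : R -> R) (B : R) : continuous h ->
  (forall s, `|h s| <= B) -> local_average w h i = average N (node i) h.
Proof.
move=> ch hB; have N0 : (0 < N)%N by exact: leq_ltn_trans (ltn_ord i).
have NR : 0 < N%:R :> R by rewrite ltr0n.
have iF := integrable_weight (measurable_rescale (node i) N ch) (fun s => hB _).
rewrite /average /local_average.
have := Rintegral_lebesgue_affine (- (N%:R * node i)) NR iF.
move=> /(congr1 ( *%R N%:R)); rewrite mulVKf ?gt_eqF// => <-.
congr (_ * _); apply: eq_Rintegral => s _ /=.
rewrite -mulrBr; congr (_ * h _).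
by rewrite mulrC mulKf ?gt_eqF// addrC subrK.
Qed.

(** The functions are assumed to converge continuously because they are evaluated at the moving
    points x_n + s/n; the limit is h x times the integral of [w], which is 1. *)
Lemma cvg_average (h_ : nat -> R -> R) (h : R -> R) (x_ : nat -> R) (x B : R) :
  (forall n, continuous (h_ n)) -> (forall n s, `|h_ n s| <= B) ->
  (forall y_ y, y_ n @[n --> \oo] --> y -> h_ n (y_ n) @[n --> \oo] --> h y) ->
  x_ n @[n --> \oo] --> x ->
  average n (x_ n) (h_ n) @[n --> \oo] --> h x.
Proof.
move=> ch hB hh xx.
have -> : h x = \int[leb]_s (w s * h x).
  rewrite (RintegralZr _ measurableT iw).
  by rewrite /Rintegral w1 mul1r.
apply: (cvg_weight (phi := cst (h x)) (B := B)).
- by move=> n; exact: measurable_rescale.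
- by move=> n s; exact: hB.
- move=> s; apply: hh; rewrite -[X in _ --> X]addr0; apply: cvgD => //.
  by rewrite -[X in _ --> X](mulr0 s); apply: cvgM; [exact: cvg_cst|exact: cvg_invn].
Qed.

End averages.

(** * Continuity and convergence of the potential *)

Section continuity.
Context {R : realType}.

Lemma seq_bounded (V : normedModType R) (u_ : nat -> V) (u : V) :
  u_ n @[n --> \oo] --> u -> exists B : R, forall n, `|u_ n| <= B.
Proof.
move=> cu; have /cvg_seq_bounded : cvgn u_ by apply/cvg_ex; exists u.
by move=> [B [_ hB]]; exists (B + 1) => n; apply: (hB (B + 1)); rewrite ?ltrDl ?ltr01.
Qed.

Lemma circle_bounded (f : R -> R) : circle_continuous f -> exists B, forall t, `|f t| <= B.
Proof.
move=> [cf pf].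
have pfn n t : f (t + n%:R) = f t.
  by elim: n => [|n IH]; rewrite ?addr0// -natr1 addrA pf.
have pfz (z : int) t : f (t + z%:~R) = f t.
  case: z => n; first exact: pfn.
  by rewrite NegzE -(pfn n.+1) mulrNz subrK.
have cpt : compact (f @` `[0, 1]%classic).
  apply: continuous_compact; last exact: segment_compact.
  exact: continuous_subspaceT.
have [B [_ hB]] := compact_bounded cpt.
exists (B + 1) => t; rewrite -[t](subrK (Num.floor t)%:~R) pfz.
apply: (hB (B + 1)) => /=; first by rewrite ltrDl ltr01.
exists (t - (Num.floor t)%:~R) => //=; rewrite in_itv/=.
have /andP[h1 h2] := floor_itv t; rewrite subr_ge0 h1/= lerBlDl ltW//.
by rewrite (lt_le_trans h2)// intrD addrC.
Qed.

Definition locally_lipschitz3 (F : R -> R -> R -> R) := forall x : R * R * R,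
  exists2 U : set (R * R * R), nbhs x U & [lipschitz F y.1.1 y.1.2 y.2 | y in U].

Variable Phi : R -> R -> R -> R.
Hypothesis lPhi : locally_lipschitz3 Phi.

Lemma continuous_Phi : continuous (fun x : R * R * R => Phi x.1.1 x.1.2 x.2).
Proof.
move=> x; have [U nU [k [_ hk]]] := lPhi x.
(* The Lipschitz property holds for all constants above the threshold [k]; this one is moreover
   positive. *)
have {hk} hk := hk (`|k| + 1) (ltr_pwDr ltr01 (ler_norm _)).
have k0 : 0 < `|k| + 1 by rewrite ltr_wpDl.
apply/cvgrPdist_le => e e0; near=> y.
apply: le_trans (hk (x, y) _) _.
  by split => /=; [exact: nbhs_singleton|near: y; exact: nU].
rewrite /= -ler_pdivlMl//; near: y.
by apply: cvgr_dist_le; [exact: cvg_id|rewrite mulr_gt0// invr_gt0].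
Unshelve. all: by end_near. Qed.

Lemma cvg_Phi (p_ v_ t_ : nat -> R) (p v t : R) :
  p_ n @[n --> \oo] --> p -> v_ n @[n --> \oo] --> v -> t_ n @[n --> \oo] --> t ->
  Phi (p_ n) (v_ n) (t_ n) @[n --> \oo] --> Phi p v t.
Proof.
move=> hp hv ht.
apply/cvgrPdist_le => e e0.
have /cvgrPdist_le/(_ _ e0)/nbhs_ballP[d /= d0 hd] := @continuous_Phi (p, v, t).
have hp' : \forall n \near \oo, `|p - p_ n| < d by move/cvgrPdist_lt : hp; exact.
have hv' : \forall n \near \oo, `|v - v_ n| < d by move/cvgrPdist_lt : hv; exact.
have ht' : \forall n \near \oo, `|t - t_ n| < d by move/cvgrPdist_lt : ht; exact.
near=> n; apply: (hd (p_ n, v_ n, t_ n)).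
have np : `|p - p_ n| < d by near: n.
have nv : `|v - v_ n| < d by near: n.
have nt : `|t - t_ n| < d by near: n.
by [].
Unshelve. all: by end_near. Qed.

Lemma Phi_bounded (A : R) : exists B, forall p v t,
  `|p| <= A -> `|v| <= A -> `|t| <= A -> `|Phi p v t| <= B.
Proof.
pose I := `[- A, A]%classic : set R.
have cI : compact I by exact: segment_compact.
have cpt : compact ((fun x : R * R * R => Phi x.1.1 x.1.2 x.2) @` (I `*` I `*` I)).
  apply: continuous_compact; last by do 2 apply: compact_setX => //.
  exact: continuous_subspaceT continuous_Phi.
have [B [_ hB]] := compact_bounded cpt.
exists (B + 1) => p v t pA vA tA.
apply: (hB (B + 1)) => /=; first by rewrite ltrDl ltr01.
exists (p, v, t) => //=.
by rewrite /I/= !in_itv/= -!ler_norml.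
Qed.

End continuity.

Section potential.
Context {R : realType}.
Notation M := (measurableTypeR R).
Local Notation leb := (@lebesgue_measure R).
Local Notation unif := (@unif R).
Variables (K : L2 R -> R -> R) (g w : R -> R) (Phi : R -> R -> R -> R) (tau : R).
Hypothesis bK : bounded_L2_C K.
Hypothesis cg : circle_continuous g.
Hypothesis mw : measurable_fun [set: M] w.
Hypothesis w1 : (\int[leb]_t (w t)%:E = 1)%E.
Hypothesis lPhi : locally_lipschitz3 Phi.

Let iw : leb.-integrable setT (EFin \o w).
Proof. by apply: integrable_of_integral_fin_num => //; rewrite w1. Qed.

Lemma operator_bound : exists2 C : R, 0 <= C & (forall u t, `|K u t| <= C * `|u|) /\
  (forall u v t, `|K u t - K v t| <= C * `|u - v|).
Proof.
have [linK _ [C hC]] := bK; exists `|C|; first exact: normr_ge0.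
have hC' u t : `|K u t| <= `|C| * `|u|.
  by rewrite (le_trans (hC _ _))// ler_wpM2r// ler_norm.
split => // u v t; have -> : K u t - K v t = K (u - v) t.
  by have := linK (- 1) v u t; rewrite (scaleN1r v) mulN1r (addrC (- v) u) => ->; rewrite addrC.
exact: hC'.
Qed.

(** The operator bound is uniform in the point, which handles [u_] at moving points; continuity of
    [K u] handles the points themselves. *)
Lemma cvg_operator (u_ : nat -> L2 R) (u : L2 R) (y_ : nat -> R) (y : R) :
  u_ n @[n --> \oo] --> u -> y_ n @[n --> \oo] --> y ->
  K (u_ n) (y_ n) @[n --> \oo] --> K u y.
Proof.
move=> cu cy; have [C C0 [_ hC]] := operator_bound.
have [_ cK _] := bK; have [cKu _] := cK u.
have h1 : K u (y_ n) @[n --> \oo] --> K u y by apply: continuous_cvg cy; exact: cKu.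
have h2 : K (u_ n) (y_ n) - K u (y_ n) @[n --> \oo] --> (0 : R).
  apply/norm_cvg0P; apply: (@squeeze_cvgr _ _ _ _ (cst 0) (fun n => C * `|u_ n - u|)).
  - by apply: nearW => n; rewrite normr_ge0/=.
  - exact: cvg_cst.
  - rewrite -[X in _ --> X](mulr0 C); apply: cvgM; first exact: cvg_cst.
    by apply/norm_cvg0P; exact/subr_cvg0.
exact: (cvg_sub0 (f := fun n => K (u_ n) (y_ n)) (g := fun n => K u (y_ n)) h2 h1).
Qed.

Lemma average_le N x (h : R -> R) (B : R) : continuous h -> (forall s, `|h s| <= B) ->
  `|average w N x h| <= (\int[leb]_s `|w s|) * B.
Proof.
move=> ch hB; have iF := integrable_weight mw w1 (measurable_rescale x N ch) (fun s => hB _).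
have iaw : leb.-integrable setT (EFin \o (fun s => `|w s|)).
  by have := integrable_abse iw.
rewrite (le_trans (le_normr_Rintegral measurableT iF))//.
rewrite -(RintegralZr _ measurableT iaw); apply: le_Rintegral => //.
- by have := integrable_abse iF.
- rewrite (_ : _ \o _ = (fun s => (B%:E * `|(w s)%:E|)%E)).
    by apply: integrableZl => //; exact: integrable_abse.
  by apply/funext => s; rewrite /= -EFinM mulrC.
- by move=> s _; rewrite normrM ler_wpM2l.
Qed.

Lemma interp_dist N (f f' : N.-tuple R) (e : R) : 0 <= e ->
  (forall i, `|tnth f i - tnth f' i| <= e) -> `|interp f - interp f'| <= e.
Proof.
move=> e0 fe; apply: L2_class_dist => // t t01.
have [N0|N0] := posnP N.
  by move: f f' fe; rewrite N0 => f f' _; rewrite /step !big_ord0 subrr normr0.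
by have [i [_ _ h]] := step_value N0 t01; rewrite !h.
Qed.

Lemma cvg_interp N (f_ : nat -> N.-tuple R) (f : N.-tuple R) :
  (forall i, tnth (f_ n) i @[n --> \oo] --> tnth f i) ->
  interp (f_ n) @[n --> \oo] --> interp f.
Proof.
move=> cf; apply/subr_cvg0/norm_cvg0P.
apply: (@squeeze_cvgr _ _ _ _ (cst 0)
  (fun n => \sum_(i < N) `|tnth (f_ n) i - tnth f i|)).
- apply: nearW => n; rewrite normr_ge0/=; apply: interp_dist => [|i].
    exact: sumr_ge0.
  by rewrite (bigD1 i)//= lerDl sumr_ge0.
- exact: cvg_cst.
- have : \sum_(i < N) `|tnth (f_ n) i - tnth f i| @[n --> \oo] --> \sum_(i < N) (0 : R).
    by apply: cvg_sumr => i; apply/norm_cvg0P/subr_cvg0; exact: cf.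
  by rewrite big1.
Qed.

Let continuousK u : continuous (K u).
Proof. by have [_ h _] := bK; have [] := h u. Qed.

Lemma K_E N (f : N.-tuple R) i : K_ K w f i = average w N (node i) (K (interp f)).
Proof.
have [C C0 [hC _]] := operator_bound.
exact: (local_averageE mw w1 i (@continuousK (interp f)) (hC _)).
Qed.

Lemma g_E N (i : 'I_N) : g_ g w i = average w N (node i) g.
Proof.
have [B hB] := circle_bounded cg.
exact: (local_averageE mw w1 i cg.1 hB).
Qed.

Lemma cvg_Psi_fixed N (f_ : nat -> N.-tuple R) (f : N.-tuple R) :
  (forall i, tnth (f_ n) i @[n --> \oo] --> tnth f i) ->
  Psi K g w Phi tau (f_ n) @[n --> \oo] --> Psi K g w Phi tau f.
Proof.
move=> cf; apply: cvgM; first exact: cvg_cst.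
apply: cvg_sumr => i; apply: cvg_Phi => //; [|exact: cvg_cst|exact: cvg_cst].
under eq_fun do rewrite K_E; rewrite K_E.
have ci := cvg_interp cf.
have [C C0 [hC _]] := operator_bound; have [B hB] := seq_bounded ci.
apply: (cvg_weight mw w1 (B := C * B)).
- by move=> n; exact: measurable_rescale.
- by move=> n s; rewrite (le_trans (hC _ _))// ler_wpM2l.
- by move=> s; apply: cvg_operator => //; exact: cvg_cst.
Qed.

(** The sum is the mean of a step function whose value at t is [Phi] at averages based at the mesh
    point left of t. These averages converge to K u t and g t, and they stay in a compact set, where
    [Phi] is bounded. *)
Lemma cvg_Psi (f_ : forall N, N.-tuple R) (u : L2 R) :
  interp (f_ N) @[N --> \oo] --> u ->
  Psi K g w Phi tau (f_ N) @[N --> \oo] -->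
    tau * \int[unif]_t (Phi (K u t) (g t) t * (0 <= (t : R) < 1)%R%:R).
Proof.
move=> cu; have [C C0 [hC _]] := operator_bound; have [B hB] := seq_bounded cu.
have [G hG] := circle_bounded cg.
have hCB n s : `|K (interp (f_ n)) s| <= C * B.
  by rewrite (le_trans (hC _ _))// ler_wpM2l.
set W := \int[leb]_s `|w s|.
(* 1 bounds the nodes, the other two terms bound the averages of K u and of g. *)
have [P hP] := Phi_bounded lPhi (Num.max 1 (Num.max (W * (C * B)) (W * G))).
pose c N : N.-tuple R :=
  [tuple Phi (average w N (node i) (K (interp (f_ N)))) (average w N (node i) g) (node i)
  | i < N].
under eq_fun => N.
  rewrite /Psi -mulrA (_ : \sum_(i < N) _ = \sum_(i < N) tnth (c N) i); last first.
    by apply: eq_bigr => i _; rewrite tnth_mktuple K_E g_E.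
  over.
apply: cvgM; first exact: cvg_cst.
apply: (cvg_mean_step (B := P)) => [N i|t t01].
  rewrite tnth_mktuple; apply: hP.
  - by rewrite !le_max (average_le _ _ (@continuousK _) (hCB _)) !orbT.
  - by rewrite !le_max (average_le _ _ cg.1 hG) !orbT.
  - by have /andP[i0 i1] := @node_itv R _ i; rewrite le_max ger0_norm// i1.
have -> : (step (c N) t @[N --> \oo] --> Phi (K u t) (g t) t) =
  (Phi (average w N (step (nodes N) t) (K (interp (f_ N))))
    (average w N (step (nodes N) t) g) (step (nodes N) t) @[N --> \oo] -->
    Phi (K u t) (g t) t).
  apply: propext; split; apply: cvg_trans; apply: near_eq_cvg; near=> N;
    rewrite (step_mktuple (fun x => Phi (average w N x (K (interp (f_ N))))
      (average w N x g) x))//; near: N; by exists 1%N.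
have cn := cvg_step_nodes t01.
apply: cvg_Phi => //.
- apply: (cvg_average mw w1 (B := C * B)) => // y_ y yy.
  exact: cvg_operator.
- apply: (cvg_average mw w1 (h_ := fun=> g) (B := G)) => // [n|y_ y yy].
    exact: cg.1.
  by apply: continuous_cvg yy; exact: cg.1.
Unshelve. all: by end_near. Qed.

Lemma Psi_ge N (f : N.-tuple R) (c : R) : 0 <= tau -> 0 <= c ->
  (forall i, - c <= Phi (K_ K w f i) (g_ g w i) (node i)) ->
  - (tau * c) <= Psi K g w Phi tau f.
Proof.
move=> tau0 c0 hc; have [N0|N0] := posnP N.
  move: f hc; rewrite N0 => f _; rewrite /Psi big_ord0 mulr0 oppr_le0 mulr_ge0//.
have NR : 0 < N%:R :> R by rewrite ltr0n.
rewrite /Psi -mulrA -mulrN ler_wpM2l// ler_pdivlMl//.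
rewrite (_ : N%:R * - c = \sum_(i < N) - c); first exact: ler_sum.
by rewrite sumr_const card_ord mulr_natl.
Qed.

End potential.

(** * Limits of the sampled loops *)

Section loop_limit.
Context {R : realType}.
Notation M := (measurableTypeR R).
Local Notation unif := (@unif R).
Variable kappa : R.
Local Notation c := ((Num.sqrt kappa)^-1).
Local Notation loop := (loop kappa).
Local Notation loop_mean := (loop_mean kappa).
Local Notation loop_list := (loop_list kappa).

(** Total on lists, missing entries being read as 0, so that no proof about the length is
    carried. *)
Definition tuple_of_list N (l : seq R) : N.-tuple R := [tuple nth 0 l i | i < N].

Lemma loop_equicontinuous e (eps : R) : 0 < eps -> \forall N \near \oo,
  forall x t, x <= t <= x + N%:R^-1 -> `|loop e t - loop e x| <= eps.
Proof.
move=> eps0; have [C hC] := brownian_modulus e.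
(* Modulus over a time 2^-n: the first term comes from the path, the second from its linear drift.
   It applies as soon as N >= 2^n. *)
pose r n : R := `|c| * (C * (9 / 10) ^+ n + 2^-1 ^+ n * `|brownian e 1|).
have r0 : r n @[n --> \oo] --> (0 : R).
  have : r n @[n --> \oo] --> `|c| * (C * 0 + 0 * `|brownian e 1|).
    apply: cvgM; first exact: cvg_cst.
    apply: cvgD; apply: cvgM; [exact: cvg_cst| |exact: cvg_pow_half|exact: cvg_cst].
    by apply: cvg_expr; rewrite ger0_norm; lra.
  by rewrite mulr0 mul0r addr0 mulr0.
move/cvgrPdist_le : r0 => /(_ _ eps0)[n _ /(_ n (leqnn n))].
rewrite /= sub0r normrN => rn.
near=> N => x t /andP[xt tx]; apply: le_trans rn; rewrite (le_trans _ (ler_norm _))//.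
rewrite /loop -mulrBr normrM ler_wpM2l//.
have p2 : 0 < 2 ^+ n :> R by rewrite exprn_gt0.
have N2 : N%:R^-1 <= 2^-1 ^+ n :> R.
  rewrite exprVn lef_pV2 ?posrE//.
    by rewrite -natrX ler_nat; near: N; exact: nbhs_infty_ge.
  by rewrite ltr0n; near: N; exists 1%N.
have tx2 : t <= x + 2^-1 ^+ n by rewrite (le_trans tx)// lerD2l.
rewrite (_ : _ - _ = (brownian e t - brownian e x) - (t - x) * brownian e 1); last by ring.
rewrite (le_trans (ler_normB _ _))// lerD//.
  by apply: hC; rewrite xt -exprVn tx2.
by rewrite normrM ler_wpM2r// ger0_norm ?subr_ge0// lerBlDl.
Unshelve. all: by end_near. Qed.

Lemma loop_bounded e : exists B : R, forall t, 0 <= t <= 1 -> `|loop e t| <= B.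
Proof.
have cpt : compact (loop e @` `[0, 1]%classic).
  apply: continuous_compact; last exact: segment_compact.
  apply: continuous_subspaceT; exact: loop_continuous.
have [B [_ hB]] := compact_bounded cpt.
exists (B + 1) => t t01; apply: (hB (B + 1)) => /=; first by rewrite ltrDl ltr01.
by exists t => //=; rewrite in_itv.
Qed.

Lemma cvg_loop_mean e : exists m : R, loop_mean N e @[N --> \oo] --> m.
Proof.
have [B hB] := loop_bounded e; pose c N : N.-tuple R := [tuple loop e (node i) | i < N].
eexists; rewrite (_ : (fun N => _) = (fun N => N%:R^-1 * \sum_(i < N) tnth (c N) i)).
  apply: (cvg_mean_step (B := B)) => [N i|t t01].
    rewrite tnth_mktuple; exact: hB _ (@node_itv R _ i).
  apply: (@cvg_trans _ (loop e (step (nodes N) t) @[N --> \oo])).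
    apply: near_eq_cvg; near=> N; rewrite step_mktuple//.
    by near: N; exists 1%N.
  apply: continuous_cvg (cvg_step_nodes t01); exact: loop_continuous.
apply/funext => N; rewrite /loop_mean; congr (_ * _).
by apply: eq_bigr => i _; rewrite tnth_mktuple.
Unshelve. all: by end_near. Qed.

(** The limit is the class of t -> p.1 + loop(t) - m, with m the limit of the discrete means. The
    interpolation samples the loop at the left end of each cell, so [loop_equicontinuous] gives
    uniform convergence. *)
Lemma cvg_interp_loop (p : M * (M * M)) : exists u : L2 R,
  interp (tuple_of_list N (loop_list N p)) @[N --> \oo] --> u.
Proof.
have [m hm] := cvg_loop_mean p.2; have [B hB] := loop_bounded p.2.
pose f (t : M) : R := (p.1 : R) + (loop p.2 t - m).
have mf : measurable_fun [set: M] f.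
  apply: continuous_measurable_fun => t; apply: cvgD; first exact: cvg_cst.
  by apply: cvgB; [exact: loop_continuous|exact: cvg_cst].
have fB (t : R) : 0 <= t < 1 -> `|f t| <= `|p.1 : R| + (B + `|m|).
  move=> /andP[t0 t1]; rewrite (le_trans (ler_normD _ _))// lerD2l.
  rewrite (le_trans (ler_normB _ _))// lerD2r.
  by apply: hB; rewrite t0 ltW.
have fL := bounded_Lfun2 mf fB.
exists (L2_class fL); apply/cvgrPdist_le => eps eps0.
have e2 : 0 < eps / 2 by rewrite divr_gt0.
have leq2 := loop_equicontinuous p.2 e2.
move/cvgrPdist_le : hm => /(_ _ e2) hm.
near=> N; have N0 : (0 < N)%N by near: N; exists 1%N.
apply: L2_class_dist => [|t t01]; first exact: ltW.
have [i [ti it ->]] := step_value N0 t01.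
rewrite tnth_mktuple nth_mkseq// /f.
set x := i%:R / N%:R in ti it *.
rewrite (_ : _ - _ = (loop p.2 t - loop p.2 x) - (m - loop_mean N p.2)); last by ring.
rewrite (le_trans (ler_normB _ _))// [leRHS](splitr eps) lerD//.
  have hN : forall x t, x <= t <= x + N%:R^-1 -> `|loop p.2 t - loop p.2 x| <= eps / 2.
    by near: N.
  by apply: hN; rewrite ti ltW.
by near: N.
Unshelve. all: by end_near. Qed.

End loop_limit.

(** * Convergence of the Gibbs measures *)

Section tuple_continuity.
Context {R : realType}.

Definition tuple_continuous N (F : N.-tuple R -> R) := forall f_ f,
  (forall i, tnth (f_ n) i @[n --> \oo] --> tnth f i) -> F (f_ n) @[n --> \oo] --> F f.

Lemma tuple_of_listK N (f : N.-tuple R) : tuple_of_list N f = f.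
Proof. by apply: eq_from_tnth => i; rewrite tnth_mktuple (tnth_nth 0). Qed.

Lemma tuple_continuous_list N (F : N.-tuple R -> R) : tuple_continuous F ->
  list_continuous N (F \o tuple_of_list N).
Proof.
move=> cF u v su sv uv; apply: cF => i; rewrite tnth_mktuple.
by under eq_fun do rewrite tnth_mktuple; exact: uv.
Qed.

Lemma tuple_continuous_list_measurable N (F : N.-tuple R -> R) : tuple_continuous F ->
  list_measurable N (fun l => (F (tuple_of_list N l))%:E).
Proof. by move=> /tuple_continuous_list/list_continuous_measurable. Qed.

Lemma tuple_continuous_measurable N (F : N.-tuple R -> R) : tuple_continuous F ->
  measurable_fun setT F.
Proof.
move=> /tuple_continuous_list_measurable/measurable_EFinP.
by under eq_fun do rewrite tuple_of_listK.
Qed.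

Lemma tuple_continuous_interp N (phi : L2 R -> R) : continuous phi ->
  tuple_continuous (fun f : N.-tuple R => phi (interp f)).
Proof. by move=> cphi f_ f cf; apply: continuous_cvg (cvg_interp cf); exact: cphi. Qed.

Lemma measurable_interp N :
  measurable_fun [set: N.-tuple R] (@interp R N : N.-tuple R -> borel (L2 R)).
Proof.
apply: measurable_borel => phi cphi.
exact: tuple_continuous_measurable (tuple_continuous_interp cphi).
Qed.

Lemma continuous_measurable_borel (V : normedModType R) (phi : V -> R) :
  continuous phi -> measurable_fun [set: borel V] (phi : borel V -> R).
Proof.
move=> cphi.
apply: (@measurability _ _ (borel V) _ setT phi (@RGenOInfty.G R) (RGenOInfty.measurableE R)).
move=> _ [_ [x ->] <-]; rewrite setTI; apply: sub_sigma_algebra.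
by apply: open_comp => // y _; exact: cphi.
Qed.

End tuple_continuity.

Lemma Rintegral_gt0 d (T : measurableType d) (R : realType)
    (m : {measure set T -> \bar R}) (f : T -> R) :
  m setT != 0%E -> (forall x, 0 < f x) -> m.-integrable setT (EFin \o f) ->
  0 < \int[m]_x f x.
Proof.
move=> m0 f0 intf; rewrite lt_neqAle Rintegral_ge0 ?andbT; last by move=> x _; exact: ltW.
apply/eqP => if0; move/eqP: m0; apply.
have mf := measurable_int _ intf.
have abs0 : (\int[m]_x `|(EFin \o f) x| = 0)%E.
  under eq_integral do rewrite gee0_abs ?lee_fin ?ltW//.
  rewrite -[LHS](fineK (integrable_fin_num measurableT intf)).
  by congr (_%:E); exact/esym.
have /(ae_eq_integral_abs _ measurableT mf).1 : (\int[m]_x `|(EFin \o f) x| = 0)%E by [].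
move=> [A [mA A0 hA]]; apply/eqP; rewrite -measure_le0 -A0; apply: le_measure; rewrite ?inE//.
by move=> x _; apply: hA => /= /(_ I) [] fx0; move: (f0 x); rewrite fx0 ltxx.
Qed.

(** * Gibbs measures as weighted laws of loops *)

Section gibbs_convergence.
Context {R : realType}.
Notation M := (measurableTypeR R).
Local Notation leb := (@lebesgue_measure R).
Local Notation noise := (@noise R).
Variables (K : L2 R -> R -> R) (g w : R -> R) (Phi : R -> R -> R -> R).
Variables (tau kappa c : R) (N1 : nat).
Hypothesis tau0 : 0 < tau.
Hypothesis kappa0 : 0 < kappa.
Hypothesis c0 : 0 <= c.
Hypothesis bK : bounded_L2_C K.
Hypothesis cg : circle_continuous g.
Hypothesis mw : measurable_fun [set: M] w.
Hypothesis w1 : (\int[leb]_t (w t)%:E = 1)%E.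
Hypothesis lPhi : locally_lipschitz3 Phi.
Hypothesis Phi_ge : forall N, (N1 <= N)%N -> forall (f : N.-tuple R) (i : 'I_N),
  - c <= Phi (K_ K w f i) (g_ g w i) (node i).
Local Notation Psi := (Psi K g w Phi tau).
Local Notation Psi_full := (Psi_full K g w Phi tau kappa).

Definition mean_square N (f : N.-tuple R) : R := N%:R^-1 * \sum_(i < N) tnth f i ^+ 2.

Definition weight N (f : N.-tuple R) : R := expR (- (Psi f + kappa / 2 * mean_square f)).

Lemma Psi_fullE N (f : N.-tuple R) : (0 < N)%N ->
  expR (- Psi_full f) = expR (- (kappa * N%:R / 2 * loop_energy N f)) * weight f.
Proof.
move=> N0; have NR : N%:R != 0 :> R by rewrite pnatr_eq0 -lt0n.
rewrite /weight -expRD; congr expR; rewrite -opprD; congr (- _).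
rewrite /Psi_full [RHS]addrC -addrA; congr (_ + _).
rewrite big_split/= mulrDr; congr (_ + _).
  by rewrite /mean_square mulrA; congr (_ * _); field.
rewrite /loop_energy !mulr_sumr; apply: eq_bigr => i _.
by rewrite /D_ !(tnth_nth 0)/=; field.
Qed.

Lemma mean_square_ge0 N (f : N.-tuple R) : 0 <= mean_square f.
Proof. by rewrite mulr_ge0// sumr_ge0// => i _; rewrite sqr_ge0. Qed.

(** Stated for any lower bound [s] of the mean square: 0 gives boundedness for fixed N, and the
    square of the base point gives the integrable envelope. *)
Lemma weight_le N (f : N.-tuple R) (s : R) : (N1 <= N)%N -> s <= mean_square f ->
  weight f <= expR (tau * c) * expR (- (kappa / 2 * s)).
Proof.
move=> NN sf; rewrite -expRD ler_expR opprD lerD//.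
  by rewrite lerNl; apply: Psi_ge; [exact: ltW| |exact: Phi_ge].
by rewrite lerN2 ler_wpM2l// divr_ge0// ltW.
Qed.

Lemma weight_bound N (f : N.-tuple R) : (N1 <= N)%N -> 0 <= weight f <= expR (tau * c).
Proof.
move=> NN; rewrite expR_ge0 (le_trans (weight_le NN (mean_square_ge0 f)))//.
by rewrite mulr0 oppr0 expR0 mulr1.
Qed.

Lemma tuple_continuous_weight N : tuple_continuous (@weight N).
Proof.
move=> f_ f cf; apply: continuous_cvg; first exact: continuous_expR.
apply: cvgN; apply: cvgD; first exact: cvg_Psi_fixed.
apply: cvgM; first exact: cvg_cst.
apply: cvgM; first exact: cvg_cst.
apply: cvg_sumr => i; rewrite expr2; under eq_fun do rewrite expr2.
by apply: cvgM; exact: cf.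
Qed.

Lemma tuple_continuous_density N : (0 < N)%N ->
  tuple_continuous (fun f : N.-tuple R => expR (- Psi_full f)).
Proof.
move=> N0 f_ f cf; rewrite Psi_fullE//; under eq_fun do rewrite Psi_fullE//.
apply: cvgM; last exact: tuple_continuous_weight.
apply: continuous_cvg; first exact: continuous_expR.
apply: cvgN; apply: cvgM; first exact: cvg_cst.
apply: cvg_sumr => i; rewrite expr2; under eq_fun do rewrite expr2.
have hN (j : nat) : (j < N)%N -> nth 0 (f_ n) j @[n --> \oo] --> nth 0 f j.
  move=> jN; have := cf (Ordinal jN); rewrite (tnth_nth 0)/=.
  by under eq_fun do rewrite (tnth_nth 0)/=.
by apply: cvgM; apply: cvgB; apply: hN; rewrite ?ltn_mod.
Qed.

Definition loop_interp N (p : M * (M * M)) : L2 R :=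
  interp (tuple_of_list N (loop_list kappa N p)).

Definition loop_weight N (p : M * (M * M)) : R :=
  weight (tuple_of_list N (loop_list kappa N p)).

(** The gradient energy is absorbed into the law of the loop by [loop_law]. [C] is independent of
    [phi], so the case of constant [phi] gives the normalisation with the same [C]. *)
Lemma gibbs_integral N : (0 < N)%N -> (N1 <= N)%N -> exists2 C : R, 0 < C &
  forall (phi : L2 R -> R) (B : R), continuous phi -> (forall u, 0 <= phi u <= B) ->
  (\int[lebesgue_tuple R N]_f (expR (- Psi_full f) * phi (interp f))%:E =
   C%:E * \int[leb \x noise]_p (loop_weight N p * phi (loop_interp N p))%:E)%E.
Proof.
move=> N0 NN; have [C C0 hC] := loop_law kappa0 N0; exists C => // phi B cphi phiB.
pose F (f : N.-tuple R) : R := weight f * phi (interp f).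
have cF : tuple_continuous F.
  move=> f_ f cf; apply: cvgM; first exact: tuple_continuous_weight.
  exact: tuple_continuous_interp.
pose H (l : seq R) := F (tuple_of_list N l).
have mH : list_measurable N (fun l => (H l)%:E) by exact: tuple_continuous_list_measurable.
have HB l : 0 <= H l <= expR (tau * c) * B.
  have /andP[w0 wB] := weight_bound (tuple_of_list N l) NN.
  have /andP[p0 pB] := phiB (interp (tuple_of_list N l)).
  by rewrite /H /F mulr_ge0//= ler_pM.
rewrite -(hC H _ mH (tuple_continuous_list cF) HB) -ge0_integral_lebesgue_tuple.
- apply: eq_integral => f _.
  by rewrite Psi_fullE// /H /F tuple_of_listK -EFinM mulrA.
- apply: emeasurable_funM => //.
  apply/measurable_EFinP; apply: measurableT_comp => //; apply: measurableT_comp => //.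
  by apply: measurable_funM => //; exact: measurable_loop_energy.
- by move=> l; rewrite mule_ge0// lee_fin ?expR_ge0//; have /andP[] := HB l.
Qed.

Local Notation loop_tuple N p := (tuple_of_list N (loop_list kappa N p)).

Lemma tnth_loop N p (i : 'I_N) : tnth (loop_tuple N p) i =
  (p.1 : R) + (loop kappa p.2 (node i) - loop_mean kappa N p.2).
Proof. by rewrite tnth_mktuple nth_mkseq. Qed.

(* The fluctuation has zero mean, so it can only increase the mean square. *)
Lemma mean_square_loop_ge N (p : M * (M * M)) : (0 < N)%N ->
  (p.1 : R) ^+ 2 <= mean_square (loop_tuple N p).
Proof.
move=> N0; have NR : 0 < N%:R :> R by rewrite ltr0n.
rewrite /mean_square ler_pdivlMl//.
pose b (i : 'I_N) := loop kappa p.2 (node i) - loop_mean kappa N p.2.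
have b0 : \sum_(i < N) b i = 0.
  rewrite /b big_split/= sumr_const card_ord -[X in _ + X]mulr_natl mulrN.
  by rewrite /loop_mean mulVKf ?gt_eqF// subrr.
rewrite (eq_bigr (fun i => (p.1 : R) ^+ 2 + 2 * p.1 * b i + b i ^+ 2)); last first.
  by move=> i _; rewrite tnth_loop -/(b i); ring.
rewrite big_split big_split/= -(mulr_sumr _ _ b) b0 mulr0 addr0 sumr_const card_ord mulr_natl lerDl.
by apply: sumr_ge0 => i _; exact: sqr_ge0.
Qed.

Lemma cvg_mean_square_loop (p : M * (M * M)) : exists s : R,
  mean_square (loop_tuple N p) @[N --> \oo] --> s.
Proof.
have [m hm] := cvg_loop_mean kappa p.2; have [B hB] := loop_bounded kappa p.2.
have [B' hB'] := seq_bounded hm.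
pose F N x := ((p.1 : R) + (loop kappa p.2 x - loop_mean kappa N p.2)) ^+ 2.
pose s N : N.-tuple R := [tuple F N (node i) | i < N].
eexists; rewrite (_ : (fun N => _) = (fun N => N%:R^-1 * \sum_(i < N) tnth (s N) i)).
  apply: (cvg_mean_step (B := (`|p.1 : R| + (B + B')) ^+ 2)) => [N i|t t01].
    rewrite tnth_mktuple /F normrX lerXn2r ?nnegrE//.
      rewrite (le_trans (normr_ge0 ((p.1 : R) + (loop kappa p.2 0 - loop_mean kappa N p.2))))//.
      rewrite (le_trans (ler_normD _ _))// lerD2l (le_trans (ler_normB _ _))// lerD//.
      by apply: hB; rewrite lexx ler01.
    rewrite (le_trans (ler_normD _ _))// lerD2l (le_trans (ler_normB _ _))// lerD//.
    exact: hB _ (@node_itv R _ i).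
  apply: (@cvg_trans _ (F N (step (nodes N) t) @[N --> \oo])).
    apply: near_eq_cvg; near=> N; rewrite (step_mktuple (F N))//.
    by near: N; exists 1%N.
  have h : (p.1 : R) + (loop kappa p.2 (step (nodes N) t) - loop_mean kappa N p.2)
      @[N --> \oo] --> (p.1 : R) + (loop kappa p.2 t - m).
    apply: cvgD; first exact: cvg_cst.
    apply: cvgB => //.
    by apply: continuous_cvg (cvg_step_nodes t01); exact: loop_continuous.
  by rewrite /F; under eq_fun do rewrite expr2; exact: (cvgM h h).
apply/funext => N; rewrite /mean_square; congr (_ * _).
by apply: eq_bigr => i _; rewrite tnth_loop tnth_mktuple.
Unshelve. all: by end_near. Qed.

(** The limit is again an exponential, hence positive; this keeps the limiting normalisation away
    from 0. *)
Lemma cvg_loop_weight (p : M * (M * M)) : exists l : R,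
  0 < l /\ loop_weight N p @[N --> \oo] --> l.
Proof.
have [u hu] := cvg_interp_loop kappa p; have [s hs] := cvg_mean_square_loop p.
have hP := cvg_Psi (tau := tau) bK cg mw w1 lPhi hu.
eexists; split; last first.
  apply: continuous_cvg; first exact: continuous_expR.
  apply: cvgN; apply: cvgD; first exact: hP.
  by apply: cvgM; [exact: cvg_cst|exact: hs].
exact: expR_gt0.
Qed.

Definition envelope (p : M * (M * M)) : R :=
  expR (tau * c) * expR (- (kappa / 2 * (p.1 : R) ^+ 2)).

(** The strict inequality [N1 < N] also provides N > 0. *)
Lemma loop_weight_le N p : (N1 < N)%N -> loop_weight N p <= envelope p.
Proof.
move=> NN; apply: (weight_le (ltnW NN)).
by apply: mean_square_loop_ge; exact: leq_ltn_trans NN.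
Qed.

Lemma integrable_envelope : (leb \x noise)%E.-integrable setT (EFin \o envelope).
Proof.
have k2 : 0 < kappa / 2 by rewrite divr_gt0.
have mf : measurable_fun setT (fun x : M => (expR (- (kappa / 2 * (x : R) ^+ 2)))%:E).
  apply/measurable_EFinP; apply: measurableT_comp => //; apply: measurableT_comp => //.
  by apply: measurable_funM => //; exact: measurable_funX.
suff ig : (leb \x noise)%E.-integrable setT
    (fun p => (expR (- (kappa / 2 * (p.1 : R) ^+ 2)))%:E).
  exact: (integrableZl measurableT (expR (tau * c)) ig).
apply/integrableP; split; first exact: (measurableT_comp mf).
have [C C0 hC] := integral_expR_sqr k2.
rewrite (_ : integral _ _ _ = C%:E) ?ltry//.
rewrite -hC; pose G (x : M) (e : M * M) : \bar R := (expR (- (kappa / 2 * (x : R) ^+ 2)))%:E.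
have mG : measurable_fun setT (fun p : M * (M * M) => G p.1 p.2).
  exact: (measurableT_comp mf).
have G0 x e : (0 <= G x e)%E by rewrite lee_fin expR_ge0.
transitivity (\int[leb]_x \int[noise]_e G x e)%E.
  rewrite -(@ge0_integral_prod _ _ _ _ _ leb noise G mG G0).
  by apply: eq_integral => p _; rewrite /= ger0_norm// expR_ge0.
by apply: eq_integral => x _; rewrite integral_probability_cst.
Qed.

Lemma measurable_loop_tuple N (F : N.-tuple R -> R) : tuple_continuous F ->
  measurable_fun setT (fun p => F (loop_tuple N p)).
Proof.
move=> /tuple_continuous_list_measurable mF; apply/measurable_EFinP.
apply: (measurable_list_comp mF) => [p|i iN]; first by rewrite size_mkseq.
exact: measurable_nth_loop_list.
Qed.

Lemma measurable_loop_interp N (phi : L2 R -> R) : continuous phi ->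
  measurable_fun setT (fun p => phi (loop_interp N p)).
Proof.
move=> cphi; exact: (measurable_loop_tuple (tuple_continuous_interp (N := N) cphi)).
Qed.

Lemma measurable_loop_weight N : measurable_fun setT (loop_weight N).
Proof.
exact: (measurable_loop_tuple (@tuple_continuous_weight N)).
Qed.

Variables (X : M * (M * M) -> L2 R) (W : M * (M * M) -> R).
Hypothesis cX : forall p, loop_interp N p @[N --> \oo] --> X p.
Hypothesis cW : forall p, loop_weight N p @[N --> \oo] --> W p.

Lemma measurable_limit_weight : measurable_fun setT W.
Proof.
by apply: (measurable_fun_cvg measurable_loop_weight) => p _; exact: cW.
Qed.

Lemma measurable_limit_loop : measurable_fun setT (X : _ -> borel (L2 R)).
Proof.
apply: measurable_borel => phi cphi.
apply: (measurable_fun_cvg (fun N => measurable_loop_interp N cphi)) => p _.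
have : phi (loop_interp N p) @[N --> \oo] --> phi (X p).
  by apply: continuous_cvg (@cX p); exact: cphi.
exact.
Qed.

Lemma cvg_loop_integral (phi : L2 R -> R) (B : R) : continuous phi ->
  (forall u, `|phi u| <= B) ->
  [/\ forall N, (N1 < N)%N -> (leb \x noise)%E.-integrable setT
        (fun p => (loop_weight N p * phi (loop_interp N p))%:E),
      (leb \x noise)%E.-integrable setT (fun p => (W p * phi (X p))%:E)
    & \int[(leb \x noise)%E]_p (loop_weight N p * phi (loop_interp N p)) @[N --> \oo]
      --> \int[(leb \x noise)%E]_p (W p * phi (X p))].
Proof.
move=> cphi phiB.
have mF N : measurable_fun setT (fun p => loop_weight N p * phi (loop_interp N p)).
  by apply: measurable_funM; [exact: measurable_loop_weight|exact: measurable_loop_interp].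
have iE : (leb \x noise)%E.-integrable setT (EFin \o (fun p => B * envelope p)).
  exact: (integrableZl measurableT B integrable_envelope).
have le N p : (N1 < N)%N ->
    `|loop_weight N p * phi (loop_interp N p)| <= B * envelope p.
  move=> NN; rewrite normrM mulrC ler_pM//.
  by rewrite ger0_norm ?expR_ge0// loop_weight_le.
have iF N : (N1 < N)%N -> (leb \x noise)%E.-integrable setT
    (fun p => (loop_weight N p * phi (loop_interp N p))%:E).
  move=> NN; apply: (le_integrable measurableT _ _ iE); first exact/measurable_EFinP.
  by move=> p _ /=; rewrite lee_fin (le_trans (le N p NN))// ler_norm.
(* Domination holds only for N > N1, so the sequence is shifted by [N1.+1] and shifted back at the
   end. *)
have cF p : loop_weight (n + N1.+1) p * phi (loop_interp (n + N1.+1) p) @[n --> \oo]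
    --> W p * phi (X p).
  apply: cvgM.
    by have := @cW p; rewrite -(cvg_shiftn N1.+1).
  apply: continuous_cvg; first exact: cphi.
  by have := @cX p; rewrite -(cvg_shiftn N1.+1).
have [iW cI] := dominated_cvg_Rintegral (fun n => mF (n + N1.+1)%N) cF iE
  (fun n p => le (n + N1.+1)%N p (leq_addl n N1.+1)).
by split => //; rewrite -(cvg_shiftn N1.+1).
Qed.

Lemma lebesgue_noise_neq0 : (leb \x noise)%E setT != 0%E.
Proof.
have -> : (leb \x noise)%E setT = (leb setT * noise setT)%E.
  by rewrite -setXTT; exact: product_measure1E.
rewrite mule_neq0//.
  have : (leb `[0%R, 1%R]%classic <= leb setT)%E by apply: le_measure; rewrite ?inE.
  rewrite lebesgue_measure_itv/= lte_fin ltr01 oppr0 adde0 => h.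
  by rewrite gt_eqF// (lt_le_trans _ h)// lte_fin ltr01.
suff -> : noise setT = 1%E by rewrite oner_neq0.
exact: probability_setT.
Qed.

Let J N (phi : L2 R -> R) : R :=
  \int[(leb \x noise)%E]_p (loop_weight N p * phi (loop_interp N p)).

Hypothesis W0 : forall p, 0 < W p.

Let Jlim (phi : L2 R -> R) : R := \int[(leb \x noise)%E]_p (W p * phi (X p)).

Let one : L2 R -> R := cst 1.

Let cone : continuous one.
Proof. exact: cst_continuous. Qed.

Let one1 u : `|one u| <= 1.
Proof. by rewrite normr1. Qed.

Let J1_gt0 N : (N1 < N)%N -> 0 < J N one.
Proof.
move=> NN; have [iF _ _] := cvg_loop_integral cone one1.
apply: Rintegral_gt0; [exact: lebesgue_noise_neq0| |exact: iF].
by move=> p; rewrite mulr1 expR_gt0.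
Qed.

Let Jlim1_gt0 : 0 < Jlim one.
Proof.
have [_ iF _] := cvg_loop_integral cone one1.
apply: Rintegral_gt0; [exact: lebesgue_noise_neq0| |exact: iF].
by move=> p; rewrite mulr1.
Qed.

(** [gibbs] is a bare set function; identifying its pushforward with a bundled probability makes the
    integral in [weakly_cvg] computable. The constant of [gibbs_integral] cancels in the
    quotient. *)
Lemma gibbs_law N : (N1 < N)%N -> exists P : probability (borel (L2 R)) R,
  pushforward (gibbs K g w Phi tau kappa (N := N))
    (@interp R N : N.-tuple R -> borel (L2 R)) = P /\
  forall (phi : L2 R -> R) (B : R), continuous phi -> (forall u, 0 <= phi u <= B) ->
    (\int[P]_u (phi u)%:E = (J N phi / J N one)%:E)%E.
Proof.
move=> NN; have N0 : (0 < N)%N by exact: leq_ltn_trans NN.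
have [C C0 hC] := gibbs_integral N0 (ltnW NN).
have hJ (phi : L2 R -> R) (B : R) : continuous phi -> (forall u, 0 <= phi u <= B) ->
    (\int[lebesgue_tuple R N]_f (expR (- Psi_full f) * phi (interp f))%:E =
     (C * J N phi)%:E)%E.
  move=> cphi phiB; rewrite (hC _ _ cphi phiB) EFinM; congr (_ * _)%E.
  have [|iF _ _] := cvg_loop_integral (B := B) cphi.
    by move=> u; have /andP[p0 pB] := phiB u; rewrite ger0_norm.
  by rewrite /J /Rintegral fineK//; exact: (integrable_fin_num measurableT (iF N NN)).
have Z1 : (\int[lebesgue_tuple R N]_f (expR (- Psi_full f))%:E = (C * J N one)%:E)%E.
  rewrite -(hJ _ 1 cone); last by move=> u; rewrite ler01 lexx.
  by apply: eq_integral => f _; rewrite mulr1.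
pose Z := \int[lebesgue_tuple R N]_f expR (- Psi_full f).
have ZE : Z = C * J N one by rewrite /Z /Rintegral Z1.
have Z0 : 0 < Z by rewrite ZE mulr_gt0// J1_gt0.
have cd := tuple_continuous_density N0.
have md := tuple_continuous_measurable cd.
have mh : measurable_fun setT (fun f : N.-tuple R => Z^-1 * expR (- Psi_full f)).
  exact: measurable_funM.
have Zi0 : (0 <= Z^-1%:E)%E by rewrite lee_fin invr_ge0 ltW.
have h0 (f : N.-tuple R) : 0 <= Z^-1 * expR (- Psi_full f).
  by rewrite mulr_ge0 ?expR_ge0// invr_ge0 ltW.
have h1 : (\int[lebesgue_tuple R N]_f (Z^-1 * expR (- Psi_full f))%:E = 1)%E.
  under eq_integral do rewrite EFinM.
  have mdE : measurable_fun setT (fun f : N.-tuple R => (expR (- Psi_full f))%:E).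
    exact/measurable_EFinP.
  rewrite (ge0_integralZl _ measurableT mdE)//.
  by rewrite Z1 -ZE -EFinM mulVf// gt_eqF.
have [P [PE hP]] := weighted_law (measurable_interp (R := R) (N := N)) mh h0 h1.
exists P; split; first by apply/funext => A; rewrite PE.
move=> phi B cphi phiB; rewrite hP; last 2 first.
- exact: continuous_measurable_borel.
- by exists B => u; have /andP[p0 pB] := phiB u; rewrite ger0_norm.
under eq_integral do rewrite -mulrA EFinM.
have mdphi : measurable_fun setT (fun f : N.-tuple R =>
    (expR (- Psi_full f) * phi (interp f))%:E).
  apply/measurable_EFinP; apply: measurable_funM => //.
  exact: tuple_continuous_measurable (tuple_continuous_interp (N := N) cphi).
rewrite (ge0_integralZl _ measurableT mdphi)//; last first.
  by move=> f _; rewrite lee_fin mulr_ge0 ?expR_ge0//; have /andP[] := phiB (interp f).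
rewrite (hJ _ B)// -EFinM; congr (_%:E); rewrite ZE.
have := J1_gt0 NN; move: C0 => /lt0r_neq0 C0 /lt0r_neq0 J0.
by field; rewrite C0 J0.
Qed.

Lemma limit_law : exists P : probability (borel (L2 R)) R,
  forall phi : L2 R -> R, continuous phi -> (exists B, forall u, `|phi u| <= B) ->
    (\int[P]_u (phi u)%:E = (Jlim phi / Jlim one)%:E)%E.
Proof.
have [_ iW _] := cvg_loop_integral cone one1.
pose h p := (Jlim one)^-1 * W p.
have mW := measurable_limit_weight.
have mh : measurable_fun setT h by exact: measurable_funM.
have h0 p : 0 <= h p by rewrite mulr_ge0// ?invr_ge0 ltW.
have iW' : (leb \x noise)%E.-integrable setT (EFin \o W).
  by apply: eq_integrable iW => // p _; rewrite mulr1.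
have h1 : (\int[leb \x noise]_p (h p)%:E = 1)%E.
  under eq_integral do rewrite EFinM.
  rewrite (integralZl measurableT iW') -(fineK (integrable_fin_num measurableT iW')).
  rewrite -EFinM (_ : fine _ = Jlim one) ?mulVf ?gt_eqF//.
  by apply: eq_Rintegral => p _; rewrite mulr1.
have [P [_ hP]] := weighted_law measurable_limit_loop mh h0 h1.
exists P => phi cphi [B phiB]; have [_ iF _] := cvg_loop_integral cphi phiB.
rewrite hP; last 2 first.
- exact: continuous_measurable_borel.
- by exists B.
under eq_integral do rewrite -mulrA EFinM.
rewrite (integralZl measurableT iF) -(fineK (integrable_fin_num measurableT iF)).
by rewrite -EFinM mulrC.
Qed.

Lemma gibbs_weakly_cvg : exists mu : probability (borel (L2 R)) R,
  weakly_cvg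
    (fun N => pushforward (gibbs K g w Phi tau kappa (N := N))
                (@interp R N : N.-tuple R -> borel (L2 R))) mu.
Proof.
have [P hP] := limit_law; exists P => phi /= cphi [B phiB].
(* [gibbs_law] treats nonnegative test functions, so [phi] is raised by its bound, which is
   subtracted again by [shift]. *)
pose psi (u : L2 R) : R := phi u + B.
have cpsi : continuous psi.
  by move=> u; apply: (@cvgD _ _ _ _ _ phi (cst B) _ _ (cphi u)); exact: cvg_cst.
have psiB u : 0 <= psi u <= B + B.
  have := phiB u; rewrite ler_norml => /andP[h1 h2].
  by rewrite /psi lerD2r h2 -[X in X <= _](addNr B) lerD2r h1.
have psiB' u : `|psi u| <= B + B.
  by have /andP[p0 pB] := psiB u; rewrite ger0_norm.
have mphi := continuous_measurable_borel cphi.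
have shift (Q : probability (borel (L2 R)) R) (r : R) :
    (\int[Q]_u (psi u)%:E = r%:E -> \int[Q]_u (phi u)%:E = (r - B)%:E)%E.
  rewrite (integral_probability_shift Q mphi phiB) => /(congr1 (fun x => x - B%:E)%E).
  by rewrite addeK.
rewrite (shift P _ (hP _ cpsi (ex_intro _ _ psiB'))).
have [_ _ c1] := cvg_loop_integral cone one1; have [_ _ c2] := cvg_loop_integral cpsi psiB'.
have cr : (J N psi / J N one - B)%:E @[N --> \oo] --> (Jlim psi / Jlim one - B)%:E.
  apply: cvg_EFin; first exact: nearW.
  apply: cvgB; last exact: cvg_cst.
  by apply: cvgM; [exact: c2|apply: cvgV; [rewrite gt_eqF|exact: c1]].
apply: cvg_trans cr; apply: near_eq_cvg; near=> N.
have NN : (N1 < N)%N by near: N; exact: nbhs_infty_gt.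
have [Q [-> hQ]] := gibbs_law NN.
by rewrite (shift Q _ (hQ _ _ cpsi psiB)).
Unshelve. all: by end_near. Qed.

End gibbs_convergence.

Theorem theorem4p1 (R : realType) (K : L2 R -> R -> R) (g w : R -> R)
    (Phi : R -> R -> R -> R) (tau kappa h0 c : R) (N1 : nat) :
  0 < tau -> 0 < kappa ->
  (forall p v, periodic1 (Phi p v)) ->
  A1 w -> A2 K g -> 0 < h0 -> 0 <= c -> A3 g Phi h0 c -> A4 Phi ->
  (forall N : nat, (N1 <= N)%N ->
     forall i : 'I_N, `|g_ g w i - g (node i)| <= h0) ->
  A5 K g w Phi tau kappa N1 ->
  exists mu : probability (borel (L2 R)) R,
    weakly_cvg
      (fun N => pushforward (gibbs K g w Phi tau kappa (N := N))
                  (@interp R N : N.-tuple R -> borel (L2 R)))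
      mu.
Proof.
move=> tau0 kappa0 _ [wL _ w1] [bK _ cg] _ c0 a3 [lPhi _ _ _ _] gN _.
have mw : measurable_fun [set: measurableTypeR R] w.
  by move: wL; rewrite inE => /andP[/[!inE]].
(* A3 with h = g_i - g(t_i), whose absolute value is at most [h0] for N >= N1. *)
have Phi_ge N : (N1 <= N)%N -> forall (f : N.-tuple R) (i : 'I_N),
    - c <= Phi (K_ K w f i) (g_ g w i) (node i).
  move=> NN f i; have [+ _] := a3 (K_ K w f i) (node i) _ (gN N NN i).
  by rewrite addrC subrK.
(* The limits are chosen separately at each sample point; their measurability follows from pointwise
   convergence. *)
have [X cX] := choice (cvg_interp_loop kappa).
have [W hW] := choice (cvg_loop_weight tau kappa bK cg mw w1 lPhi).
exact: (gibbs_weakly_cvg tau0 kappa0 c0 bK mw w1 lPhi Phi_ge cX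
  (fun p => (hW p).2) (fun p => (hW p).1)).
Qed.
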